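(* Let $\alpha$ be a composition and $n$ a positive integer. Then $$\Psi_n\cdot\mathbf s_\alpha=\sum_{\beta\in P_{\alpha,n}}(-1)^{ht(\beta/\!\!/\alpha)}\,\mathbf s_\beta ,$$ where $P_{\alpha,n}$ is the set of compositions $\beta$ with $\alpha<_c\beta$ such that $\beta/\!\!/\alpha$ is an nc border strip with $n$ boxes and $NE(\beta/\!\!/\alpha)=\emptyset$.
   Context: A composition is a finite sequence $\alpha=(\alpha_1,\dots,\alpha_k)$ of positive integers; $\ell(\alpha)=k$, $|\alpha|=\sum_i\alpha_i$, and $\alpha\vDash N$ means $|\alpha|=N$. Its diagram is the set of boxes $(i,j)$ with $1\le i\le\ell(\alpha)$, $1\le j\le\alpha_i$; box $(i,j)$ lies in row $i$ and column $j$, rows numbered top to bottom, columns left to right. For compositions $\gamma=(\gamma_1,\dots,\gamma_l)$ and $\delta$ write $\gamma\lessdot_c\delta$ if either $\delta=(1,\gamma_1,\dots,\gamma_l)$, or $\delta=(\gamma_1,\dots,\gamma_k+1,\dots,\gamma_l)$ for some $k$ with $\gamma_i\ne\gamma_k$ for all $i<k$. Let $<_c$ be the transitive closure of $\lessdot_c$. If $\gamma<_c\delta$, the skew shape $\delta/\!\!/\gamma$ is the set of boxes of $\delta$ not in the inner shape, where the inner shape $\gamma$ sits in the bottom $\ell(\gamma)$ rows of $\delta$, i.e. consists of the boxes $(\ell(\delta)-\ell(\gamma)+i,j)$, $1\le i\le\ell(\gamma)$, $1\le j\le\gamma_i$. For $\alpha<_c\beta$: $\mathrm{supp}(\beta/\!\!/\alpha)$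 is the set of columns containing a box of $\beta/\!\!/\alpha$; $\beta/\!\!/\alpha$ is an interval shape if this set consists of consecutive integers. An interval shape is an nc border strip if (1) whenever $(i,1),(i,2)\in\beta/\!\!/\alpha$, the box $(i,1)$ is the bottommost box of column 1 of $\beta/\!\!/\alpha$, and (2) whenever $(i,j),(i,j+1)\in\beta/\!\!/\alpha$ with $j\ge2$, the box $(i,j)$ is the topmost box of column $j$ of $\beta/\!\!/\alpha$. Its height $ht(\beta/\!\!/\alpha)$ is one less than the number of rows containing boxes of $\beta/\!\!/\alpha$. $NE(\beta/\!\!/\alpha)$ is the set of $j\in\mathrm{supp}(\beta/\!\!/\alpha)$ such that column $j+1$ of $\beta/\!\!/\alpha$ contains at least one box and $i_1<i_2$ for all boxes $(i_1,j+1),(i_2,j)\in\beta/\!\!/\alpha$. $\mathbf{NSym}=\mathbb Q\langle\mathbf h_1,\mathbf h_2,\dots\rangle$ is the free associative algebra; $\mathbf h_\alpha=\mathbf h_{\alpha_1}\cdots\mathbf h_{\alpha_k}$. Write $\alpha\succcurlyeq\beta$ if the parts of $\alpha$ are obtained by adding together consecutive parts of $\beta$. The ribbon functions are $\mathbf r_\beta=\sum_{\alpha\succcurlyeq\beta}(-1)^{\ell(\beta)-\ell(\alpha)}\mathbf h_\alpha$ and $\Psi_n=\sum_{k=0}^{n-1}(-1)^k\mathbf r_{(1^k,n-k)}$. A standard reverse composition tableau (SRCT) of shape $\alpha\vDash N$ is a bijective filling $\tau$ of the diagram of $\alpha$ by $1,\dots,N$ such that rows decrease left to right, the first column increases top to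 bottom, and for all $i<j$, $k\ge1$ with $(j,k+1)\in\alpha$, $(i,k)\in\alpha$ and $\tau(i,k)>\tau(j,k+1)$, one has $(i,k+1)\in\alpha$ and $\tau(i,k+1)>\tau(j,k+1)$. Its descent set is the set of $i\in[N-1]$ such that $i+1$ lies in a column weakly right of the column of $i$; its descent composition is $(s_1,s_2-s_1,\dots,N-s_j)$ where $s_1<\dots<s_j$ are the descents. Let $d_{\alpha,\beta}$ be the number of SRCTs of shape $\alpha$ with descent composition $\beta$. The noncommutative Schur functions $\mathbf s_\alpha$ are the (unique) elements of $\mathbf{NSym}$ with $\mathbf r_\beta=\sum_{\alpha\vDash|\beta|}d_{\alpha,\beta}\mathbf s_\alpha$ for every composition $\beta$. *)

(* Defs.v *)
From HB Require Import structures.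
From mathcomp Require Import all_boot all_order all_algebra.
Set Implicit Arguments. Unset Strict Implicit. Unset Printing Implicit Defensive.
Import Order.TTheory GRing.Theory Num.Theory.

Definition is_comp (a : seq nat) : bool := all (fun x => 0 < x) a.

Fixpoint seqs_len (k m : nat) : seq (seq nat) :=
  if k is k'.+1 then
    flatten [seq [seq x :: s | s <- seqs_len k' m] | x <- iota 1 m]
  else [:: [::]].

Definition compositions (N : nat) : seq (seq nat) :=
  flatten [seq [seq s <- seqs_len k N | sumn s == N] | k <- iota 0 N.+1].

Definition cover_c (g d : seq nat) : bool :=
  (d == 1 :: g) ||
  has (fun k => (d == incr_nth g k) &&
                all (fun i => nth 0 g i != nth 0 g k) (iota 0 k))
      (iota 0 (size g)).

Definition covers_of (g : seq nat) : seq (seq nat) :=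
  (1 :: g) :: [seq incr_nth g k | k <- iota 0 (size g) &
                 all (fun i => nth 0 g i != nth 0 g k) (iota 0 k)].

Fixpoint chain_c (k : nat) (g d : seq nat) : bool :=
  if k is k'.+1 then has (fun e => chain_c k' e d) (covers_of g)
  else g == d.

(* transitive closure <_c : since every cover step raises |.| by exactly 1,
   a chain from g to d has exactly |d| - |g| >= 1 steps. *)
Definition lt_c (g d : seq nat) : bool :=
  (sumn g < sumn d) && chain_c (sumn d - sumn g) g d.

(* Skew shapes beta//alpha; boxes (i,j) are 1-indexed (row, column).   *)
Definition in_inner (b a : seq nat) (i j : nat) : bool :=
  (size b - size a < i) && (j <= nth 0 a (i - (size b - size a)).-1).

Definition skew_boxes (b a : seq nat) : seq (nat * nat) :=
  [seq p <- flatten [seq [seq (i, j) | j <- iota 1 (nth 0 b i.-1)]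
                    | i <- iota 1 (size b)] | ~~ in_inner b a p.1 p.2].

Definition in_skew (b a : seq nat) (i j : nat) : bool :=
  (i, j) \in skew_boxes b a.

Definition supp (b a : seq nat) : seq nat := undup (map snd (skew_boxes b a)).

Definition interval_shape (b a : seq nat) : bool :=
  let cs := supp b a in
  all (fun j1 => all (fun j2 => all (fun j => j \in cs) (iota j1 (j2 - j1))) cs) cs.

Definition nc_border_strip (b a : seq nat) : bool :=
  let B := skew_boxes b a in
  [&& interval_shape b a,
   all (fun p => (p.2 == 1) ==> in_skew b a p.1 2 ==>
                   all (fun q => (q.2 == 1) ==> (q.1 <= p.1)) B) B &
   all (fun p => (2 <= p.2) ==> in_skew b a p.1 p.2.+1 ==>
                   all (fun q => (q.2 == p.2) ==> (p.1 <= q.1)) B) B].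

Definition ht (b a : seq nat) : nat := (size (undup (map fst (skew_boxes b a)))).-1.

Definition NE (b a : seq nat) : seq nat :=
  let B := skew_boxes b a in
  [seq j <- supp b a |
     has (fun q => q.2 == j.+1) B &&
     all (fun q1 => (q1.2 == j.+1) ==>
            all (fun q2 => (q2.2 == j) ==> (q1.1 < q2.1)) B) B].

Definition P_set (a : seq nat) (n : nat) : seq (seq nat) :=
  [seq b <- compositions (sumn a + n) |
     [&& lt_c a b, nc_border_strip b a, size (skew_boxes b a) == n
       & nilp (NE b a)]].

(* NSym = Q<h_1,h_2,...>.  An element is identified with its           *)
(* coefficient function on the words h_gamma (gamma a composition);    *)
(* multiplication is the concatenation (monoid-algebra) product.       *)
Local Open Scope ring_scope.
Definition nsym := seq nat -> rat.

Definition nh (a : seq nat) : nsym := fun g => (g == a)%:R.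

Definition nmul (f g : nsym) : nsym :=
  fun w => \sum_(i < (size w).+1) f (take i w) * g (drop i w).

Fixpoint coarsens (a b : seq nat) : bool :=
  if a is x :: a' then
    has (fun k => (sumn (take k b) == x) && coarsens a' (drop k b)) (iota 1 (size b))
  else nilp b.

Definition nr (b : seq nat) : nsym :=
  fun w => \sum_(a <- compositions (sumn b) | coarsens a b)
             (-1) ^+ (size b - size a)%N * nh a w.

Definition Psi (n : nat) : nsym :=
  fun w => \sum_(k < n) (-1) ^+ k * nr (nseq k 1 ++ [:: (n - k)%N]) w.

Local Close Scope ring_scope.

(* A filling of shape a is a seq of rows; tau(i,k) is 1-indexed.       *)
Definition tau (T : seq (seq nat)) (i k : nat) : nat := nth 0 (nth [::] T i.-1) k.-1.
Definition in_shape (a : seq nat) (i k : nat) : bool :=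
  [&& 1 <= i, i <= size a, 1 <= k & k <= nth 0 a i.-1].

Definition is_srct (a : seq nat) (T : seq (seq nat)) : bool :=
  [&& map size T == a,
      perm_eq (flatten T) (iota 1 (sumn a)),
      all (fun r => sorted (fun x y => y < x) r) T,
      sorted ltn (map (head 0) T) &
      all (fun i => all (fun j => (i < j) ==>
        all (fun k =>
          (in_shape a j k.+1 && in_shape a i k && (tau T j k.+1 < tau T i k)) ==>
          (in_shape a i k.+1 && (tau T j k.+1 < tau T i k.+1)))
          (iota 1 (nth 0 a j.-1)))
        (iota 1 (size a))) (iota 1 (size a))].

Definition srcts (a : seq nat) : seq (seq (seq nat)) :=
  [seq T <- [seq reshape a p | p <- permutations (iota 1 (sumn a))] | is_srct a T].

(* column (0-indexed) of the entry v in T *)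
Definition col_of (T : seq (seq nat)) (v : nat) : nat :=
  index v (nth [::] T (find (fun r => v \in r) T)).

Definition descents (T : seq (seq nat)) : seq nat :=
  let N := size (flatten T) in
  [seq i <- iota 1 N.-1 | col_of T i <= col_of T i.+1].

Definition descent_comp (T : seq (seq nat)) : seq nat :=
  let N := size (flatten T) in
  if N is 0 then [::]
  else pairmap (fun x y => y - x) 0 (rcons (descents T) N).

Definition d_coef (a b : seq nat) : nat :=
  count (fun T => descent_comp T == b) (srcts a).

(* Noncommutative Schur functions: the unique s_alpha with            *)
(*   r_beta = \sum_{alpha |= |beta|} d_{alpha,beta} s_alpha.           *)
(* In degree N let cs = compositions N and M beta alpha = d_{alpha,beta};*)
(* then r = M s, so s = M^{-1} r (M is invertible).                    *)
Local Open Scope ring_scope.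
Definition dmat (N : nat) : 'M[rat]_(size (compositions N)) :=
  \matrix_(i, j) (d_coef (nth [::] (compositions N) j) (nth [::] (compositions N) i))%:R.

Definition ns (a : seq nat) : nsym :=
  fun w =>
    let N := sumn a in
    let cs := compositions N in
    \sum_(i < size cs | nat_of_ord i == index a cs)
      \sum_(j < size cs) invmx (dmat N) i j * nr (nth [::] cs j) w.

(* Main.v *)
Require Import Defs.
From HB Require Import structures.
From mathcomp Require Import all_boot all_order all_algebra.
From mathcomp Require Import zify.
Import Order.TTheory GRing.Theory Num.Theory.

(** Adding a box in column [c] to a composition can be done in at most one way
    along a cover of [<_c], so SRCTs of shape [a] are the column words [w] whose
    box-adding operators, applied from the last letter to the first, lead from
    the empty composition to [a]; descents of the tableau are the weak ascents
    of [w].  Since [r_a r_b] is the sum of the two ribbons obtained by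
    concatenating and near-concatenating [a] and [b], cutting words in two gives
    that the coefficient of [s_b] in [Psi_n s_a] is the signed number of words
    of length [n] that increase weakly, then decrease strictly, and lead from
    [a] to [b].  This uses that the matrix of the [d_{a,b}] is invertible: it is
    unitriangular for the order by length, then lexicographic.

    Such a hook word with least letter [j] is [j^n] or [j^a u j^e] with [u] a
    hook word in larger letters and [e] equal to 0 or 1.  Operators of
    nonadjacent columns commute, so only the two columns [j] and [j+1] decide
    whether the choices [e = 0] and [e = 1] lead to [b].  If both do, all boxes
    of column [j+1] lie above those of column [j] (or column [j+1] is empty) and
    the contributions cancel; if one does, the pair of columns is that of an nc
    border strip, the choice [e = 1] corresponding to a row having boxes in both
    columns.  Induction on the columns gives the theorem. *)

Set Implicit Arguments.
Unset Strict Implicit.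
Unset Printing Implicit Defensive.

(** * Hook words *)

(** The height arises as follows. In [j^a u j^e] every leading letter carries a sign. The shapes
    before and after [u] are forced by [j], [e] and the two end shapes, so [a] is forced too: it is
    the number of rows whose last new box lies in column [j], except the row that a final letter [j]
    has just completed. Every row of a strip is thus counted once, at its last column, and the
    innermost word, a power of one letter, has one sign less than letters; the exponent is the
    number of rows minus one. If the first row of length [j-1] ends in column [j], a final letter
    [j] saves one leading letter, whence opposite signs for the two choices. A final letter changes
    the inner shape, so the induction has to run over arbitrary pairs of shapes. The predicate it
    proves must contain the trace that the cover relation leaves on the boxes, while [<_c] itself is
    recovered at the end from the sum being nonzero. *)

Fixpoint words (j k n : nat) : seq (seq nat) :=
  if n is n'.+1 then
    flatten [seq [seq x :: s | s <- words j k n'] | x <- iota j k]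
  else [:: [::]].

Lemma words1 k m : seqs_len k m = words 1 m k.
Proof. by elim: k => //= k ->. Qed.

Lemma mem_words j k n u :
  (u \in words j k n) = (size u == n) && all (fun c => j <= c < j + k) u.
Proof.
elim: n u => [|n IH] [|c u] //=; first by apply/negP => /flatten_mapP[x _ /mapP[]].
apply/flatten_mapP/idP => [[x xi /mapP[s]]|/and3P[su cj au]].
  by rewrite IH => /andP[/eqP<- sa] [-> ->]; rewrite eqxx -mem_iota xi.
exists c; first by rewrite mem_iota.
by apply/mapP; exists u => //; rewrite IH -eqSS su.
Qed.

Lemma words_uniq j k n : uniq (words j k n).
Proof.
elim: n => //= n IH; apply: allpairs_uniq => //; first exact: iota_uniq.
by move=> [a b] [c d] _ _ /= [-> ->].
Qed.

Arguments words : simpl never.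

Definition sdec (u : seq nat) := sorted gtn u.
Arguments sdec : simpl never.

Local Open Scope ring_scope.

(** Used to match each kind of hook word with the shorter words, or words in fewer letters, that it
    comes from. *)
Lemma big_reindex_support (R : nmodType) (A B : eqType) (s : seq A) (t : seq B)
    (P : pred A) (h : B -> A) (F : A -> R) :
  uniq s -> uniq t -> {in t &, injective h} ->
  {in t, forall y, (h y \in s) && P (h y)} ->
  (forall x, x \in s -> P x -> x \notin map h t -> F x = 0) ->
  \sum_(x <- s | P x) F x = \sum_(y <- t) F (h y).
Proof.
move=> us ut hi ht hF.
rewrite (bigID (mem (map h t))) /= [X in _ + X]big1_seq ?addr0; last first.
  by move=> x /andP[/andP[Px xt] xs]; exact: hF.
rewrite -(big_map h predT F) -big_filter; apply: perm_big.
apply: uniq_perm; rewrite ?filter_uniq ?map_inj_in_uniq //.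
move=> x; rewrite mem_filter; apply/idP/idP => [/andP[/andP[]]//|xt].
by rewrite xt andbT; case/mapP: xt => y yt ->; rewrite andbC; exact: ht.
Qed.

(* The sign with which a word occurs in Psi: (-1)^k for a word weakly
   increasing on its first k steps and strictly decreasing afterwards. *)
Fixpoint hook_sign (u : seq nat) : rat :=
  if u is c :: v then
    if v is d :: _ then
      if (c <= d)%N then - hook_sign v else (sdec v)%:R
    else 1
  else 0.

Lemma hook_sign_sdec u : u != [::] -> sdec u -> hook_sign u = 1.
Proof.
case: u => // c [|d u] // _ /andP[/= dc du].
by rewrite leqNgt dc /= [sdec _]du.
Qed.

Lemma hook_sign_min c u :
  u != [::] -> all (leq c) u -> hook_sign (c :: u) = - hook_sign u.
Proof. by case: u => // d u _ /= /andP[-> _]. Qed.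

Lemma sdec_rcons j u : all (ltn j) u -> sdec (rcons u j) = sdec u.
Proof.
rewrite /sdec; case: u => //= c u /andP[cj uj].
rewrite rcons_path /= andb_idr // => _.
by move: (mem_last c u); rewrite inE => /orP[/eqP->//|/(allP uj)].
Qed.

Lemma hook_sign_rcons j u :
  u != [::] -> all (ltn j) u -> hook_sign (rcons u j) = hook_sign u.
Proof.
elim: u => // c [_ _|d u IH _ /= /andP[cj]]; first by rewrite /= => /andP[]; rewrite ltnNge; case: leqP.
move=> uj; have /= h1 := @sdec_rcons j (d :: u) uj.
by have /= h2 := IH isT uj; rewrite h1 h2.
Qed.

(** A hook word rises and then falls strictly, so a least letter that is not at the beginning can
    only be the last letter, and occurs once. *)
Lemma hook_sign_interior_min j u :
  all (leq j) u -> (j < head 0 u)%N -> hook_sign u != 0 -> j \in u ->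
  exists2 v, u = rcons v j & (v != [::]) && all (ltn j) v.
Proof.
elim: u => // c [|d u] IH; first by rewrite inE /= => _ jc _ /eqP jE; lia.
move=> /andP[_ ju] /= jc hs; rewrite inE => /orP[/eqP jE|ju']; first by lia.
have [jd|jd] := ltnP j d; last first.
  have jE : j = d by move: ju => /= /andP[]; lia.
  subst d; move: hs; rewrite leqNgt jc /=; case: u {IH ju'} ju => [|e u] ju.
    by move=> _; exists [:: c] => //=; rewrite jc.
  by move: ju => /and3P[_ je _]; rewrite /sdec /= ltnNge je eqxx.
have hs' : hook_sign (d :: u) != 0.
  move: hs; case: ifP => _; first by rewrite oppr_eq0.
  by move=> hs; case: (boolP (sdec (d :: u))) hs; rewrite ?eqxx // => h _; rewrite hook_sign_sdec.
have [v E /andP[v0 vj]] := IH ju jd hs' ju'.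
by exists (c :: v); rewrite ?E //= jc.
Qed.

Definition hook_sum j k n (F : seq nat -> rat) :=
  \sum_(u <- words j k n) hook_sign u * F u.

Lemma hook_sum0 j k F : hook_sum j k 0 F = 0.
Proof. by rewrite /hook_sum big_seq1 mul0r. Qed.

Lemma eq_hook_sum j k n F G :
  (forall u, size u = n -> all (leq j) u -> F u = G u) ->
  hook_sum j k n F = hook_sum j k n G.
Proof.
move=> FG; rewrite /hook_sum big_seq [RHS]big_seq; apply: eq_bigr => u.
rewrite mem_words => /andP[/eqP su au]; rewrite FG //.
by apply: sub_all au => c /andP[].
Qed.

(** The three terms are the words beginning with [j], those without [j], and those whose only [j] is
    the last letter. In the first, the step after the initial [j] is a weak increase and costs a
    sign, unless the word is the single letter [j]. *)
Lemma hook_sumS j k n F : hook_sum j k.+1 n.+1 F =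
  (if n is 0 then F [:: j] else - hook_sum j k.+1 n (fun u => F (j :: u)))
  + hook_sum j.+1 k n.+1 F + hook_sum j.+1 k n (fun u => F (rcons u j)).
Proof.
rewrite /hook_sum (bigID (fun u => head 0%N u == j)) /= -addrA; congr (_ + _).
  rewrite (@big_reindex_support _ _ _ _ (words j k.+1 n) _ (cons j)).
  - case: n => [|n]; first by rewrite big_seq1 /= mul1r.
    rewrite -sumrN big_seq [RHS]big_seq; apply: eq_bigr => u.
    rewrite mem_words => /andP[/eqP su au].
    rewrite hook_sign_min ?mulNr //; first by case: (u) su.
    by apply: sub_all au => c /andP[].
  - exact: words_uniq.
  - exact: words_uniq.
  - by move=> u v _ _ [].
  - move=> u; rewrite !mem_words /= eqSS eqxx => /andP[-> ->].
    by rewrite leqnn andbT /=; lia.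
  - move=> [|c u]; rewrite mem_words //= eqSS => /and3P[su _ au] /eqP-> /mapP[].
    by exists u; rewrite // mem_words su.
have hd u : u \in words j k.+1 n.+1 -> head 0%N u != j -> (j < head 0 u)%N.
  rewrite mem_words => /andP[]; case: u => //= c u _ /andP[h _] cj.
  by lia.
rewrite (bigID (all (ltn j))) /=; congr (_ + _).
  rewrite (@big_reindex_support _ _ _ _ (words j.+1 k n.+1) _ id) //.
  - exact: words_uniq.
  - exact: words_uniq.
  - move=> u; rewrite !mem_words => /andP[/eqP su au].
    rewrite su eqxx /=; apply/and3P; split.
    + by apply: sub_all au => c; lia.
    + by case: (u) su au => //= c v _ /andP[]; lia.
    + by apply: sub_all au => c /andP[].
  - move=> u; rewrite map_id !mem_words => /andP[/eqP-> au] /andP[_ ju].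
    rewrite eqxx /= => /allPn[c cu]; move/(allP ju): (cu); move/(allP au): cu.
    by move=> /=; lia.
(* In length one the third kind is empty, its letter [j] being also the initial one; this agrees
   with [hook_sign] being 0 on the empty word. *)
case: n hd => [|n] hd.
  rewrite -/(hook_sum _ _ _ _) hook_sum0 big1_seq // => u /andP[/andP[uj au]].
  move=> uw; case: u uj au uw (hd _ uw uj) => [|c [|d u]]; rewrite mem_words //=.
  by move=> _ /negP jc _ cj; case: jc; rewrite cj.
rewrite (@big_reindex_support _ _ _ _ (words j.+1 k n.+1) _ (fun u => rcons u j)).
- rewrite big_seq [RHS]big_seq; apply: eq_bigr => u.
  rewrite mem_words => /andP[/eqP su au]; rewrite hook_sign_rcons //.
    by case: (u) su.
  by apply: sub_all au => c /andP[].
- exact: words_uniq.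
- exact: words_uniq.
- by move=> u v _ _ /rcons_inj[].
- move=> u; rewrite !mem_words size_rcons eqSS => /andP[/eqP su au].
  rewrite su eqxx.
  rewrite !all_rcons /= ltnn leqnn andbT /=; apply/andP; split.
    by apply/andP; split; [lia | apply: sub_all au => c; lia].
  by case: u su au => //= c u _ /andP[]; lia.
- move=> u uw /andP[uj uN] uv.
  have [->|h0] := eqVneq (hook_sign u) 0; first by rewrite mul0r.
  have := uw; rewrite mem_words => /andP[/eqP su au].
  have ju : all (leq j) u by apply: sub_all au => c /andP[].
  have jin : j \in u.
    move/allPn: uN => [c cu]; rewrite -leqNgt => cj.
    by move/(allP ju): (cu) => /= jc; have -> : j = c by lia.
  have [v E /andP[v0 vj]] := hook_sign_interior_min ju (hd _ uw uj) h0 jin.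
  case/negP: uv; apply/mapP; exists v => //; rewrite mem_words.
  move: su au; rewrite E size_rcons all_rcons => -[->] /andP[_ av].
  rewrite eqxx /=; apply/allP => c cv; move/(allP av): (cv); move/(allP vj): cv.
  by move=> /=; lia.
Qed.

(** The recursion unfolded over the number [a] of leading letters [j]. The power of [j] stands apart
    because its last letter carries no sign. *)
Lemma hook_sum_split j k n F : hook_sum j k.+1 n.+1 F =
  (-1) ^+ n * F (nseq n.+1 j)
  + \sum_(a < n.+1) (-1) ^+ a *
      (hook_sum j.+1 k (n.+1 - a) (fun u => F (nseq a j ++ u))
       + hook_sum j.+1 k (n - a) (fun u => F (nseq a j ++ rcons u j))).
Proof.
elim: n F => [|n IH] F; rewrite hook_sumS; first by rewrite big_ord1 subn0 !mul1r addrA.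
rewrite IH [in RHS]big_ord_recl /= !subn0 mul1r opprD -sumrN exprS mulN1r mulNr -!addrA.
congr (_ + _); rewrite addrC -addrA; congr (_ + (_ + _)).
by apply: eq_bigr => a _; rewrite /bump /= add1n subSS exprS mulN1r mulNr.
Qed.

Local Close Scope ring_scope.

(** * Box-adding operators *)

(* The unique cover of [g] in the order [<_c] that adds a box in column [c]. *)
Definition add_box (c : nat) (g : seq nat) : option (seq nat) :=
  if c == 1 then Some (1 :: g)
  else if c.-1 \in g then Some (incr_nth g (index c.-1 g)) else None.

(* The rightmost letter acts first. *)
Definition act (u : seq nat) (g : seq nat) : option (seq nat) :=
  foldr (fun c => obind (add_box c)) (Some g) u.

Definition first_at (v : nat) (x : seq nat) (r : nat) :=
  [/\ r < size x, nth 0 x r = v & forall i, i < r -> nth 0 x i <> v].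

Lemma act_cat u v g : act (u ++ v) g = obind (act u) (act v g).
Proof.
rewrite /act foldr_cat; case: (foldr _ _ v) => //=.
by elim: u => //= c u ->.
Qed.

Lemma add_box_first c x r :
  1 < c -> first_at c.-1 x r -> add_box c x = Some (incr_nth x r).
Proof.
move=> c1 [rs xr lt]; rewrite /add_box ifN ?neq_ltn ?c1 ?orbT //.
have xin : c.-1 \in x by rewrite -xr mem_nth.
rewrite xin; congr (Some (incr_nth _ _)).
case: (ltngtP (index c.-1 x) r) => // [/lt|/(before_find 0) /=].
  by rewrite nth_index.
by rewrite xr eqxx.
Qed.

Lemma first_at_index v x : v \in x -> first_at v x (index v x).
Proof.
move=> vx; split; rewrite ?index_mem ?nth_index // => i /(before_find 0) /=.
by move/eqP.
Qed.

Lemma add_box_inv c x y : 1 < c -> add_box c x = Some y ->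
  exists2 r, first_at c.-1 x r & y = incr_nth x r.
Proof.
move=> c1; rewrite /add_box ifN ?neq_ltn ?c1 ?orbT //.
case: ifP => // xin [<-]; exists (index c.-1 x) => //.
exact: first_at_index.
Qed.

Lemma sumn_incr_nth x r : sumn (incr_nth x r) = (sumn x).+1.
Proof.
elim: x r => [|a x IH] [|r] //=; last by rewrite IH addnS.
by elim: r => //= r; rewrite add0n.
Qed.

Lemma add_box_sumn c x y : add_box c x = Some y -> sumn y = (sumn x).+1.
Proof.
rewrite /add_box; case: ifP => _; first by case=> <-.
by case: ifP => // xin [<-]; rewrite sumn_incr_nth.
Qed.

Lemma act_sumn u x y : act u x = Some y -> sumn y = sumn x + size u.
Proof.
elim: u y => [|c u IH] y /=; first by case=> <-; rewrite addn0.
by case: (act u x) (IH) => //= z /(_ _ erefl) E /add_box_sumn; lia.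
Qed.

Lemma size_incr_first x r : r < size x -> size (incr_nth x r) = size x.
Proof. by move=> h; rewrite size_incr_nth h. Qed.

(** A letter [c] lengthens a row of length [c-1], so letters from [j] on never touch a row shorter
    than [j-1]. *)
Lemma act_ge j u x y : 1 < j -> all (leq j) u -> act u x = Some y ->
  size y = size x /\ forall i, nth 0 x i <= nth 0 y i /\
    (nth 0 x i < nth 0 y i -> j <= (nth 0 x i).+1).
Proof.
move=> j1; elim: u y => [|c u IH] y /=; first by move=> _ [<-]; split=> // i; lia.
case/andP=> jc ju; case: (act u x) (IH) => //= z /(_ _ ju erefl) [sz hz].
case/add_box_inv=> [|r [rs xr _] ->]; first by lia.
rewrite size_incr_first //; split=> // i; rewrite nth_incr_nth.
by have := hz i; case: eqVneq => [<-|]; rewrite ?xr; lia.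
Qed.

(** The effect of a power of the operator of column [j] on row lengths. Since it always takes the
    topmost row of length [j-1], a row is passed over only if no lower row is used. *)
Definition fills j (Z Y : nat -> nat) :=
  (forall i, Y i = Z i \/ (Z i = j.-1 /\ Y i = j)) /\
  (forall i i', i < i' -> Z i' < Y i' -> Z i = j.-1 -> Z i < Y i).

Lemma sumn_nth x : sumn x = \sum_(i < size x) nth 0 x i.
Proof. by rewrite sumnE (big_nth 0) big_mkord. Qed.

Definition rows (x y : seq nat) := \sum_(i < size y) (nth 0 x i < nth 0 y i : nat).

Lemma sumn_rows z y : size z = size y ->
  (forall i, nth 0 y i = nth 0 z i \/ nth 0 y i = (nth 0 z i).+1) ->
  sumn y = sumn z + rows z y.
Proof.
move=> s h; rewrite !sumn_nth s -big_split; apply: eq_bigr => i _ /=.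
by have := h i; lia.
Qed.

Lemma leq_sumn x y : size x = size y -> (forall i, nth 0 x i <= nth 0 y i) ->
  sumn x <= sumn y.
Proof. by move=> s h; rewrite !sumn_nth s leq_sum. Qed.

Lemma ltn_sumn x y i : size x = size y ->
  (forall i, nth 0 x i <= nth 0 y i) -> nth 0 x i < nth 0 y i ->
  sumn x < sumn y.
Proof.
move=> s h xy; have iy : i < size y.
  by case: (ltnP i (size y)) xy => // /(nth_default 0)->.
rewrite !sumn_nth s (bigD1 (Ordinal iy)) //= [ltnRHS](bigD1 (Ordinal iy)) //=.
by rewrite -addSn leq_add // leq_sum.
Qed.

Lemma sumn_eq x y : size x = size y -> (forall i, nth 0 x i <= nth 0 y i) ->
  sumn x = sumn y -> x = y.
Proof.
move=> s h e; apply: (@eq_from_nth _ 0) => // i _.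
by case: (ltngtP (nth 0 x i) (nth 0 y i)) (h i) => // /(ltn_sumn s h); lia.
Qed.

Lemma act_nseq a j z y : 1 < j -> size z = size y ->
  act (nseq a j) z = Some y <->
  fills j (nth 0 z) (nth 0 y) /\ sumn y = sumn z + a.
Proof.
move=> j1; elim: a z => [|a IH] z s.
  rewrite /= addn0; split=> [[->]|[[f1 _] e]]; first by split=> //; split=> i; lia.
  by congr Some; apply: sumn_eq => // i; have := f1 i; lia.
(* The letter that acts first is split off at the right end of the word. *)
rewrite -addn1 nseqD act_cat /=; split.
  case E: add_box => [z'|//] /= h.
  have [//|r [rs zr lt] zE] := add_box_inv _ E.
  have s' : size z' = size y by rewrite zE size_incr_first.
  have [[f1 f2] e] := (IH _ s').1 h; have nz' i : nth 0 z' i = (r == i) + nth 0 z i.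
    by rewrite zE nth_incr_nth.
  split; last by rewrite e (add_box_sumn E); lia.
  split=> [i|i i' ii'].
    by have := f1 i; rewrite nz'; case: eqVneq => [<-|]; rewrite ?zr; lia.
  have := f1 i; have := f1 i'; have := f2 _ _ ii'; rewrite !nz'.
  case: (eqVneq r i) => [E1|]; first by subst; lia.
  case: (eqVneq r i') => [E1|]; last by lia.
  by subst=> _ _ _ _ _ /(lt _ ii').
case=> [[f1 f2] e].
have [i0 i0P] : exists i, nth 0 z i < nth 0 y i.
  case: (boolP (has (fun i => nth 0 z i < nth 0 y i) (iota 0 (size y)))).
    by case/hasP=> i _ h; exists i.
  move/hasPn=> h; suff : sumn y <= sumn z by lia.
  apply: leq_sumn => // i; case: (ltnP i (size y)) => iy.
    by have := h i; rewrite mem_iota => /(_ iy); lia.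
  by rewrite nth_default.
have zi0 : nth 0 z i0 = j.-1 by have := f1 i0; lia.
have zin : j.-1 \in z.
  rewrite -zi0 mem_nth //; case: (ltnP i0 (size z)) => // h; move: zi0.
  by rewrite nth_default //; lia.
have [rs zr lt] := first_at_index zin; set r := index _ _ in rs zr lt.
have yr : nth 0 y r = j.
  have : nth 0 z r < nth 0 y r.
    case: (ltngtP r i0) => [h|/lt//|->//]; exact: f2 h i0P zr.
  by have := f1 r; lia.
rewrite (@add_box_first _ _ r) //=; apply/IH; first by rewrite size_incr_first.
split; last by rewrite sumn_incr_nth; lia.
split=> [i|i i' ii']; rewrite ?nth_incr_nth.
  by have := f1 i; case: eqVneq => [<-|]; rewrite ?zr ?yr; lia.
have := f2 _ _ ii'.
by case: (eqVneq r i) => [<-|]; rewrite ?zr; [|case: (eqVneq r i') => [<-|]]; lia.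
Qed.

(* [good j X Y] says that the boxes [(i, k)] with [X i < k <= Y i] lie in
   columns at least [j] and form an nc border strip without northeast steps. *)
Definition bx (X Y : nat -> nat) i k := X i < k <= Y i.

Record good (j : nat) (X Y : nat -> nat) : Prop := Good {
  good_le : forall i, X i <= Y i /\ (X i < Y i -> j <= (X i).+1);
  good_top : forall i i' k, i < i' -> bx X Y i' k -> (X i).+1 = k -> bx X Y i k;
  good_row : forall i i' k, bx X Y i k -> bx X Y i k.+1 -> bx X Y i' k -> i <= i';
  good_next : forall i1 k i2 k2, bx X Y i1 k -> bx X Y i2 k2 -> k < k2 ->
    exists i' i, [/\ i' <= i, bx X Y i' k & bx X Y i k.+1] }.

Lemma good_skip j X Y : (forall i, ~~ bx X Y i j) -> good j X Y <-> good j.+1 X Y.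
Proof.
move=> h; split=> [] [g0 g1 g2 g3]; split=> // i; have := g0 i; have := h i.
  by rewrite /bx; lia.
by rewrite /bx; lia.
Qed.

(** In a single column the clauses about consecutive columns are void, and only the cover condition
    [good_top] remains. *)
Lemma good_single j X Y : 0 < j -> (forall i k, j < k -> ~~ bx X Y i k) ->
  good j X Y <-> fills j X Y.
Proof.
move=> j0 h; split=> [[g0 g1 g2 g3]|[f1 f2]].
  have f1 i : Y i = X i \/ (X i = j.-1 /\ Y i = j).
    by have := g0 i; have := h i j.+1; have := h i (Y i); rewrite /bx; lia.
  split=> // i i' ii' xy xi; have := g1 i i' j ii'; have := f1 i'; rewrite /bx; lia.
split.
- by move=> i; have := f1 i; lia.
- move=> i i' k ii'; have := f2 i i' ii'; have := f1 i; have := f1 i'.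
  by rewrite /bx; lia.
- by move=> i i' k; have := f1 i; rewrite /bx; lia.
- by move=> i1 k i2 k2; have := f1 i1; have := f1 i2; rewrite /bx; lia.
Qed.

(** * Splitting off the least column of a strip *)

Section Step.
Variables (j r : nat) (X Y : nat -> nat).
Hypothesis j1 : 1 < j.
Hypothesis Xr : X r = j.-1.
Hypothesis lt_r : forall i, i < r -> X i <> j.-1.
Hypothesis le : forall i, X i <= Y i /\ (X i < Y i -> j <= (X i).+1).

(** [X1] is the inner shape after a final letter [j] has acted on row [r]. [Y0] and [Y1] are the
    shapes that have to be reached, from [X] and from [X1], before the leading letters [j] act. *)
Variables (X1 Y0 Y1 : nat -> nat).
Hypothesis X1E : forall i, X1 i = (r == i) + X i.
Hypothesis Y0E : forall i, Y0 i = if (X i == j.-1) && (Y i == j) then j.-1 else Y i.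
Hypothesis Y1E : forall i, Y1 i = if (X1 i == j.-1) && (Y i == j) then j.-1 else Y i.

(** A box in column [j] lies in a row of length [j-1], hence below [r], and [good_top] then forces
    row [r] to grow. *)
Lemma not_good_step : Y r = j.-1 -> (exists i, bx X Y i j) -> ~ good j X Y.
Proof.
move=> Yr [i bi] g; have := @good_top _ _ _ g r i j; rewrite Xr {2}/bx Yr.
case: (ltngtP r i) => [_ /(_ isT bi)||E]; first by lia.
  by move/lt_r; have := le i; move: bi; rewrite /bx; lia.
by move: bi; rewrite -E /bx Yr Xr; lia.
Qed.

(** A row passing column [j] needs its box there before the larger letters act, hence the step to
    [X1]. Row [r] then has boxes in columns [j] and [j+1]; it is topmost in column [j], as
    [good_row] demands, and it provides the link between the two columns. *)
Lemma good_step_long : j < Y r ->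
  good j X Y <-> fills j Y1 Y /\ good j.+1 X1 Y1.
Proof.
move=> Yr; have ri i : X i = j.-1 -> r <= i.
  by move=> xi; rewrite leqNgt; apply/negP => /lt_r.
have E1 i : X1 i = if r == i then j else X i.
  by rewrite X1E; case: (eqVneq r i) => [<-|]; rewrite ?Xr; lia.
have E2 i : Y1 i = if (X i == j.-1) && (Y i == j) then j.-1 else Y i.
  by rewrite Y1E E1 ?Y0E; case: (eqVneq r i) => [<-|]//; rewrite Xr; do !case: ifP; lia.
have F i k : j < k -> bx X1 Y1 i k = bx X Y i k.
  rewrite /bx E1 E2 => jk; case: (eqVneq r i) => [<-|]; first by rewrite Xr; do !case: ifP; lia.
  by case: ifP; lia.
split=> [[g0 g1 g2 g3]|[[f1 f2] [h0 h1 h2 h3]]].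
  (* A second row passing column [j] would have to be topmost there, but [r] lies above it. *)
  have short i : X i = j.-1 -> i != r -> Y i <= j.
    move=> xi ir; rewrite leqNgt; apply/negP => yi.
    have /= := g2 i r j; rewrite /bx Xr xi; have := ri _ xi; lia.
  split; first split.
  - by move=> i; rewrite E2; case: ifP; lia.
  - move=> i i' ii'; rewrite !E2; have := g1 i i' j ii'; rewrite /bx.
    by do !case: ifP; have := le i; have := le i'; lia.
  split.
  - move=> i; rewrite E1 E2; have := short i; have := g0 i.
    by case: (eqVneq r i) => [<-|]; rewrite ?Xr; do ?case: ifP; lia.
  - move=> i i' k ii' b' kE; have jk : j < k.
      by move: b'; have := short i'; have := g0 i'; rewrite /bx E1 E2; case: (eqVneq r i') => [<-|]; do ?case: ifP; lia.
    move: b'; rewrite !F // => b'; move: kE; rewrite E1.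
    by case: (eqVneq r i) => [<- <-|_]; [rewrite /bx Xr; lia | exact: g1 ii' b'].
  - move=> i i' k b b' b''; have jk : j < k.
      by move: b; have := short i; have := g0 i; rewrite /bx E1 E2; case: (eqVneq r i) => [<-|]; do ?case: ifP; lia.
    by move: b b' b''; rewrite !F //; [exact: g2|lia].
  - move=> i1 k i2 k2 b b' kk; have jk : j < k.
      by move: b; have := short i1; have := g0 i1; rewrite /bx E1 E2; case: (eqVneq r i1) => [<-|]; do ?case: ifP; lia.
    move: b b'; rewrite !F //; last by lia.
    move=> b b'; have [i' [i [p q s]]] := g3 _ _ _ _ b b' kk.
    by exists i', i; rewrite !F //; lia.
have short i : X i = j.-1 -> i != r -> Y i <= j.
  by move=> xi ir; have := h0 i; rewrite E1 E2 (negbTE (_ : r != i)) 1?eq_sym //; case: ifP; lia.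
have b_ge i k : bx X Y i k -> j <= k by have := le i; rewrite /bx; lia.
have b_eq i : bx X Y i j -> X i = j.-1 by have := le i; rewrite /bx; lia.
split=> //.
- move=> i i' k ii' b' kE; have := b_ge _ _ b'; rewrite leq_eqVlt => /orP[/eqP jk|jk].
    rewrite -jk in b' kE *; have xi : X i = j.-1 by lia.
    case: (eqVneq i r) => [->|ir]; first by rewrite /bx Xr; lia.
    have ii : i' != r by have := ri _ xi; lia.
    have := f2 i i' ii'; rewrite !E2; have := short i' (b_eq _ b') ii; have := b_eq _ b'.
    have := short i xi ir; have := le i; move: b'; rewrite /bx; do !case: ifP; lia.
  have := h1 i i' k ii'; rewrite !F // E1; case: (eqVneq r i) => [E|_]; last by move/(_ b' kE).
  by subst i; lia.
- move=> i i' k b b1 b2; have := b_ge _ _ b; rewrite leq_eqVlt => /orP[/eqP jk|jk].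
    subst k; have := short i (b_eq _ b); case: eqVneq => [->|_ /(_ isT)].
      by move=> _; apply/ri/b_eq.
    by move: b1; rewrite /bx; lia.
  by apply: (h2 i i' k); rewrite F //; lia.
- move=> i1 k i2 k2 b b' kk; have := b_ge _ _ b; rewrite leq_eqVlt => /orP[/eqP jk|jk].
    by exists r, r; subst k; rewrite /bx Xr; split; lia.
  have := h3 i1 k i2 k2; rewrite !F //; last by lia.
  by move=> /(_ b b' kk) [i' [i]]; rewrite !F //; [exists i', i | lia].
Qed.

(** Decides between survival and cancellation when row [r] ends in column [j]. Row [r] has the
    topmost box of column [j]; without [E], column [j+1] is empty or lies entirely above column
    [j]. *)
Let E := exists2 i, r < i & bx X Y i j.+1.

(** No row has boxes in both columns here, so [good_next], applied to the box of row [r] and a box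
    in a later column, must give a box of column [j+1] below row [r]. Conversely such a box links
    row [r] to column [j+1]. *)
Lemma good_step_short : Y r = j ->
  (exists i k, j < k /\ bx X Y i k) ->
  good j X Y <-> [/\ fills j Y0 Y, good j.+1 X Y0 & E].
Proof.
move=> Yr [i0 [k0 [jk0 b0]]]; have ri i : X i = j.-1 -> r <= i.
  by move=> xi; rewrite leqNgt; apply/negP => /lt_r.
have F i k : j < k -> bx X Y0 i k = bx X Y i k.
  by rewrite /bx ?Y0E => jk; case: ifP; lia.
have br : bx X Y r j by rewrite /bx Xr Yr; lia.
split=> [[g0 g1 g2 g3]|[[f1 f2] [h0 h1 h2 h3] [i' ri' b']]].
  have short i : X i = j.-1 -> Y i <= j.
    move=> xi; case: (eqVneq i r) => [->|ir]; first by rewrite Yr.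
    rewrite leqNgt; apply/negP => yi.
    have /= := g2 i r j; rewrite /bx Xr xi; have := ri _ xi; lia.
  have bge i k : bx X Y0 i k -> j < k.
    by have := short i; have := g0 i; rewrite /bx ?Y0E; case: ifP; lia.
  split; first split.
  - by move=> i; rewrite ?Y0E; case: ifP; lia.
  - move=> i i' ii'; rewrite ?Y0E; have := g1 i i' j ii'; rewrite /bx.
    by do !case: ifP; have := le i; have := le i'; lia.
  - split.
    + by move=> i; rewrite ?Y0E; have := short i; have := g0 i; case: ifP; lia.
    + move=> i i' k ii' b' kE; have jk := bge _ _ b'.
      by move: b'; rewrite !F // => b'; exact: g1 ii' b' kE.
    + move=> i i' k b b' b''; have jk := bge _ _ b.
      by move: b b' b''; rewrite !F //; [exact: g2|lia].
    + move=> i1 k i2 k2 b b' kk; have jk := bge _ _ b.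
      move: b b'; rewrite !F //; last by lia.
      move=> b b'; have [i' [i [p q s]]] := g3 _ _ _ _ b b' kk.
      by exists i', i; rewrite !F //; lia.
  have [i' [i [p q s]]] := g3 _ _ _ _ br b0 jk0; exists i => //.
  have := ri i'; have := le i'; move: q s; rewrite /bx.
  case: (ltngtP r i) => // [|e]; first by lia.
  by rewrite -e Yr; lia.
have short i : X i = j.-1 -> Y i <= j.
  by move=> xi; have := h0 i; rewrite ?Y0E; case: ifP; lia.
have b_ge i k : bx X Y i k -> j <= k by have := le i; rewrite /bx; lia.
have b_eq i : bx X Y i j -> X i = j.-1 by have := le i; rewrite /bx; lia.
split=> //.
- move=> i i2 k ii' b2 kE; have := b_ge _ _ b2; rewrite leq_eqVlt => /orP[/eqP jk|jk].
    rewrite -jk in b2 kE *; have xi : X i = j.-1 by lia.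
    have := f2 i i2 ii'; rewrite ?Y0E; have := short i2 (b_eq _ b2); have := b_eq _ b2.
    have := short i xi; have := le i; move: b2; rewrite /bx; do !case: ifP; lia.
  by have := h1 i i2 k ii'; rewrite !F // => /(_ b2 kE).
- move=> i i2 k b b1 b2; have := b_ge _ _ b; rewrite leq_eqVlt => /orP[/eqP jk|jk].
    by subst k; have := short i (b_eq _ b); move: b1; rewrite /bx; lia.
  by apply: (h2 i i2 k); rewrite F //; lia.
- move=> i1 k i2 k2 b b2 kk; have := b_ge _ _ b; rewrite leq_eqVlt => /orP[/eqP jk|jk].
    by subst k; exists r, i'; split=> //; lia.
  have := h3 i1 k i2 k2; rewrite !F //; last by lia.
  by move=> /(_ b b2 kk) [i3 [i]]; rewrite !F //; [exists i3, i | lia].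
Qed.

(** The two pairs of shapes differ only in row [r], which gets no box in either. In [X1] it has
    length [j] and is open to a box in column [j+1], so [good_top] forbids boxes of that column
    below it; in [X] it has length [j-1] and forbids nothing there. *)
Lemma good_step_swap : Y r = j ->
  good j.+1 X1 Y1 <-> good j.+1 X Y0 /\ ~ E.
Proof.
move=> Yr; have E1 i : X1 i = if r == i then j else X i.
  by rewrite X1E; case: (eqVneq r i) => [<-|]; rewrite ?Xr; lia.
have E2 i : Y1 i = if r == i then j else Y0 i.
  rewrite Y1E E1 ?Y0E; case: (eqVneq r i) => [<-|]//; rewrite ?Yr; do ?case: ifP; lia.
have lr : Y0 r = j.-1 by rewrite Y0E Xr Yr !eqxx.
have F i k : bx X1 Y1 i k = bx X Y0 i k.
  by rewrite /bx E1 E2; case: (eqVneq r i) => [<-|] //; rewrite Xr lr; lia.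
have G i : bx X Y0 i j.+1 = bx X Y i j.+1.
  by rewrite /bx ?Y0E; case: ifP; lia.
split=> [[h0 h1 h2 h3]|[[g0 g1 g2 g3] nE]].
  split; last first.
    case=> i ri bi; have := h1 r i j.+1 ri; rewrite !F G E1 eqxx => /(_ bi erefl).
    by rewrite /bx Xr lr; lia.
  split.
  - move=> i; have := h0 i; rewrite E1 E2; case: (eqVneq r i) => [<-|] //.
    by rewrite Xr lr; lia.
  - move=> i i' k ii' b kE; have := h1 i i' k ii'; rewrite !F E1.
    case: (eqVneq r i) => [e _|_]; last by move/(_ b kE).
    subst i; exfalso; have := h0 i'; move: b; rewrite -F /bx; lia.
  - by move=> i i' k; have := h2 i i' k; rewrite !F.
  - move=> i1 k i2 k2; have := h3 i1 k i2 k2; rewrite !F => h b b' kk.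
    by have [i' [i]] := h b b' kk; rewrite !F; exists i', i.
split.
- move=> i; have := g0 i; rewrite E1 E2; case: (eqVneq r i) => [<-|] //.
- move=> i i' k ii'; rewrite !F E1; case: (eqVneq r i) => [e|_]; last exact: g1.
  by subst i => b kE; case: nE; exists i' => //; rewrite -G kE.
- by move=> i i' k; rewrite !F; exact: g2.
- move=> i1 k i2 k2; rewrite !F => b b' kk.
  by have [i' [i h]] := g3 _ _ _ _ b b' kk; exists i', i; rewrite !F.
Qed.

(** Row [r] grows on the way from [Y0] and is already full in [Y1]. Its growth imposes nothing on
    other rows, because no row above it has length [j-1]. *)
Lemma fills_step_swap : Y r = j -> fills j Y0 Y <-> fills j Y1 Y.
Proof.
move=> Yr; have E1 i : X1 i = if r == i then j else X i.
  by rewrite X1E; case: (eqVneq r i) => [<-|]; rewrite ?Xr; lia.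
have E2 i : Y1 i = if r == i then j else Y0 i.
  rewrite Y1E E1 ?Y0E; case: (eqVneq r i) => [<-|]//; rewrite ?Yr; do ?case: ifP; lia.
have lr : Y0 r = j.-1 by rewrite Y0E Xr Yr !eqxx.
split=> -[f1 f2]; split.
- by move=> i; have := f1 i; rewrite E2; case: eqVneq => [<-|//]; lia.
- move=> i i' ii'; have := f2 i i' ii'; rewrite !E2.
  by case: (eqVneq r i) => [<-|]; case: (eqVneq r i') => [<-|]; lia.
- by move=> i; have := f1 i; rewrite E2; case: eqVneq => [<-|//]; lia.
move=> i i' ii'; have := f2 i i' ii'; rewrite !E2.
case: (eqVneq r i) => [<-|]; first by lia.
case: (eqVneq r i') => [e|]; last by lia.
subst i'; have := lt_r ii'; have := le i; rewrite Y0E; case: ifP; lia.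
Qed.

End Step.

(** Allows case distinctions on the existence of a row with some property; rows beyond the last one
    have length 0 and never qualify. *)
Lemma has_iotaP (P : pred nat) N : (forall i, P i -> i < N) ->
  reflect (exists i, P i) (has P (iota 0 N)).
Proof.
move=> h; apply: (iffP hasP) => [[i _ Pi]|[i Pi]]; exists i => //.
by rewrite mem_iota h.
Qed.

(** The only shape, among those reached from [x] by letters above [j], from which letters [j] can
    lead to [y]. *)
Definition lower j (x y : seq nat) :=
  mkseq (fun i => if (nth 0 x i == j.-1) && (nth 0 y i == j) then j.-1
                  else nth 0 y i) (size y).

Lemma size_lower j x y : size (lower j x y) = size y.
Proof. by rewrite size_mkseq. Qed.

Lemma nth_lower j x y i : 0 < j -> nth 0 (lower j x y) i =
  if (nth 0 x i == j.-1) && (nth 0 y i == j) then j.-1 else nth 0 y i.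
Proof.
move=> j0; have [iy|iy] := ltnP i (size y); first by rewrite nth_mkseq.
have yi : nth 0 y i = 0 by rewrite nth_default.
by rewrite yi nth_default ?size_lower //; case: ifP; lia.
Qed.

Lemma rows_gt0 x y i : nth 0 x i < nth 0 y i -> 0 < rows x y.
Proof.
move=> xy; have iy : i < size y.
  by case: (ltnP i (size y)) xy => // /(nth_default 0)->.
by rewrite /rows (bigD1 (Ordinal iy)) //= xy.
Qed.

Lemma rowsD x y x' y' z w : size y = size y' -> size y = size w ->
  (forall i, (nth 0 x i < nth 0 y i : nat) =
     (nth 0 x' i < nth 0 y' i) + (nth 0 z i < nth 0 w i)) ->
  rows x y = rows x' y' + rows z w.
Proof.
by move=> s1 s2 h; rewrite /rows -s1 -s2 -big_split; apply: eq_bigr => i _ /=.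
Qed.

(** Letters above [j] leave rows of length [j-1] alone and letters [j] stop at length [j]. So a row
    of length [j] in [y] had length [j-1] before the leading letters exactly when it has that length
    in [x]. *)
Lemma act_nseq_cat a j u x y : 1 < j -> size x = size y -> all (ltn j) u ->
  (act (nseq a j ++ u) x == Some y) =
  (act (nseq a j) (lower j x y) == Some y) && (act u x == Some (lower j x y)).
Proof.
move=> j1 s ju; rewrite act_cat; apply/eqP/andP => [|[/eqP h /eqP->//]].
case E: (act u x) => [z|//] /= h.
have [sz hz] := @act_ge j.+1 _ _ _ (ltnW j1) ju E.
have szy : size z = size y by rewrite sz.
have [[f1 _] _] := (act_nseq a j1 szy).1 h.
suff zE : z = lower j x y by rewrite -zE h.
apply: (@eq_from_nth _ 0); rewrite ?size_lower ?sz // => i _.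
by rewrite nth_lower; [case: ifP; have := hz i; have := f1 i | ]; lia.
Qed.

(** * Signed sums over hook words in columns from 2 on *)

Local Open Scope ring_scope.

Lemma hook_sumZ j k n (c : rat) F :
  hook_sum j k n (fun u => c * F u) = c * hook_sum j k n F.
Proof. by rewrite /hook_sum big_distrr /=; apply: eq_bigr => u _; rewrite mulrCA. Qed.

Lemma hook_sum_eq0 j k n F :
  (forall u, all (leq j) u -> F u = 0) -> hook_sum j k n F = 0.
Proof.
move=> h; rewrite /hook_sum big1_seq // => u /andP[_].
rewrite mem_words => /andP[_ au]; rewrite h ?mulr0 //.
by apply: sub_all au => c /andP[].
Qed.

(** For [j = 1] and enough letters, this is the coefficient of [ns y] in the product of [Psi n] and
    [ns x]. *)
Definition act_sum j k n x y := hook_sum j k n (fun u => (act u x == Some y)%:R).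

Lemma act_sum_eq0 j k n x y i : (1 < j)%N ->
  ~ ((nth 0 x i <= nth 0 y i)%N /\
     (nth 0 x i < nth 0 y i -> j <= (nth 0 x i).+1)%N) ->
  act_sum j k n x y = 0.
Proof.
move=> j1 h; apply: hook_sum_eq0 => u ju; case: eqP => // E.
by case: h; have [_] := act_ge j1 ju E; apply.
Qed.

(** A nonempty word would have to lengthen some row, and the empty word has hook sign 0. *)
Lemma act_sum_le j k n x y : (1 < j)%N -> size x = size y ->
  (forall i, ~ ((nth 0 x i < nth 0 y i)%N /\ (j <= (nth 0 x i).+1)%N)) ->
  act_sum j k n x y = 0.
Proof.
move=> j1 s h; rewrite /act_sum /hook_sum big1_seq // => u /andP[_].
rewrite mem_words => /andP[_ au].
case: eqP => E; rewrite ?mulr0 // mulr1.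
have ju : all (leq j) u by apply: sub_all au => c /andP[].
have [_ g] := act_ge j1 ju E; have := act_sumn E.
suff : (sumn y <= sumn x)%N by case: (u) => //= c v; lia.
by apply: leq_sumn => // i; have := g i; have := h i; lia.
Qed.

(** The sizes of [y] and of the forced intermediate shape determine [a], so at most one term
    survives. *)
Lemma act_sum_lower k j n N x y : (1 < j)%N -> size x = size y ->
  let z := lower j x y in let d := (sumn y - sumn z)%N in
  \sum_(a < N) (-1) ^+ a *
    hook_sum j.+1 k (n - a) (fun u => (act (nseq a j ++ u) x == Some y)%:R) =
  ((d < N)%N && (act (nseq d j) z == Some y))%:R *
     ((-1) ^+ d * act_sum j.+1 k (n - d) x z).
Proof.
move=> j1 s z d.
have step a : hook_sum j.+1 k (n - a)
    (fun u => (act (nseq a j ++ u) x == Some y)%:R) =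
    (act (nseq a j) z == Some y)%:R * act_sum j.+1 k (n - a) x z.
  rewrite -hook_sumZ; apply: eq_hook_sum => u _ ju.
  by rewrite act_nseq_cat // -natrM mulnb.
have ad a : act (nseq a j) z = Some y -> a = d.
  by move/act_sumn; rewrite size_nseq /d; lia.
have [dN|dN] := ltnP d N; last first.
  rewrite mul0r big1 // => a _; rewrite step.
  by case: eqP => [/ad e|]; rewrite ?mul0r ?mulr0 //; have := ltn_ord a; lia.
rewrite (bigD1 (Ordinal dN)) //= big1 ?addr0; first by rewrite step mulrCA.
move=> a ne; rewrite step; case: eqP => [/ad e|]; rewrite ?mul0r ?mulr0 //.
by case/eqP: ne; apply: val_inj.
Qed.

(** Induction on the number [k] of columns evaluates the two sums left after splitting off the
    letter [j]. A boolean equivalent to [good] is built on the way, so that the predicate can serve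
    as a coefficient. *)
Theorem act_sum_good k j n x y : (1 < j)%N -> size x = size y ->
  sumn y = (sumn x + n)%N -> (0 < n)%N -> (forall i, nth 0 y i < j + k)%N ->
  exists2 b : bool, b <-> good j (nth 0%N x) (nth 0%N y) &
    act_sum j k n x y = b%:R * (-1) ^+ (rows x y).-1.
Proof.
elim: k j n x y => [|k IH] j n x y j1 s; case: n => // n sn _ by_.
  exists false; last by rewrite /act_sum /hook_sum /words /= big_nil mul0r.
  split=> // -[g0 _ _ _]; suff : (sumn y <= sumn x)%N by lia.
  by apply: leq_sumn => // i; have := g0 i; have := by_ i; lia.
have out i : (size y <= i)%N -> nth 0%N x i = 0%N /\ nth 0%N y i = 0%N.
  by move=> h; rewrite !nth_default ?s.
have gP : reflect (exists i, ~~ ((nth 0 x i <= nth 0 y i) &&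
    ((nth 0 x i < nth 0 y i) ==> (j <= (nth 0 x i).+1))))%N
    (has (fun i => ~~ ((nth 0 x i <= nth 0 y i) &&
    ((nth 0 x i < nth 0 y i) ==> (j <= (nth 0 x i).+1))))%N (iota 0 (size y))).
  apply: has_iotaP => i; case: (ltnP i (size y)) => // /out[-> ->].
  by lia.
case: gP => [[i hi]|nle].
  have nle : ~ ((nth 0 x i <= nth 0 y i)%N /\
     (nth 0 x i < nth 0 y i -> j <= (nth 0 x i).+1)%N) by lia.
  exists false; last by rewrite (act_sum_eq0 _ _ j1 nle) mul0r.
  by split=> // -[g0 _ _ _]; case: nle.
have {nle}le i : (nth 0 x i <= nth 0 y i)%N /\
     (nth 0 x i < nth 0 y i -> j <= (nth 0 x i).+1)%N.
  case: (boolP ((nth 0 x i <= nth 0 y i) &&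
    ((nth 0 x i < nth 0 y i) ==> (j <= (nth 0 x i).+1)))%N) => [|h]; first by lia.
  by case: nle; exists i.
set X := nth 0%N x; set Y := nth 0%N y.
(* The power of [j], the words without a final [j] after [u], and those with one. *)
have sE : act_sum j k.+1 n.+1 x y = (-1) ^+ n * (act (nseq n.+1 j) x == Some y)%:R
  + (\sum_(a < n.+1) (-1) ^+ a * hook_sum j.+1 k (n.+1 - a)
        (fun u => (act (nseq a j ++ u) x == Some y)%:R)
  +  \sum_(a < n.+1) (-1) ^+ a * hook_sum j.+1 k (n - a)
        (fun u => (act (nseq a j ++ rcons u j) x == Some y)%:R)).
  rewrite /act_sum hook_sum_split; congr (_ + _).
  by rewrite -big_split; apply: eq_bigr => a _; rewrite mulrDr.
(* A final letter acts first, so its sum is of the same form as the other one, with [x1] in place of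
   [x]. *)
have tail0 : (forall x1, add_box j x = Some x1 -> forall n0,
      act_sum j.+1 k n0 x1 (lower j x1 y) = 0) ->
    \sum_(a < n.+1) (-1) ^+ a * hook_sum j.+1 k (n - a)
        (fun u => (act (nseq a j ++ rcons u j) x == Some y)%:R) = 0.
  move=> h; case E: (add_box j x) => [x1|].
    have s1 : size x1 = size y.
      by have [//|r [rs _ _] ->] := add_box_inv _ E; rewrite size_incr_first.
    transitivity (\sum_(a < n.+1) (-1) ^+ a * hook_sum j.+1 k (n - a)
        (fun u => (act (nseq a j ++ u) x1 == Some y)%:R)).
      apply: eq_bigr => a _; congr (_ * _); apply: eq_hook_sum => u _ _.
      by rewrite -cats1 catA act_cat /= E.
    by rewrite act_sum_lower // h // !mulr0.
  rewrite big1 // => a _; rewrite hook_sum_eq0 ?mulr0 // => u _.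
  by rewrite -cats1 catA act_cat /= E.
have jP : reflect (exists i, bx X Y i j) (has (fun i => bx X Y i j) (iota 0 (size y))).
  apply: has_iotaP => i; case: (ltnP i (size y)) => // /out[xi yi].
  by rewrite /bx /X /Y xi yi; lia.
have lo0 x1 i : nth 0%N (lower j x1 y) i =
  if (nth 0%N x1 i == j.-1) && (nth 0%N y i == j) then j.-1 else nth 0%N y i.
  by apply: nth_lower; lia.
have dE x1 : (sumn y - sumn (lower j x1 y))%N = rows (lower j x1 y) y.
  rewrite (@sumn_rows (lower j x1 y) y) ?size_lower ?addKn // => i.
  by rewrite lo0; case: ifP; lia.
case: jP => [[i0 b0]|nb].
  2: {
    (* Column [j] has no box: the letter [j] cannot occur and the sum starts at column [j+1]. *)
    have nb' i : ~~ bx X Y i j by apply/negP => b; case: nb; exists i.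
    have lE : lower j x y = y.
      apply: (@eq_from_nth _ 0%N); rewrite ?size_lower // => i _.
      by rewrite lo0; case: ifP => //; have := nb' i; rewrite /bx /X /Y; lia.
    have [|||||b bP bE] := IH j.+1 n.+1 x y; rewrite ?addSnnS //; first by lia.
    exists b; first by rewrite bP; exact: iff_sym (good_skip nb').
    rewrite sE tail0 ?addr0; last first.
      move=> x1 /add_box_inv[//|r [rs xr _] ->] n0.
      apply: (@act_sum_eq0 _ _ _ _ _ r); first by lia.
      rewrite lo0 nth_incr_nth eqxx xr; have := nb' r; rewrite /bx /X /Y xr.
      by case: ifP; lia.
    case: eqP => [/act_nseq[//|//|[f1 _] _]|_]; rewrite ?mulr0 ?add0r.
      exfalso; suff : (sumn y <= sumn x)%N by lia.
      apply: leq_sumn => // i; have := f1 i; have := nb' i; rewrite /bx /X /Y; lia.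
    rewrite act_sum_lower // lE subnn /= eqxx mul1r expr0 mul1r subn0.
    exact: bE. }
have fP : reflect (exists i, (nth 0 x i < nth 0 y i) && (j < nth 0 y i))%N
    (has (fun i => (nth 0 x i < nth 0 y i) && (j < nth 0 y i))%N (iota 0 (size y))).
  apply: has_iotaP => i; case: (ltnP i (size y)) => // /out[xi yi].
  by rewrite xi yi; lia.
case: fP => [[i1 f1]|nf].
  2: {
    (* No box lies beyond column [j]: only the power of [j] can contribute, and its [n+1] letters
       fill as many rows. *)
    have nf' i k1 : (j < k1)%N -> ~~ bx X Y i k1.
      by move=> jk; apply/negP => b; case: nf; exists i; move: b; rewrite /bx /X /Y; lia.
    have pE : act (nseq n.+1 j) x == Some y <-> good j X Y.
      split=> [/eqP/(act_nseq _ j1 s)[f _]|/(good_single (ltnW j1) nf') f].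
        exact/(good_single (ltnW j1) nf').
      exact/eqP/(act_nseq _ j1 s).
    exists (act (nseq n.+1 j) x == Some y) => //.
    have z0 x1 n0 : size x1 = size y -> (forall i, nth 0 x i <= nth 0 x1 i)%N ->
        act_sum j.+1 k n0 x1 (lower j x1 y) = 0.
      move=> s1 x01; apply: act_sum_le; rewrite ?size_lower //; first by lia.
      move=> i; rewrite lo0 => -[h1 h2]; case: nf; exists i; move: h1 (x01 i) h2.
      by case: ifP; lia.
    rewrite sE tail0 ?addr0; last first.
      move=> x1 /add_box_inv[//|r [rs xr _] ->] n0.
      apply: z0 => [|i]; first by rewrite size_incr_first.
      by rewrite nth_incr_nth leq_addl.
    rewrite act_sum_lower // z0 // !mulr0 addr0.
    case: eqP => [h|_]; last by rewrite mulr0 mul0r.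
    have [[g1 _] _] := (act_nseq _ j1 s).1 h.
    have : sumn y = (sumn x + rows x y)%N.
      by apply: sumn_rows => // i; have := g1 i; lia.
    by rewrite mulrC => rE; have -> : rows x y = n.+1 by lia. }
have pure0 : act (nseq n.+1 j) x == Some y = false.
  apply/eqP => /(act_nseq _ j1 s)[[h _] _]; have := h i1; lia.
have x0 : X i0 = j.-1 by have := le i0; move: b0; rewrite /bx /X /Y; lia.
have xin : j.-1 \in x.
  rewrite -x0 mem_nth //; case: (ltnP i0 (size x)) => // h; move: x0.
  by rewrite /X nth_default //; lia.
have fr := first_at_index xin; set r := index _ _ in fr.
have [rs xr lt] := fr.
pose x1 := incr_nth x r.
have n1 i : nth 0%N x1 i = ((r == i) + nth 0%N x i)%N by rewrite nth_incr_nth.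
have s1 : size x1 = size y by rewrite size_incr_first.
have ax : add_box j x = Some x1 by apply: add_box_first.
have tE : \sum_(a < n.+1) (-1) ^+ a * hook_sum j.+1 k (n - a)
        (fun u => (act (nseq a j ++ rcons u j) x == Some y)%:R) =
    \sum_(a < n.+1) (-1) ^+ a * hook_sum j.+1 k (n - a)
        (fun u => (act (nseq a j ++ u) x1 == Some y)%:R).
  apply: eq_bigr => a _; congr (_ * _); apply: eq_hook_sum => u _ _.
  by rewrite -cats1 catA act_cat /= ax.
pose y0 := lower j x y; pose y1 := lower j x1 y.
have sy0 : size y0 = size y by rewrite size_lower.
have sy1 : size y1 = size y by rewrite size_lower.
have {}sE : act_sum j k.+1 n.+1 x y =
  ((rows y0 y < n.+1)%N && (act (nseq (rows y0 y) j) y0 == Some y))%:R *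
     ((-1) ^+ rows y0 y * act_sum j.+1 k (n.+1 - rows y0 y) x y0)
  + ((rows y1 y < n.+1)%N && (act (nseq (rows y1 y) j) y1 == Some y))%:R *
     ((-1) ^+ rows y1 y * act_sum j.+1 k (n - rows y1 y) x1 y1).
  by rewrite sE pure0 mulr0 add0r tE !act_sum_lower // !dE.
have sum0 : sumn y = (sumn y0 + rows y0 y)%N.
  by apply: sumn_rows => // i; rewrite lo0; case: ifP; lia.
have sum1 : sumn y = (sumn y1 + rows y1 y)%N.
  by apply: sumn_rows => // i; rewrite lo0; case: ifP; lia.
have sx1 : sumn x1 = (sumn x).+1 by rewrite sumn_incr_nth.
have fl0 : act (nseq (rows y0 y) j) y0 == Some y <->
    fills j (nth 0%N y0) Y.
  split=> [/eqP/(act_nseq _ j1 sy0)[]//|f].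
  exact/eqP/(act_nseq _ j1 sy0).
have fl1 : act (nseq (rows y1 y) j) y1 == Some y <->
    fills j (nth 0%N y1) Y.
  split=> [/eqP/(act_nseq _ j1 sy1)[]//|f].
  exact/eqP/(act_nseq _ j1 sy1).
have yb1 i : (nth 0 y1 i < j.+1 + k)%N.
  by rewrite lo0; have := by_ i; case: ifP; lia.
have yb0 i : (nth 0 y0 i < j.+1 + k)%N.
  by rewrite lo0; have := by_ i; case: ifP; lia.
have xr' : X r = j.-1 by [].
case: (ltngtP (Y r) j) => yr.
(* Row [r] keeps length [j-1]. A final [j] would make it too long; without one, it blocks the
   leading letters from row [i0] below it, whose box in column [j] can then not be added. *)
- have {}yr : Y r = j.-1 by have := le r; rewrite -/X -/Y; lia.
  exists false; first by split=> // /(not_good_step j1 xr' lt le yr); case; exists i0.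
  rewrite mul0r sE [act_sum _ _ _ x1 _](@act_sum_eq0 _ _ _ _ _ r) ?mulr0 ?addr0.
  + case: (boolP (_ && _)); rewrite ?mul0r //.
    case/andP=> _ /fl0[_ f2].
    rewrite (@act_sum_eq0 _ _ _ _ _ i0) ?mulr0 //; first by lia.
    have y0r : nth 0%N y0 r = j.-1.
      by rewrite lo0 -/X -/Y xr' yr; case: ifP; lia.
    have : ~ (nth 0 y0 i0 < Y i0)%N.
      move=> h; have := f2 r i0; rewrite y0r yr ltnn => /(_ _ h).
      case: (ltngtP r i0) => [_ /(_ isT erefl)//|/lt//|e].
      by move: b0; rewrite -e /bx yr xr'; lia.
    rewrite lo0 -/X -/Y x0; move: b0; rewrite /bx x0.
    by case: ifP; lia.
  + by lia.
  + by rewrite lo0 n1 eqxx -/X -/Y xr' yr; case: ifP; lia.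
(* Row [r] passes column [j]. Letters above [j] cannot lengthen it from [j-1], so only the words
   with a final [j] remain. *)
- rewrite sE [act_sum _ _ _ x _](@act_sum_eq0 _ _ _ _ _ r) ?mulr0 ?add0r.
  + have le1 i : (nth 0 x1 i <= nth 0 y1 i)%N.
      rewrite lo0 n1; have := le i.
      by case: (eqVneq r i) => [<-|]; rewrite -/X -/Y; case: ifP; lia.
    have i1P : (nth 0 x1 i1 < nth 0 y1 i1)%N.
      rewrite lo0 n1; move: f1.
      by case: (eqVneq r i1) => [<-|]; rewrite -/X -/Y; case: ifP; lia.
    have s11 : size x1 = size y1 by rewrite sy1.
    have lts := ltn_sumn s11 le1 i1P.
    have [||||//|b1 b1P b1E] := IH j.+1 (n - rows y1 y)%N x1 y1; try lia.
    exists ((act (nseq (rows y1 y) j) y1 == Some y) && b1).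
      rewrite (good_step_long j1 xr' lt le n1 (lo0 x1) yr).
      by split=> [/andP[/fl1 ? /b1P]|[/fl1-> /b1P->]].
    have -> : (rows y1 y < n.+1)%N by lia.
    rewrite b1E /= -mulnb natrM -!mulrA; congr (_ * _).
    rewrite mulrCA; congr (_ * _); rewrite -exprD; congr (_ ^+ _).
    have -> : rows x y = (rows x1 y1 + rows y1 y)%N.
      apply: rowsD => // i; rewrite lo0 n1; move: (le i) j1 yr.
      by case: (eqVneq r i) => [<-|]; rewrite -/X -/Y ?xr'; clear; case: ifP; lia.
    by have := rows_gt0 i1P; lia.
  + by lia.
  + by rewrite lo0 -/X -/Y xr'; case: ifP; lia.
(* Row [r] ends in column [j]: its box may come from a final or from a leading letter. *)
have le0 i : (nth 0 x i <= nth 0 y0 i)%N.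
  by rewrite lo0; have := le i; rewrite -/X -/Y; case: ifP; lia.
have le1 i : (nth 0 x1 i <= nth 0 y1 i)%N.
  rewrite lo0 n1; have := le i.
  by case: (eqVneq r i) => [<-|]; rewrite -/X -/Y; case: ifP; lia.
have i1P : (nth 0 x1 i1 < nth 0 y1 i1)%N.
  rewrite lo0 n1; move: f1.
  by case: (eqVneq r i1) => [<-|]; rewrite -/X -/Y; case: ifP; lia.
have i0P : (nth 0 x i1 < nth 0 y0 i1)%N.
  by rewrite lo0; move: f1; rewrite -/X -/Y; case: ifP; lia.
have s11 : size x1 = size y1 by rewrite sy1.
have s00 : size x = size y0 by rewrite sy0.
have lt1 := ltn_sumn s11 le1 i1P; have lt0 := ltn_sumn s00 le0 i0P.
have [||||//|c1 c1P c1E] := IH j.+1 (n - rows y1 y)%N x1 y1; try lia.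
have [||||//|c0 c0P c0E] := IH j.+1 (n.+1 - rows y0 y)%N x y0; try lia.
have eP : reflect (exists i, (r < i)%N && bx X Y i j.+1)
    (has (fun i => (r < i)%N && bx X Y i j.+1) (iota 0 (size y))).
  apply: has_iotaP => i; case: (ltnP i (size y)) => // /out[xi yi].
  by rewrite /bx /X /Y xi yi; lia.
set e := has _ _ in eP.
have eP' : e <-> exists2 i, (r < i)%N & bx X Y i j.+1.
  split=> [/eP[i /andP[]]|[i ri bi]]; first by exists i.
  by apply/eP; exists i; rewrite ri.
have far : exists i k, (j < k)%N /\ bx X Y i k.
  by exists i1, (Y i1); move: f1; rewrite /bx /X /Y; clear; lia.
have c1E' : c1 = c0 && ~~ e.
  apply/idP/andP => [/c1P|[/c0P h /negP ne]].
    case/(good_step_swap j1 xr' n1 (lo0 x) (lo0 x1) yr) => /c0P-> h.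
    by split=> //; apply/negP => /eP'.
  apply/c1P/(good_step_swap j1 xr' n1 (lo0 x) (lo0 x1) yr).
  by split=> // /eP'.
have f01 : (act (nseq (rows y1 y) j) y1 == Some y) =
    (act (nseq (rows y0 y) j) y0 == Some y).
  have sw := fills_step_swap j1 xr' lt le n1 (lo0 x) (lo0 x1) yr.
  by apply/idP/idP => [/fl1/sw/fl0|/fl0/sw/fl1].
exists [&& act (nseq (rows y0 y) j) y0 == Some y, c0 & e].
  rewrite (good_step_short j1 xr' lt le (lo0 x) yr far).
  by split=> [/and3P[/fl0 ? /c0P ? /eP' ?]|[/fl0-> /c0P-> /eP'->]].
rewrite sE.
have -> : (rows y1 y < n.+1)%N by move: lt1 sum1 sn sx1; clear; lia.
have -> : (rows y0 y < n.+1)%N by move: lt0 sum0 sn; clear; lia.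
have rE : rows x y = (rows x y0 + rows y0 y)%N.
  apply: rowsD => // i; rewrite lo0; move: (le i) j1; rewrite -/X -/Y; clear.
  by case: ifP; lia.
have rE' : rows x1 y1 = rows x y0.
  rewrite /rows sy0 sy1; apply: eq_bigr => i _; rewrite !lo0 n1; move: (le i) j1.
  by case: (eqVneq r i) => [<-|] _; rewrite -/X -/Y ?xr' ?yr; clear; do !case: ifP; lia.
(* A final [j] fills row [r] and saves one leading letter; this is the opposite sign behind the
   cancellation. *)
have d01 : rows y0 y = (rows y1 y).+1.
  suff : sumn y1 = (sumn y0).+1 by move: sum0 sum1; clear; lia.
  have -> : y1 = incr_nth y0 r; last by rewrite sumn_incr_nth.
  apply: (@eq_from_nth _ 0%N); rewrite ?size_incr_first ?sy0 ?sy1 -?s // => i _.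
  rewrite nth_incr_nth !lo0 n1; move: j1.
  by case: (eqVneq r i) => [<-|]; rewrite -/X -/Y ?xr' ?yr; clear; do !case: ifP; lia.
rewrite c0E c1E rE' rE c1E' f01 d01.
have := rows_gt0 i0P; case: (rows x y0) => // R _; rewrite addSn /= exprD !exprS.
case: (_ == _); case: c0 {c0P c0E c1E' c1E c1P}; case: e {eP eP'};
  rewrite ?mul0r ?mulr0 ?mul1r ?mulr1 ?add0r ?addr0 //=.
by rewrite ?mul0r ?mulr0 ?mul1r ?mulr1 mulrC.
by rewrite mulN1r mulNr addNr.
Qed.

Local Close Scope ring_scope.

(** * The first column *)

(* Column 1 is exceptional because its boxes are added from bottom to top, those
   of the other columns from top to bottom. *)
Record strip (X Y : nat -> nat) : Prop := Strip {
  strip_le : forall i, X i <= Y i;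
  strip_top : forall i i' k, 1 < k -> i < i' -> bx X Y i' k -> (X i).+1 = k ->
    bx X Y i k;
  strip_row : forall i i' k, 1 < k -> bx X Y i k -> bx X Y i k.+1 ->
    bx X Y i' k -> i <= i';
  strip_row1 : forall i i', bx X Y i 1 -> bx X Y i 2 -> bx X Y i' 1 -> i' <= i;
  strip_next : forall i1 k i2 k2, bx X Y i1 k -> bx X Y i2 k2 -> k < k2 ->
    exists i' i, [/\ i' <= i, bx X Y i' k & bx X Y i k.+1] }.

(** Without new rows column 1 has no box, and what is special about it disappears. *)
Lemma strip_good X Y : (forall i, X i = 0 -> Y i = 0) -> strip X Y <-> good 2 X Y.
Proof.
move=> h; have b2 i k : bx X Y i k -> 1 < k by have := h i; rewrite /bx; lia.
split=> [[s0 s1 s2 s3 s4]|[g0 g1 g2 g3]]; split=> //.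
- by move=> i; have := s0 i; have := h i; lia.
- by move=> i i' k ii' b; apply: s1 (b2 _ _ b) ii' b.
- by move=> i i' k b; apply: s2 (b2 _ _ b) b.
- by move=> i; have := g0 i; lia.
- by move=> i i' k _; exact: g1.
- by move=> i i' k _; exact: g2.
- by move=> i i' /b2.
Qed.

Section FirstColumn.
(** Row [m] is the lowest new row and plays the part of row [r] above. [X0] is the old shape and
    [X1] the old shape with a row of length 1 on top; [Y0] and [Y1] are the rows of [Y] below [m]
    and from [m] on. *)
Variables (m : nat) (X Y X0 Y0 X1 Y1 : nat -> nat).
Hypothesis Xlt : forall i, i <= m -> X i = 0.
Hypothesis Xge : forall i, m < i -> X i = 0 -> Y i = 0.
Hypothesis Ylt : forall i, i < m -> Y i = 1.
Hypothesis X0E : forall i, X0 i = X (i + m.+1).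
Hypothesis Y0E : forall i, Y0 i = Y (i + m.+1).
Hypothesis X10 : X1 0 = 1.
Hypothesis X1S : forall i, X1 i.+1 = X0 i.
Hypothesis Y1E : forall i, Y1 i = Y (i + m).

Let bx0E i k : bx X0 Y0 i k = bx X Y (i + m.+1) k.
Proof. by rewrite /bx X0E Y0E. Qed.

Let bx1E i k : 1 < k -> bx X1 Y1 i k = bx X Y (i + m) k.
Proof.
move=> k1; rewrite /bx Y1E; case: i => [|i]; last by rewrite X1S X0E addSnnS.
by rewrite X10 Xlt; lia.
Qed.

Let bx_ge i k : 1 < k -> bx X Y i k -> m <= i.
Proof. by move=> k1; have := @Ylt i; rewrite /bx; lia. Qed.

Let bx_far i k : m < i -> bx X Y i k -> 1 < k.
Proof. by move=> mi; have := @Xge i mi; rewrite /bx; lia. Qed.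

Let bx1_gt1 i k : bx X1 Y1 i k -> 1 < k.
Proof.
case: i => [|i]; first by rewrite /bx X10; lia.
rewrite /bx X1S X0E Y1E addSnnS => h; apply: (@bx_far (i + m.+1)) => //; lia.
Qed.

(** Row [m] reaches column 2, so it must exist before the letters above 1 act. Being the lowest new
    row, it has the bottommost box of column 1, as [strip_row1] demands, and it links columns 1 and
    2. *)
Lemma strip_cons_long : 1 < Y m -> strip X Y <-> good 2 X1 Y1.
Proof.
move=> Ym; split=> [[s0 s1 s2 s3 s4]|[g0 g1 g2 g3]]; split.
- case=> [|i]; first by rewrite X10 Y1E add0n; lia.
  rewrite X1S X0E Y1E addSnnS; have := s0 (i + m.+1); have := @Xge (i + m.+1).
  by lia.
- move=> i i' k ii' b; have k1 := bx1_gt1 b; move: b; rewrite !bx1E //.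
  case: i ii' => [|i] ii' b; first by rewrite X10 /bx add0n Xlt // => kE; lia.
  rewrite X1S X0E -addSnnS; apply: s1 b => //; lia.
- move=> i i' k b; have k1 := bx1_gt1 b; move: b; rewrite !bx1E; try lia.
  by move=> b b' b''; have := s2 _ _ _ k1 b b' b''; lia.
- move=> i1 k i2 k2 b b' kk; have k1 := bx1_gt1 b; move: b b'; rewrite !bx1E; try lia.
  move=> b b'; have [i' [i [h1 h2 h3]]] := s4 _ _ _ _ b b' kk.
  have h4 := bx_ge k1 h2; have h5 : m <= i by apply: bx_ge h3; lia.
  by exists (i' - m), (i - m); rewrite !bx1E ?subnK //; try lia; split=> //; lia.
- move=> i; case: (ltnP m i) => mi; last by rewrite Xlt.
  have := g0 (i - m.+1).+1; rewrite X1S X0E Y1E addSnnS subnK //; lia.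
- move=> i i' k k1 ii' b kE; have mi : m < i.
    by rewrite ltnNge; apply/negP => /Xlt; lia.
  have := g1 (i - m) (i' - m) k; rewrite !bx1E // !subnK //; try lia.
  move=> h; apply: h => //; first by lia.
  by have -> : i - m = (i - m.+1).+1 by [lia]; rewrite X1S X0E subnK.
- move=> i i' k k1 b b' b''; have := g2 (i - m) (i' - m) k.
  have h1 := bx_ge k1 b; have h2 := bx_ge k1 b''.
  by rewrite !bx1E ?subnK //; lia.
- move=> i i' b b' b''; case: (ltngtP i m) => h.
  + by have := bx_ge (isT : 1 < 2) b'; lia.
  + by have := bx_far h b.
  + by case: (leqP i' i) => // h'; have := @bx_far i' 1; rewrite -h => /(_ h' b'').
- move=> i1 k i2 k2 b b' kk; case: (ltnP 1 k) => k1; last first.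
    have -> : k = 1 by move: b; rewrite /bx; lia.
    by exists m, m; rewrite /bx Xlt //; split=> //; lia.
  have k2_ : 1 < k2 by lia.
  have h1 := bx_ge k1 b; have h2 := bx_ge k2_ b'.
  have := g3 (i1 - m) k (i2 - m) k2; rewrite !bx1E ?subnK //.
  move=> /(_ b b' kk) [i' [i []]]; rewrite !bx1E //; try lia.
  by move=> h3 h4 h5; exists (i' + m), (i + m); split=> //; lia.
Qed.

(** No new row reaches column 2. Boxes of column 2 lie in old rows, below all of column 1, so their
    mere existence is the link that [strip_next] asks for. *)
Lemma strip_cons_short : Y m = 1 -> (exists i, X0 i < Y0 i) ->
  strip X Y <-> good 2 X0 Y0 /\ exists i, bx X0 Y0 i 2.
Proof.
move=> Ym [i0 hi0]; have far0 i k : bx X0 Y0 i k -> 1 < k.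
  by rewrite bx0E; apply: bx_far; lia.
have ge' i k : 1 < k -> bx X Y i k -> m < i.
  move=> k1 b; have := bx_ge k1 b; rewrite leq_eqVlt => /orP[/eqP e|//].
  by move: b; rewrite -e /bx Ym; lia.
split=> [[s0 s1 s2 s3 s4]|[[g0 g1 g2 g3] [i2 b2]]].
  split; first split.
  - move=> i; rewrite X0E Y0E; have := s0 (i + m.+1); have := @Xge (i + m.+1); lia.
  - move=> i i' k ii' b; have k1 := far0 _ _ b; move: b; rewrite !bx0E X0E => b.
    by apply: s1 b => //; lia.
  - move=> i i' k b; have k1 := far0 _ _ b; move: b; rewrite !bx0E => b b' b''.
    by have := s2 _ _ _ k1 b b' b''; lia.
  - move=> i1 k i2 k2 b b' kk; have k1 := far0 _ _ b; move: b b'; rewrite !bx0E => b b'.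
    have [i' [i [h1 h2 h3]]] := s4 _ _ _ _ b b' kk.
    have h4 := ge' _ _ k1 h2; have h5 : m < i by apply: ge' h3; lia.
    by exists (i' - m.+1), (i - m.+1); rewrite !bx0E !subnK //; split=> //; lia.
  have b1 : bx X Y m 1 by rewrite /bx Xlt // Ym.
  have bi0 : bx X Y (i0 + m.+1) (Y0 i0) by rewrite -bx0E /bx; lia.
  have k1 : 1 < Y0 i0 by apply: bx_far bi0; lia.
  have [i' [i [h1 h2 h3]]] := s4 _ _ _ _ b1 bi0 k1.
  by exists (i - m.+1); rewrite bx0E subnK //; apply: ge' h3.
split.
- move=> i; case: (ltnP m i) => mi; last by rewrite Xlt.
  by have := g0 (i - m.+1); rewrite X0E Y0E subnK //; lia.
- move=> i i' k k1 ii' b kE; have mi : m < i.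
    by rewrite ltnNge; apply/negP => /Xlt; lia.
  have := g1 (i - m.+1) (i' - m.+1) k; by rewrite !bx0E X0E !subnK //; lia.
- move=> i i' k k1 b b' b''; have := g2 (i - m.+1) (i' - m.+1) k.
  have h1 := ge' _ _ k1 b; have h2 := ge' _ _ k1 b''.
  by rewrite !bx0E !subnK // => /(_ b b' b''); lia.
- by move=> i i' b b'; have := bx_far (ge' i 2 isT b') b.
- move=> i1 k i3 k2 b b' kk; case: (ltnP 1 k) => k1; last first.
    have -> : k = 1 by move: b; rewrite /bx; lia.
    exists m, (i2 + m.+1); rewrite -bx0E; split=> //; first by lia.
    by rewrite /bx Xlt // Ym.
  have k2_ : 1 < k2 by lia.
  have h1 := ge' _ _ k1 b; have h2 := ge' _ _ k2_ b'.
  have := g3 (i1 - m.+1) k (i3 - m.+1) k2; rewrite !bx0E !subnK //.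
  move=> /(_ b b' kk) [i' [i []]]; rewrite !bx0E.
  by move=> h3 h4 h5; exists (i' + m.+1), (i + m.+1); split=> //; lia.
Qed.

(** In [X1] the top row has length 1 and gets no box, so [good_top] excludes boxes in column 2 below
    it. *)
Lemma good_cons1 : Y m = 1 ->
  good 2 X1 Y1 <-> good 2 X0 Y0 /\ ~ exists i, bx X0 Y0 i 2.
Proof.
move=> Ym; have far0 i k : bx X0 Y0 i k -> 1 < k.
  by rewrite bx0E; apply: bx_far; lia.
have bS i k : bx X1 Y1 i.+1 k = bx X0 Y0 i k.
  by rewrite /bx X1S Y1E Y0E addSnnS.
have b0 k : bx X1 Y1 0 k = false by rewrite /bx X10 Y1E add0n Ym; lia.
split=> [[g0 g1 g2 g3]|[[g0 g1 g2 g3] ne]].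
  split; last first.
    by case=> i bi; have := g1 0 i.+1 2 isT; rewrite bS X10 b0 => /(_ bi erefl).
  split.
  - by move=> i; have := g0 i.+1; rewrite X1S Y1E Y0E addSnnS.
  - by move=> i i' k ii'; have := g1 i.+1 i'.+1 k ii'; rewrite !bS X1S.
  - by move=> i i' k; have := g2 i.+1 i'.+1 k; rewrite !bS.
  - move=> i1 k i2 k2; have := g3 i1.+1 k i2.+1 k2; rewrite !bS => h b b' kk.
    have [i' [i []]] := h b b' kk.
    case: i' => [|i']; case: i => [|i]; rewrite ?b0 // !bS.
    by exists i', i.
split.
- case=> [|i]; first by rewrite X10 Y1E add0n Ym.
  by have := g0 i; rewrite X1S Y1E Y0E addSnnS.
- move=> i [|i'] k ii'; first by rewrite b0.
  rewrite bS; case: i ii' => [|i] ii' b; rewrite ?X10 ?X1S ?bS.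
    by move=> kE; case: ne; exists i'; rewrite kE.
  exact: (g1 i i' k ii' b).
- by move=> [|i] [|i'] k; rewrite ?b0 // !bS; exact: g2.
- move=> [|i1] k [|i2] k2; rewrite ?b0 // !bS => b b' kk.
  have [i' [i h]] := g3 _ _ _ _ b b' kk.
  by exists i'.+1, i.+1; rewrite !bS.
Qed.

End FirstColumn.

(* The inner shape occupies the bottom rows of the outer one; the rows above it
   get length 0. *)
Definition pad (x y : seq nat) := nseq (size y - size x) 0 ++ x.

Lemma nth_pad x y i : nth 0 (pad x y) i =
  if i < size y - size x then 0 else nth 0 x (i - (size y - size x)).
Proof. by rewrite nth_cat size_nseq; case: ifP => // h; rewrite nth_nseq h. Qed.

Lemma size_pad x y : size x <= size y -> size (pad x y) = size y.
Proof. by move=> h; rewrite size_cat size_nseq subnK. Qed.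

Lemma act_nseq1 a z : act (nseq a 1) z = Some (nseq a 1 ++ z).
Proof. by elim: a => //= a ->. Qed.

(** Letters 1 put rows of length 1 on top, and the letters of [u] keep the number of rows; so the
    sizes determine [a]. *)
Lemma act_nseq1_cat a u x y : all (leq 2) u ->
  (act (nseq a 1 ++ u) x == Some y) =
  [&& size y == size x + a, take a y == nseq a 1 & act u x == Some (drop a y)].
Proof.
move=> u2; rewrite act_cat; apply/eqP/and3P.
  case E: (act u x) => [z|//] /=; rewrite act_nseq1 => -[<-].
  have [sz _] := @act_ge 2 _ _ _ isT u2 E.
  rewrite size_cat size_nseq sz addnC take_size_cat ?drop_size_cat ?size_nseq //.
case=> _ /eqP tk /eqP->; rewrite /= act_nseq1 -tk.
by rewrite cat_take_drop.
Qed.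

Lemma rows_cons a b x y : rows (a :: x) (b :: y) = (a < b) + rows x y.
Proof. by rewrite /rows big_ord_recl. Qed.

Lemma rows_nseq m x y : rows (nseq m 0 ++ x) (nseq m 1 ++ y) = m + rows x y.
Proof. by elim: m => //= m IH; rewrite rows_cons IH. Qed.

Local Open Scope ring_scope.

Lemma act_sum_shift k n N x y : (size x <= size y)%N ->
  let m := (size y - size x)%N in
  \sum_(a < N) (-1) ^+ a *
    hook_sum 2 k (n - a) (fun u => (act (nseq a 1 ++ u) x == Some y)%:R) =
  ((m < N)%N && (take m y == nseq m 1%N))%:R *
     ((-1) ^+ m * act_sum 2 k (n - m) x (drop m y)).
Proof.
move=> s m.
have step a : hook_sum 2 k (n - a)
    (fun u => (act (nseq a 1 ++ u) x == Some y)%:R) =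
    ((a == m) && (take a y == nseq a 1%N))%:R * act_sum 2 k (n - a) x (drop a y).
  rewrite -hook_sumZ; apply: eq_hook_sum => u _ ju.
  rewrite act_nseq1_cat // andbA -natrM mulnb.
  by have -> : (size y == size x + a)%N = (a == m) by rewrite /m; lia.
have [mN|mN] := ltnP m N; last first.
  rewrite mul0r big1 // => a _; rewrite step.
  by case: eqP => [e|]; rewrite ?mul0r ?mulr0 //; have := ltn_ord a; lia.
rewrite (bigD1 (Ordinal mN)) //= big1 ?addr0; first by rewrite step eqxx mulrCA.
move=> a ne; rewrite step; case: eqP => [e|]; rewrite ?mul0r ?mulr0 //.
by case/eqP: ne; apply: val_inj.
Qed.

Lemma act_sum_shift0 k n N x y : (size y < size x)%N ->
  \sum_(a < N) (-1) ^+ a *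
    hook_sum 2 k (n - a) (fun u => (act (nseq a 1 ++ u) x == Some y)%:R) = 0.
Proof.
move=> s; rewrite big1 // => a _; rewrite hook_sum_eq0 ?mulr0 // => u ju.
rewrite act_nseq1_cat //; have -> // : (size y == size x + a)%N = false by lia.
Qed.

(** One more splitting step, for column 1, with the lowest new row [m'] in place of the first row of
    length [j-1]; the remaining columns are covered by [act_sum_good]. *)
Theorem act_sum_strip k n x y : is_comp x -> is_comp y -> (size x <= size y)%N ->
  sumn y = (sumn x + n)%N -> (0 < n)%N -> (forall i, nth 0 y i < 1 + k)%N ->
  exists2 b : bool, b <-> strip (nth 0%N (pad x y)) (nth 0%N y) &
    act_sum 1 k n x y = b%:R * (-1) ^+ (rows (pad x y) y).-1.
Proof.
move=> cx cy sxy; case: n => // n sn _ by_.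
have ypos i : (i < size y)%N -> (0 < nth 0 y i)%N by move=> h; rewrite (all_nthP 0%N cy).
have xpos i : (i < size x)%N -> (0 < nth 0 x i)%N by move=> h; rewrite (all_nthP 0%N cx).
case: k by_ => [|k] by_.
  have y0 : (0 < size y)%N by case: (y) sn => //=; lia.
  by have := ypos _ y0; have := by_ 0%N; lia.
have sE : act_sum 1 k.+1 n.+1 x y =
  (-1) ^+ n * (act (nseq n.+1 1%N) x == Some y)%:R
  + (\sum_(a < n.+1) (-1) ^+ a * hook_sum 2 k (n.+1 - a)
        (fun u => (act (nseq a 1 ++ u) x == Some y)%:R)
  +  \sum_(a < n.+1) (-1) ^+ a * hook_sum 2 k (n - a)
        (fun u => (act (nseq a 1 ++ u) (1 :: x)%N == Some y)%:R)).
  rewrite /act_sum hook_sum_split; congr (_ + _).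
  rewrite -big_split; apply: eq_bigr => a _ /=; rewrite mulrDr; congr (_ + _ * _).
  by apply: eq_hook_sum => u _ _; rewrite -cats1 catA act_cat.
rewrite {}sE act_nseq1 act_sum_shift //.
have pE := nth_pad x y.
set m := (size y - size x)%N in pE *.
case Em: m => [|m'].
  (* Without new rows no letter 1 occurs; a final one would already give too many rows. *)
  have s : size x = size y by lia.
  have pE' : pad x y = x by rewrite /pad -/m Em.
  rewrite act_sum_shift0; last by rewrite /= s.
  rewrite take0 drop0 subn0 expr0 !mul1r addr0 pE'.
  have [||||i|b bP bE] := @act_sum_good k 2 n.+1 x y => //.
  exists b.
    rewrite bP; apply: iff_sym; apply: strip_good => i.
    case: (ltnP i (size x)) => [/xpos|h _]; first by lia.
    by rewrite nth_default // -s.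
  rewrite bE; case: eqP => [[e]|_]; last by rewrite mulr0 add0r.
  by move: s; rewrite -e /= size_cat size_nseq; lia.
have s1 : (size (1 :: x)%N <= size y)%N by rewrite /= ; lia.
rewrite act_sum_shift //.
have -> : (size y - size (1 :: x)%N)%N = m' by rewrite /=; lia.
set ym := nth 0%N y m'; set y' := drop m'.+1 y.
have my : (m' < size y)%N by lia.
have dE : drop m' y = ym :: y' by rewrite (drop_nth 0%N).
have tE : take m'.+1 y = rcons (take m' y) ym by rewrite (take_nth 0%N).
have yE : y = take m' y ++ ym :: y' by rewrite -dE cat_take_drop.
have sy' : size y' = size x by rewrite size_drop; lia.
have szt : size (take m' y) = m' by rewrite size_take my.
have ym0 : (0 < ym)%N by apply: ypos.
rewrite dE tE.
have nE : nseq m'.+1 1%N = rcons (nseq m' 1%N) 1%N.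
  by rewrite -cats1 -[[:: 1%N]]/(nseq 1 1%N) -nseqD addn1.
rewrite nE eqseq_rcons.
have Xlt i : (i <= m')%N -> nth 0%N (pad x y) i = 0%N.
  by move=> h; rewrite pE Em ltnS h.
have Xge i : (m' < i)%N -> nth 0%N (pad x y) i = 0%N -> nth 0%N y i = 0%N.
  move=> h; rewrite pE Em ifN -?leqNgt //.
  case: (ltnP (i - m'.+1) (size x)) => [/xpos|h' _]; first by lia.
  by rewrite nth_default //; lia.
have X0E i : nth 0%N x i = nth 0%N (pad x y) (i + m'.+1).
  by rewrite pE Em addnK ifN // -leqNgt leq_addl.
have Y0E i : nth 0%N y' i = nth 0%N y (i + m'.+1) by rewrite nth_drop addnC.
have Y1E i : nth 0%N (ym :: y') i = nth 0%N y (i + m') by rewrite -dE nth_drop addnC.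
(* The rows above row [m'] come from leading letters and have length 1. A strip has the same
   property by [strip_row1], since row [m'] has a box of column 1 below them. *)
case: (altP (take m' y =P nseq m' 1%N)) => /= tk; last first.
  exists false.
    split=> // -[_ _ _ s3 _]; case/eqP: tk.
    apply: (@eq_from_nth _ 0%N); rewrite szt ?size_nseq // => i im.
    rewrite nth_take // nth_nseq im.
    have := s3 i m'; rewrite /bx !Xlt //; last by lia.
    by have := @ypos i; move: ym0; rewrite /ym; lia.
  rewrite !andbF /= !mul0r !addr0; case: eqP => [[e]|_]; last by rewrite mulr0.
  have mn : (m' <= n)%N.
    by have := congr1 size e; rewrite /= size_cat size_nseq; lia.
  case/eqP: tk; rewrite -e -[_ :: _]/(nseq n.+1 1%N ++ x).
  by rewrite takel_cat ?size_nseq ?take_nseq //; lia.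
have Ylt i : (i < m')%N -> nth 0%N y i = 1%N.
  by move=> h; rewrite -(nth_take 0%N h) tk nth_nseq h.
have padE : pad x y = nseq m' 0%N ++ 0%N :: x.
  by rewrite /pad -/m Em -addn1 nseqD -catA.
have rE : rows (pad x y) y = (m' + (1 + rows x y'))%N.
  by rewrite padE yE tk rows_nseq rows_cons ym0.
have sumE : sumn y = (m' + (ym + sumn y'))%N.
  by rewrite yE tk sumn_cat sumn_nseq mul1n.
(* If row [m'] is longer than 1, it can only come from a final letter 1. *)
case: (altP (ym =P 1%N)) => /= ym1; last first.
  have Ym : (1 < nth 0 y m')%N by rewrite -/ym; lia.
  have st := strip_cons_long Xlt Xge Ylt X0E (erefl : nth 0%N (1 :: x)%N 0 = 1%N) (fun i => erefl) Y1E Ym.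
  have r1 : rows (1 :: x)%N (ym :: y') = (1 + rows x y')%N by rewrite rows_cons ltn_neqAle eq_sym ym1 ym0.
  have pure0 : Some (nseq n.+1 1%N ++ x) == Some y = false.
    apply/eqP => -[e]; case/eqP: ym1; rewrite /ym -e.
    have := congr1 size e; rewrite /= size_cat size_nseq => h.
    by rewrite -[_ :: _]/(nseq n.+1 1%N ++ x) nth_cat size_nseq ltnS ifT ?nth_nseq ?ifT //; lia.
  rewrite pure0 !andbF mul0r mulr0 !add0r andbT.
  case: (ltnP m' n) => mn; last first.
    exists false.
      split=> // /st[g0 _ _ _].
      have : (sumn (1 :: x)%N < sumn (ym :: y'))%N.
        apply: (@ltn_sumn (1 :: x)%N (ym :: y') 0) => [|i|].
        - by rewrite /= sy'.
        - by case: (g0 i).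
        - by rewrite /=; lia.
      by rewrite /=; lia.
    rewrite mul0r ltnS; case: leqP => h; rewrite ?mul0r // mul1r.
    by have -> : (n - m' = 0)%N by [lia]; rewrite /act_sum hook_sum0 mulr0.
  have [||||i|b bP bE] := @act_sum_good k 2 (n - m') (1 :: x)%N (ym :: y') => //.
  - by rewrite /= sy'.
  - by rewrite /=; lia.
  - by lia.
  - by rewrite Y1E.
  exists b; first by rewrite bP; exact: iff_sym.
  rewrite bE r1 rE ltnS (ltnW mn) mul1r mulrCA -exprD; congr (_ * _ ^+ _); lia.
have Ym : nth 0%N y m' = 1%N by rewrite -/ym.
rewrite ?tk ym1 in yE; rewrite ym1 in sumE Y1E *; rewrite ?andbT.
(* There are at least as many new rows as boxes: a strip then requires [y'] to be [x], and the word
   is a power of 1. *)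
case: (leqP n m') => mn.
  have xE : (y' == x) = (Some (nseq n.+1 1%N ++ x) == Some y).
    apply/eqP/eqP => [e|[e]].
      have mn' : m' = n by rewrite e in sumE; lia.
      by rewrite yE -mn' e nE cat_rcons.
    have mn' : m' = n by have := congr1 size e; rewrite /= size_cat size_nseq; lia.
    by rewrite /y' -e mn' -[_ :: _]/(nseq n.+1 1%N ++ x) drop_size_cat ?size_nseq.
  exists (y' == x).
    split=> [/eqP e|[s0 _ _ _ _]].
      have hX i : (i <= m')%N /\ nth 0%N (pad x y) i = 0%N /\ nth 0%N y i = 1%N \/
                  (m' < i)%N /\ nth 0%N (pad x y) i = nth 0%N y i.
        case: (ltngtP i m') => h; [left|right|left].
        - by rewrite Xlt ?Ylt //; lia.
        - by split=> //; rewrite -(subnK h) -X0E -Y0E e.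
        - by rewrite h Xlt ?Ym.
      split.
      - by move=> i; have := hX i; lia.
      - by move=> i i' k1; have := hX i; have := hX i'; rewrite /bx; lia.
      - by move=> i i' k1; have := hX i; rewrite /bx; lia.
      - by move=> i i'; have := hX i; rewrite /bx; lia.
      - by move=> i1 k1 i2 k2; have := hX i1; have := hX i2; rewrite /bx; lia.
    have le i : (nth 0 x i <= nth 0 y' i)%N by rewrite X0E Y0E.
    apply/eqP/esym/sumn_eq => //; have := leq_sumn (esym sy') le; lia.
  rewrite -xE; have -> : (m'.+1 < n.+1)%N = false by lia.
  rewrite mul0r add0r; have -> : (n - m' = 0)%N by lia.
  rewrite /act_sum hook_sum0 !mulr0 addr0 rE mulrC.
  case: eqP => [e|_]; rewrite ?mul0r //; congr (_ * _ ^+ _).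
  have -> : rows x y' = 0%N by rewrite e /rows big1 // => i _; rewrite ltnn.
  by rewrite e in sumE; lia.
have -> : (Some (nseq n.+1 1%N ++ x) == Some y) = false.
  apply/eqP => -[e]; have := congr1 size e.
  by rewrite /= size_cat size_nseq; lia.
have -> : (m'.+1 < n.+1)%N by lia.
have -> : (m' < n.+1)%N by lia.
rewrite mulr0 add0r !mul1r subSS.
have [||||i|c0 c0P c0E] := @act_sum_good k 2 (n - m') x y' => //; try lia.
  by rewrite Y0E.
have [||||i|c1 c1P c1E] := @act_sum_good k 2 (n - m') (1 :: x)%N (1 :: y')%N => //.
- by rewrite /= sy'.
- by rewrite /=; lia.
- by lia.
- by rewrite Y1E.
have eP : reflect (exists i, bx (nth 0%N x) (nth 0%N y') i 2)
    (has (fun i => bx (nth 0%N x) (nth 0%N y') i 2) (iota 0 (size y'))).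
  apply: has_iotaP => i; case: (ltnP i (size y')) => // h.
  by rewrite /bx (nth_default _ h); lia.
set e := has _ _ in eP.
have far : exists i, (nth 0 x i < nth 0 y' i)%N.
  have fP : reflect (exists i, (nth 0 x i < nth 0 y' i)%N)
      (has (fun i => (nth 0 x i < nth 0 y' i)%N) (iota 0 (size y'))).
    apply: has_iotaP => i; case: (ltnP i (size y')) => // h.
    by rewrite (nth_default _ h).
  case: fP => // nf; exfalso; suff : (sumn y' <= sumn x)%N by lia.
  apply: leq_sumn => // i; rewrite leqNgt; apply/negP => h; case: nf.
  by exists i.
have X10 : nth 0%N (1 :: x)%N 0 = 1%N by [].
have st := strip_cons_short Xlt Xge Ylt X0E Y0E X10 Ym far.
have gc := good_cons1 Xge X0E Y0E X10 (fun i => erefl) Y1E Ym.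
(* As for later columns: a final letter 1 is possible as well exactly when column 2 has no box, and
   then the two terms cancel. *)
have c1E' : c1 = c0 && ~~ e.
  apply/idP/andP => [/c1P/gc[/c0P-> h]|[/c0P h /negP ne]].
    by split=> //; apply/negP => /eP.
  by apply/c1P/gc; split=> // /eP.
exists (c0 && e).
  by rewrite st; split=> [/andP[/c0P ? /eP ?]|[/c0P-> /eP->]].
have [i0 hi0] := far; have := rows_gt0 hi0.
rewrite c0E c1E c1E' rE rows_cons ltnn add0n.
case: (rows x y') => // R _; rewrite add1n !addnS /= !exprS exprD.
case: c0 {c0P c0E c1E' c1E c1P st}; case: e {eP};
  rewrite ?mul0r ?mulr0 ?mul1r ?mulr1 ?add0r ?addr0 //=.
  by rewrite mulrA.
by rewrite mulN1r mulNr addNr.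
Qed.

Local Close Scope ring_scope.

(** * Nc border strips *)

Lemma size_leq_sumn a : is_comp a -> size a <= sumn a.
Proof. by elim: a => //= x a IH /andP[x0 /IH]; lia. Qed.

Lemma leq_mem_sumn a x : x \in a -> x <= sumn a.
Proof. by elim: a => //= y a IH; rewrite inE => /orP[/eqP->|/IH]; lia. Qed.

Lemma mem_compositions N a :
  (a \in compositions N) = is_comp a && (sumn a == N).
Proof.
apply/flatten_mapP/andP => [[k _]|[ca /eqP sa]].
  rewrite mem_filter words1 mem_words => /andP[-> /andP[_ h]]; split=> //.
  by apply: sub_all h => c /andP[].
exists (size a); first by rewrite mem_iota add0n ltnS -sa size_leq_sumn.
rewrite mem_filter sa eqxx words1 mem_words eqxx /=; apply/allP => x xa.
by rewrite (allP ca _ xa) add1n ltnS -sa leq_mem_sumn.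
Qed.

Lemma uniq_compositions N : uniq (compositions N).
Proof.
rewrite /compositions; elim: N.+1 0 => //= k IH m.
rewrite cat_uniq IH andbT filter_uniq ?words1 ?words_uniq //=.
apply/hasPn => u /flatten_mapP[l]; rewrite mem_iota => lm.
rewrite !mem_filter !words1 !mem_words => /andP[_ /andP[/eqP su _]].
by rewrite su negb_and negb_and; apply/orP; right; apply/orP; left; lia.
Qed.

(** A cover lengthens the first row of a given length, so the column of the new box determines
    it. *)
Lemma mem_covers_of g e : is_comp g ->
  (e \in covers_of g) <-> exists2 c, 0 < c & add_box c g = Some e.
Proof.
move=> cg; rewrite inE; split=> [/orP[/eqP->|/mapP[k]]|[c c0]].
- by exists 1.
- rewrite mem_filter mem_iota add0n /= => /andP[/allP h ks] ->.
  exists (nth 0 g k).+1 => //; apply: add_box_first.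
    by rewrite ltnS; apply: (allP cg); rewrite mem_nth.
  split=> // i ik; apply/eqP; apply: h.
  by rewrite mem_iota.
case: (ltnP 1 c) => c1; last first.
  by have -> : c = 1 by [lia]; rewrite /add_box /= => -[<-]; rewrite eqxx.
case/add_box_inv=> // r [rs gr lt] ->; apply/orP; right; apply/mapP; exists r => //.
rewrite mem_filter mem_iota add0n rs /= andbT; apply/allP => i.
by rewrite mem_iota add0n /= gr => ir; apply/eqP/lt.
Qed.

Lemma add_box_comp c x y : is_comp x -> add_box c x = Some y -> is_comp y.
Proof.
move=> cx; rewrite /add_box; case: ifP => _; first by case=> <-.
case: ifP => // xin [<-]; apply/(all_nthP 0) => i.
rewrite size_incr_first ?index_mem // => ix; rewrite nth_incr_nth.
by have := all_nthP 0 cx i ix; lia.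
Qed.

Lemma act_comp u x y : is_comp x -> act u x = Some y -> is_comp y.
Proof.
move=> cx; elim: u y => [|c u IH] y /=; first by case=> <-.
by case: (act u x) (IH) => //= z /(_ _ erefl) /add_box_comp h /h.
Qed.

(** The word lists the columns of the added boxes with the last step first. *)
Lemma chain_act n g d : is_comp g -> chain_c n g d <->
  exists u, [/\ size u = n, all (leq 1) u & act u g = Some d].
Proof.
elim: n g => [|n IH] g cg.
  split=> [/eqP->|[u [/size0nil-> _ [->]]]//]; last exact: eqxx.
  by exists [::].
have cE : chain_c n.+1 g d = has (chain_c n ^~ d) (covers_of g) by [].
split; first rewrite cE => /hasP[e /(mem_covers_of _ cg)[c c0 ce] ch].
  have [u [su u1 ue]] := (IH _ (add_box_comp cg ce)).1 ch.
  exists (rcons u c); rewrite size_rcons su all_rcons c0 u1; split=> //.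
  by rewrite -cats1 act_cat /= ce.
case=> u; case: (lastP u) => [[]//|v c []]; rewrite size_rcons => -[sv].
rewrite all_rcons => /andP[c0 v1]; rewrite -cats1 act_cat [act [:: c] g]/=.
case ce: add_box => [e|//] ve; rewrite cE; apply/hasP; exists e.
  by apply/(mem_covers_of _ cg); exists c.
by apply/(IH _ (add_box_comp cg ce)); exists v.
Qed.

(** A box in column [k > 1] goes to the first row of length [k-1], so a higher row of inner length
    [k-1] must have been lengthened before. This supplies the clauses of [strip] that come from
    [<_c] and not from the definition of a border strip. *)
Lemma act_top u x y : all (leq 1) u -> act u x = Some y ->
  [/\ size x <= size y, forall i, nth 0 (pad x y) i <= nth 0 y i &
    forall i i' k, 1 < k -> i < i' -> bx (nth 0 (pad x y)) (nth 0 y) i' k ->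
      (nth 0 (pad x y) i).+1 = k -> bx (nth 0 (pad x y)) (nth 0 y) i k].
Proof.
elim: u y => [|c u IH] y /=.
  move=> _ [<-]; rewrite /pad subnn /=; split=> // i i' k _ _.
  by rewrite /bx; lia.
case/andP=> c0 u1; case: (act u x) (IH) => //= z /(_ _ u1 erefl) [sz le top].
case: (ltnP 1 c) => c1; last first.
  have -> : c = 1 by [lia]; rewrite /add_box /= => -[<-].
  have -> : pad x (1 :: z) = 0 :: pad x z by rewrite /pad /= subSn.
  split=> /= [|[|i]|[|i] [|i'] k k1] //=; first by lia.
    by lia.
  by rewrite ltnS => ii'; exact: top.
case/add_box_inv=> // r [rs zr lt] ->.
have -> : pad x (incr_nth z r) = pad x z by rewrite /pad size_incr_first.
rewrite size_incr_first //; split=> // [i|i i' k k1 ii'].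
  by rewrite nth_incr_nth; have := le i; lia.
have := top i i' k k1 ii'; have := le i; have := le i'.
rewrite /bx !nth_incr_nth; case: (eqVneq r i') => [e|]; last by lia.
by subst i'; have := lt _ ii'; lia.
Qed.

(** * From lists of boxes to row lengths *)

Section SkewBoxes.
Variables (b a : seq nat).
Hypothesis sab : size a <= size b.
Let X := nth 0 (pad a b).
Let Y := nth 0 b.

(** The test [in_inner] also accepts [j = 0] in the bottom rows, hence the second disjunct; boxes
    have [j > 0]. *)
Lemma in_innerE i j : 0 < i -> in_inner b a i j = (0 < X i.-1) && (j <= X i.-1) || (j == 0) && (size b - size a < i).
Proof.
move=> i0; rewrite /in_inner /X nth_pad; case: ifP => h.
  by rewrite ltnn /=; lia.
have -> : size b - size a < i by lia.
have -> : (i - (size b - size a)).-1 = i.-1 - (size b - size a) by lia.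
by case: (nth 0 a _); lia.
Qed.

(** Rows count from 1 in [skew_boxes] and from 0 in [bx]; columns count from 1 in both. *)
Lemma mem_skew p : (p \in skew_boxes b a) = (0 < p.1) && bx X Y p.1.-1 p.2.
Proof.
case: p => i j /=; rewrite mem_filter /=; apply/andP/andP => [[ni]|[i0 bij]].
  case/flatten_mapP=> i' ; rewrite mem_iota => i1 /mapP[j']; rewrite mem_iota.
  move=> j1 [ii jj]; subst i' j'; have i0 : 0 < i by lia.
  by move: ni; rewrite in_innerE // /bx /Y; lia.
split; first by rewrite in_innerE //; move: bij; rewrite /bx; lia.
have ib : i.-1 < size b.
  by case: (ltnP i.-1 (size b)) bij => // h; rewrite /bx /Y (nth_default _ h); lia.
apply/flatten_mapP; exists i; first by rewrite mem_iota; lia.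
apply/mapP; exists j => //; rewrite mem_iota; move: bij; rewrite /bx /Y; lia.
Qed.

Lemma mem_supp j : j \in supp b a <-> exists i, bx X Y i j.
Proof.
rewrite mem_undup; split=> [/mapP[[i j'] /=]|[i h]].
  by rewrite mem_skew /= => /andP[_ h] ->; exists i.-1.
by apply/mapP; exists (i.+1, j) => //; rewrite mem_skew.
Qed.

(** Clause [strip_next] combines two conditions: a column with boxes to its right is followed by a
    nonempty column (interval shape), and that column does not lie entirely above it (empty
    [NE]). *)
Lemma strip_shape : (forall i, X i <= Y i) ->
  (forall i i' k, 1 < k -> i < i' -> bx X Y i' k -> (X i).+1 = k -> bx X Y i k) ->
  nc_border_strip b a && nilp (NE b a) <-> strip X Y.
Proof.
move=> le top; split=> [/andP[/and3P[iv c1 c2] ne]|[_ _ s2 s3 s4]].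
  split=> //.
  - move=> i i' k k1 b1 b2 b3; have := allP c2 (i.+1, k).
    rewrite mem_skew /= b1 k1 /in_skew mem_skew /= b2 => /(_ isT)/allP/(_ (i'.+1, k)).
    by rewrite mem_skew /= b3 eqxx /= ltnS => /(_ isT).
  - move=> i i' b1 b2 b3; have := allP c1 (i.+1, 1).
    rewrite mem_skew /= b1 /in_skew mem_skew /= b2 => /(_ isT)/allP/(_ (i'.+1, 1)).
    by rewrite mem_skew /= b3 ltnS => /(_ isT).
  - move=> i1 k i2 k2 b1 b2 kk.
    have ks : k \in supp b a by apply/mem_supp; exists i1.
    have k2s : k2 \in supp b a by apply/mem_supp; exists i2.
    have k1s : k.+1 \in supp b a.
      case: (ltngtP k.+1 k2) => [h||->//]; last by lia.
      by apply: (allP (allP (allP iv _ ks) _ k2s)); rewrite mem_iota; lia.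
    have [i3 b3] := (mem_supp _).1 k1s.
    move: ne; rewrite /nilp size_eq0 -[_ == _]negbK -has_filter => /hasPn/(_ _ ks).
    rewrite negb_and => /orP[/hasPn/(_ (i3.+1, k.+1))|/allPn[q1]].
      by rewrite mem_skew /= b3 eqxx => /(_ isT).
    case: q1 => i4 j4; rewrite mem_skew negb_imply /= => /andP[q10 bq1] /andP[/eqP e1].
    case/allPn=> -[i5 j5]; rewrite mem_skew negb_imply /= => /andP[q20 bq2] /andP[/eqP e2 h].
    by exists i5.-1, i4.-1; rewrite -e1 -e2; split=> //; move: h; clear; lia.
apply/andP; split; first apply/and3P; first split.
- apply/allP => j1 /mem_supp[i1 b1]; apply/allP => j2 /mem_supp[i2 b2].
  apply/allP => j; rewrite mem_iota => /andP[j1j jj2]; have {}jj2 : j < j2 by lia.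
  have -> : j = j1 + (j - j1) by lia.
  have : j1 + (j - j1) < j2 by lia.
  elim: (j - j1) => [|t IH] h; first by apply/mem_supp; exists i1; rewrite addn0.
  have /IH/mem_supp[i3 b3] : j1 + t < j2 by lia.
  have [|i' [i [_ _ b4]]] := s4 _ _ _ _ b3 b2 _; first by lia.
  by apply/mem_supp; exists i; rewrite addnS.
- apply/allP => -[i j]; rewrite mem_skew /= => /andP[i0 b1].
  apply/implyP => /eqP j1; apply/implyP; rewrite /in_skew mem_skew /= => /andP[_ b2].
  apply/allP => -[i' j']; rewrite mem_skew /= => /andP[i0' b3]; apply/implyP => /eqP j1'.
  by subst j j'; have := s3 _ _ b1 b2 b3; lia.
- apply/allP => -[i j]; rewrite mem_skew /= => /andP[i0 b1].
  apply/implyP => j1; apply/implyP; rewrite /in_skew mem_skew /= => /andP[_ b2].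
  apply/allP => -[i' j']; rewrite mem_skew /= => /andP[i0' b3]; apply/implyP => /eqP e.
  by subst j'; have := s2 _ _ _ j1 b1 b2 b3; lia.
rewrite /nilp size_eq0 -[_ == _]negbK -has_filter; apply/hasPn => j /mem_supp[i1 b1].
apply/negP => /andP[/hasP[[i2 j2]]]; rewrite mem_skew /= => /andP[i0 b2] /eqP e.
subst j2; have [i' [i [ii b3 b4]]] := s4 _ _ _ _ b1 b2 (ltnSn j).
move=> /allP/(_ (i.+1, j.+1)); rewrite mem_skew /= b4 eqxx => /(_ isT)/allP/(_ (i'.+1, j)).
by rewrite mem_skew /= b3 eqxx => /(_ isT) /=; lia.
Qed.

Lemma count_gtn_iota x y : count (fun j => x < j) (iota 1 y) = y - x.
Proof.
elim: y => // y IH; rewrite -(addn1 y) iotaD count_cat IH /=.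
by lia.
Qed.

Lemma sumn_pad : sumn (pad a b) = sumn a.
Proof. by rewrite sumn_cat sumn_nseq. Qed.

Lemma size_skew : (forall i, X i <= Y i) -> size (skew_boxes b a) = sumn b - sumn a.
Proof.
move=> le; rewrite size_filter count_flatten -map_comp -sumn_pad.
have -> : map (count (fun p => ~~ in_inner b a p.1 p.2) \o
    (fun i => [seq (i, j) | j <- iota 1 (nth 0 b i.-1)])) (iota 1 (size b)) =
    [seq Y i - X i | i <- iota 0 (size b)].
  rewrite (iotaDl 1) -map_comp; apply: eq_map => i; rewrite /comp add1n /=.
  rewrite count_map -count_gtn_iota; apply: eq_in_count => j /=; rewrite mem_iota => j0.
  by rewrite in_innerE //=; lia.
rewrite sumn_nth size_map size_iota !sumn_nth size_pad // -sumnB; last by [].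
by apply: eq_bigr => i _; rewrite (nth_map 0) ?size_iota // nth_iota.
Qed.

Lemma ht_rows : ht b a = (rows (pad a b) b).-1.
Proof.
rewrite /ht; congr _.-1.
have -> : rows (pad a b) b = size [seq i.+1 | i <- iota 0 (size b) & X i < Y i].
  rewrite /rows -(big_mkord xpredT (fun i => (X i < Y i : nat))) /index_iota subn0.
  rewrite size_map size_filter -sum1_count [RHS]big_mkcond.
  by apply: eq_bigr => i _; case: ifP.
apply/perm_size/uniq_perm; rewrite ?undup_uniq //.
  by rewrite map_inj_uniq ?filter_uniq ?iota_uniq // => i j [].
move=> i; rewrite mem_undup; apply/mapP/mapP => [[[i' j]]|[i']].
  rewrite mem_skew /= => /andP[i0 bij] ->; exists i'.-1; last by rewrite prednK.
  rewrite mem_filter mem_iota; have : X i'.-1 < Y i'.-1 by move: bij; rewrite /bx; lia.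
  move=> h; rewrite h /=; case: (ltnP i'.-1 (size b)) => // h'.
  by move: h; rewrite /Y (nth_default _ h').
rewrite mem_filter => /andP[xy _] ->; exists (i'.+1, Y i') => //.
by rewrite mem_skew /= /bx; lia.
Qed.

End SkewBoxes.

Local Open Scope ring_scope.

Theorem act_sum_P_set k n (x y : seq nat) : is_comp x -> (0 < n)%N ->
  y \in compositions (sumn x + n) -> (sumn x + n <= k)%N ->
  act_sum 1 k n x y = (y \in P_set x n)%:R * (-1) ^+ ht y x.
Proof.
move=> cx n0 yc nk; have := yc; rewrite mem_compositions => /andP[cy /eqP sy].
have lt_cE : lt_c x y = chain_c n x y.
  rewrite /lt_c sy; have -> : (sumn x < sumn x + n)%N by lia.
  by rewrite addKn.
rewrite mem_filter yc andbT lt_cE.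
case: (leqP (size x) (size y)) => sxy; last first.
  have nact u : all (leq 1) u -> act u x = Some y -> False.
    by move=> u1 /(act_top u1)[h _ _]; rewrite leqNgt sxy in h.
  have -> : chain_c n x y = false.
    by apply/negP => /(chain_act _ _ cx)[u [_ u1 /(nact _ u1)]].
  rewrite mul0r; apply: hook_sum_eq0 => u u1.
  by case: eqP => // /(nact _ u1).
have bd i : (nth 0 y i < 1 + k)%N.
  rewrite add1n ltnS; apply: leq_trans nk; rewrite -sy.
  case: (ltnP i (size y)) => h; first by rewrite leq_mem_sumn ?mem_nth.
  by rewrite nth_default.
have [c cP cE] := act_sum_strip cx cy sxy sy n0 bd.
rewrite cE ht_rows //; congr ((nat_of_bool _)%:R * _); apply/idP/and4P => [h|[]].
  have st := cP.1 h; have [le top _ _ _] := st.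
  have := (strip_shape sxy le top).2 st => /andP[-> ->].
  rewrite size_skew // sy addKn; split=> //; apply/(chain_act _ _ cx).
  (* The relation [<_c] holds because the sum over words is plus or minus one: some word must lead
     from [x] to [y]. *)
  have : has (fun u => act u x == Some y) (words 1 k n).
    apply/negPn/negP => /hasPn h0; move: cE; rewrite h mul1r => /eqP.
    rewrite /act_sum /hook_sum big1_seq; first by rewrite eq_sym signr_eq0.
    by move=> u /andP[_ /h0/negbTE->]; rewrite mulr0.
  case/hasP=> u; rewrite mem_words => /andP[/eqP su au] /eqP E; exists u; split=> //.
  by apply: sub_all au => c' /andP[].
move=> /(chain_act _ _ cx)[u [_ u1 /(act_top u1)[_ le top]]] nc _ ne.
by apply/cP/(strip_shape sxy le top); rewrite nc.
Qed.

Local Close Scope ring_scope.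

(** * Tableaux and column words *)

Definition shift (T : seq (seq nat)) := map (map S) T.

(** Inverse to deleting the entry 1: all entries are raised by 1, and a new 1 is put into the box
    that [add_box c] adds. *)
Definition grow (c : nat) (T : seq (seq nat)) :=
  if c == 1 then [:: 1] :: shift T
  else let r := find (fun R => size R == c.-1) T in
    set_nth [::] (shift T) r (rcons (nth [::] (shift T) r) 1).

Definition build (w : seq nat) := foldr grow [::] w.

Definition colword (T : seq (seq nat)) :=
  [seq (col_of T v).+1 | v <- iota 1 (size (flatten T))].

Definition entry (T : seq (seq nat)) i k := nth 0 (nth [::] T i) k.

(** Rows and columns count from 0, and [entry] is 0 outside the diagram. The strict inequalities of
    [srct_triple] therefore already say that the boxes of row [i] exist. *)
Record srct (a : seq nat) (T : seq (seq nat)) : Prop := Srct {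
  srct_shape : map size T = a;
  srct_perm : perm_eq (flatten T) (iota 1 (sumn a));
  srct_row : all (sorted (fun x y => y < x)) T;
  srct_col : sorted ltn (map (head 0) T);
  srct_triple : forall i j k, i < j -> k.+1 < size (nth [::] T j) ->
    entry T j k.+1 < entry T i k -> entry T j k.+1 < entry T i k.+1 }.

Lemma size_row (T : seq (seq nat)) i : size (nth [::] T i) = nth 0 (map size T) i.
Proof.
case: (ltnP i (size T)) => h; first by rewrite (nth_map [::]).
by rewrite !nth_default ?size_map.
Qed.

Lemma srctP a T : is_srct a T <-> srct a T.
Proof.
split=> [/and5P[/eqP sh pe ro co tr]|[sh pe ro co tr]].
  split=> // i j k ij kj lt; have jT : j < size T.
    by case: (ltnP j (size T)) kj => // /(nth_default [::])->.
  have sa : size a = size T by rewrite -sh size_map.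
  have kj' : k.+1 < nth 0 a j by rewrite -sh -size_row.
  have ki : k < nth 0 a i.
    rewrite -sh -size_row; case: (ltnP k (size (nth [::] T i))) => // h.
    by move: lt; rewrite /entry (nth_default _ h).
  have m1 : i.+1 \in iota 1 (size a) by rewrite mem_iota sa; lia.
  have m2 : j.+1 \in iota 1 (size a) by rewrite mem_iota sa; lia.
  have := allP (allP tr _ m1) _ m2; rewrite ltnS ij /= => /allP tr'.
  have m3 : k.+1 \in iota 1 (nth 0 a j) by rewrite mem_iota; lia.
  have := tr' _ m3; rewrite /in_shape sa /= (ltn_trans ij jT) jT kj' ki /=.
  by rewrite /tau /= -!/(entry _ _ _) lt => /andP[].
apply/and5P; split=> //; first exact/eqP.
apply/allP => -[|i]; rewrite mem_iota // => iT.
apply/allP => -[|j]; rewrite mem_iota // => jT; apply/implyP; rewrite ltnS => ij.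
apply/allP => -[|k]; rewrite mem_iota // => kj; apply/implyP.
rewrite /in_shape /tau /= => /andP[/andP[/andP[_ h1] /andP[_ h2]] lt].
have h3 : entry T j k.+1 < entry T i k.+1.
  by apply: tr => //; rewrite size_row sh.
rewrite [X in _ && X]h3 andbT; apply/andP; split; first by lia.
rewrite -sh -size_row; case: (ltnP k.+1 (size (nth [::] T i))) => // h.
by move: h3; rewrite [X in _ < X](nth_default _ h).
Qed.

Definition pos_rows (T : seq (seq nat)) := all (all (ltn 0)) T.

Lemma pos_perm T n : perm_eq (flatten T) (iota 1 n) -> pos_rows T.
Proof.
move=> pe; apply/allP => R RT; apply/allP => v vR.
have : v \in flatten T by apply/flattenP; exists R.
by rewrite (perm_mem pe) mem_iota => /andP[].
Qed.

Lemma srct_pos a T : srct a T -> pos_rows T.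
Proof. by case=> _ /pos_perm. Qed.

Lemma nth_map_succ R k : nth 0 (map S R) k = if k < size R then (nth 0 R k).+1 else 0.
Proof.
case: ltnP => h; first by rewrite (nth_map 0).
by rewrite nth_default ?size_map.
Qed.

Lemma entry_pos T i k : pos_rows T -> (0 < entry T i k) = (k < size (nth [::] T i)).
Proof.
move=> pT; rewrite /entry; case: (ltnP i (size T)) => iT; last first.
  by rewrite (nth_default _ iT) nth_nil.
have pR := allP pT _ (mem_nth [::] iT).
case: (ltnP k) => h; first exact: (allP pR _ (mem_nth 0 h)).
by rewrite (nth_default _ h).
Qed.

Lemma entry_shift T i k : pos_rows T ->
  entry (shift T) i k = if 0 < entry T i k then (entry T i k).+1 else 0.
Proof.
move=> pT; rewrite entry_pos // /entry; case: (ltnP i (size T)) => iT.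
  by rewrite (nth_map [::]) // nth_map_succ.
by rewrite !(nth_default _ iT) ?nth_default ?size_map.
Qed.

Arguments shift : simpl never.

Lemma shift_cons R T : shift (R :: T) = map S R :: shift T.
Proof. by []. Qed.

Lemma shift_cat T1 T2 : shift (T1 ++ T2) = shift T1 ++ shift T2.
Proof. exact: map_cat. Qed.

Lemma growE c T1 R T2 : c != 1 -> size R = c.-1 ->
  all (fun R' => size R' != c.-1) T1 ->
  grow c (T1 ++ R :: T2) = shift T1 ++ rcons (map S R) 1 :: shift T2.
Proof.
move=> c1 sR a1; rewrite /grow (negbTE c1).
have -> : find (fun R' => size R' == c.-1) (T1 ++ R :: T2) = size T1.
  rewrite find_cat; case: hasP => [[R' R'1 /eqP h]|_]; last by rewrite /= sR eqxx addn0.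
  by move/allP: a1 => /(_ _ R'1); rewrite h eqxx.
rewrite shift_cat shift_cons set_nthE ifT; last by rewrite size_cat /= !size_map; lia.
rewrite take_size_cat ?size_map // nth_cat size_map ltnn subnn /=.
by congr (_ ++ _ :: _); rewrite -cat_rcons drop_size_cat // size_rcons size_map.
Qed.

Lemma entry_cat T1 R T2 i k : entry (T1 ++ R :: T2) i k =
  if i < size T1 then entry T1 i k
  else if i == size T1 then nth 0 R k else entry T2 (i - (size T1).+1) k.
Proof.
rewrite /entry nth_cat; case: ifP => // h; case: eqP => [->|ne]; first by rewrite subnn.
have -> : i - size T1 = (i - (size T1).+1).+1 by lia.
by [].
Qed.

Lemma entry_grow T1 R T2 i k : pos_rows (T1 ++ R :: T2) ->
  entry (shift T1 ++ rcons (map S R) 1 :: shift T2) i k =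
  if (i == size T1) && (k == size R) then 1
  else if 0 < entry (T1 ++ R :: T2) i k then (entry (T1 ++ R :: T2) i k).+1 else 0.
Proof.
move=> pT; have := entry_shift i k pT; rewrite shift_cat shift_cons !entry_cat !size_map.
case: ltngtP => //= _ <-; rewrite nth_rcons size_map.
by case: ltngtP => // h; rewrite nth_default ?size_map // ltnW.
Qed.

Lemma perm_flatten_grow T1 R T2 :
  perm_eq (flatten (shift T1 ++ rcons (map S R) 1 :: shift T2))
          (1 :: map S (flatten (T1 ++ R :: T2))).
Proof.
have fE (s : seq nat) ss : flatten (s :: ss) = s ++ flatten ss by [].
apply/permP => p; have cE x (s : seq nat) : count p (x :: s) = p x + count p s by [].
rewrite cE map_flatten -/(shift _) shift_cat shift_cons !flatten_cat !fE.
by rewrite !count_cat -cats1 count_cat cE /=; lia.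
Qed.

Lemma iota1S n : iota 1 n.+1 = 1 :: map S (iota 1 n).
Proof. by rewrite /= -(iotaDl 1). Qed.

Lemma sorted_map_succ (r : rel nat) s :
  (forall x y, r x.+1 y.+1 = r x y) -> sorted r (map S s) = sorted r s.
Proof. by move=> h; rewrite sorted_map; apply: eq_sorted => x y; exact: h. Qed.

Lemma head_map_succ T : all (fun R => R != [::]) T ->
  map (head 0) (shift T) = map S (map (head 0) T).
Proof. by elim: T => //= -[|x R] T IH //= /IH->. Qed.

Lemma comp_rows T : is_comp (map size T) = all (fun R : seq nat => R != [::]) T.
Proof. by rewrite /is_comp all_map; apply: eq_all => -[]. Qed.

Lemma all_sorted_shift T : all (sorted (fun x y => y < x)) (shift T) =
  all (sorted (fun x y => y < x)) T.
Proof. by rewrite all_map; apply: eq_all => R /=; rewrite sorted_map_succ. Qed.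

Lemma map_size_shift T : map size (shift T) = map size T.
Proof. by rewrite -map_comp; apply: eq_map => R /=; rewrite size_map. Qed.

Lemma add_box_split c T a : 1 < c -> add_box c (map size T) = Some a ->
  exists T1 R T2, [/\ T = T1 ++ R :: T2, size R = c.-1,
    all (fun R' => size R' != c.-1) T1 &
    a = map size (shift T1 ++ rcons (map S R) 1 :: shift T2)].
Proof.
move=> c1 /add_box_inv[//|r [rs xr lt] ->]; rewrite size_map in rs.
exists (take r T), (nth [::] T r), (drop r.+1 T); split.
- by rewrite -drop_nth // cat_take_drop.
- by rewrite size_row xr.
- apply/(all_nthP [::]) => i; rewrite size_take rs => ir; rewrite nth_take //.
  by rewrite size_row; apply/eqP/lt.
have sr : size (take r T) = r by rewrite size_take rs.
rewrite map_cat /= !map_size_shift size_rcons size_map size_row.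
apply: (@eq_from_nth _ 0).
  rewrite size_incr_first ?size_map // size_cat /= !size_map size_drop sr.
  by lia.
move=> i _; rewrite nth_incr_nth nth_cat size_map sr.
case: ltngtP => h; last first.
- by rewrite h subnn.
- have -> : i - r = (i - r.+1).+1 by lia.
  by rewrite /= -!size_row nth_drop subnKC.
by rewrite -!size_row nth_take.
Qed.

Lemma add_box_grow c T1 R T2 : 1 < c -> size R = c.-1 ->
  all (fun R' => size R' != c.-1) T1 ->
  add_box c (map size (T1 ++ R :: T2)) =
  Some (map size (shift T1 ++ rcons (map S R) 1 :: shift T2)).
Proof.
move=> c1 sR a1; rewrite (@add_box_first _ _ (size T1)) //.
  congr Some; rewrite !map_cat /= !map_size_shift size_rcons size_map.
  by elim: T1 {a1} => //= R' T1 ->.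
split; first by rewrite size_map size_cat /=; lia.
  by rewrite -size_row nth_cat ltnn subnn.
move=> i i1; rewrite -size_row nth_cat i1; apply/eqP.
exact: (all_nthP [::] a1).
Qed.

(** At the new box the triple condition holds because no row above has length [c-1]: a row reaching
    column [c-1] also has a box in column [c], with an entry above 1. *)
Lemma srct_grow c a a' T : is_comp a -> srct a T -> 0 < c ->
  add_box c a = Some a' -> srct a' (grow c T).
Proof.
move=> ca sT c0; have pT := srct_pos sT; case: sT (sT) => sh pe ro co tr sT ab.
have sa := add_box_sumn ab.
rewrite -sh comp_rows in ca.
case: (ltnP 1 c) => c1; last first.
  have c1' : c = 1 by lia.
  move: ab; rewrite c1' /add_box /grow /= => -[<-]; split.
  - by rewrite /= map_size_shift sh.
  - have -> : sumn (1 :: a) = (sumn a).+1 by [].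
    have -> : flatten ([:: 1] :: shift T) = 1 :: map S (flatten T).
      by rewrite map_flatten.
    by rewrite iota1S perm_cons; exact: perm_map.
  - by rewrite /= all_sorted_shift.
  - rewrite /= head_map_succ //=; move: co pT ca; rewrite -(@sorted_map_succ ltn) //.
    by case: (T) => //= -[|x R] T' //= -> /andP[/andP[x0 _] _] _; rewrite ltnS x0.
  - move=> i [|j] k // ij kj.
    have kj' : k.+1 < size (nth [::] T j) by move: kj; rewrite /= !size_row map_size_shift.
    have e0 : 0 < entry T j k.+1 by rewrite entry_pos.
    have -> : entry ([:: 1] :: shift T) j.+1 k.+1 = (entry T j k.+1).+1.
      by rewrite -[LHS]/(entry (shift T) j k.+1) entry_shift // e0.
    case: i ij => [|i] ij.
      rewrite -[entry _ 0 k]/(nth 0 [:: 1] k).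
      by case: (k) => [|k'] /=; rewrite ?nth_nil; lia.
    rewrite -[entry _ i.+1 k]/(entry (shift T) i k).
    rewrite -[entry _ i.+1 k.+1]/(entry (shift T) i k.+1) !entry_shift //.
    by have := tr i j k ij kj'; do !case: ifP; lia.
rewrite -sh in ab; have [T1 [R [T2 [TE sR a1 aE]]]] := add_box_split c1 ab.
rewrite TE growE //; last by lia.
have eG := entry_grow (T1 := T1) (R := R) (T2 := T2).
rewrite TE in pT ca ro co tr; split.
- by rewrite aE.
- rewrite sa iota1S; apply: perm_trans (perm_flatten_grow _ _ _) _.
  by rewrite perm_cons -TE; exact: perm_map.
- rewrite all_cat /= !all_sorted_shift; move: ro; rewrite all_cat /= => /and3P[-> h ->].
  rewrite andbT; move: pT h; rewrite /pos_rows all_cat /= => /and3P[_ pR _].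
  rewrite -(@sorted_map_succ (fun x y => y < x)) // => h.
  case: R {sR TE eG tr co ca aE} pR h => //= x R /andP[x0 pR] h.
  rewrite rcons_path h /=; have := mem_last x.+1 (map S R).
  rewrite inE => /orP[/eqP->|/mapP[y yR ->]]; rewrite ltnS //.
  exact: (allP pR).
- have -> : map (head 0) (shift T1 ++ rcons (map S R) 1 :: shift T2) =
      map (head 0) (shift (T1 ++ R :: T2)).
    rewrite shift_cat shift_cons !map_cat /=; congr (_ ++ _ :: _).
    by case: (R) sR => //=; lia.
  by rewrite head_map_succ // sorted_map_succ.
move=> i j k ij kj; rewrite !eG //.
have := tr i j k ij; rewrite -(entry_pos _ _ pT).
have := @entry_pos _ j k.+1 pT; have := @entry_pos _ i k pT; have := @entry_pos _ i k.+1 pT.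
case: (eqVneq j (size T1)) => [e|jne] /=; last first.
  have : 0 < entry (T1 ++ R :: T2) j k.+1.
    rewrite entry_pos // size_row; move: kj; rewrite size_row.
    rewrite !map_cat /= !map_size_shift !nth_cat !size_map; case: ifP => // h.
    by case E: (j - size T1) => [|t] //=; lia.
  have nR : i = size T1 -> size (nth [::] (T1 ++ R :: T2) i) = size R.
    by move=> ->; rewrite nth_cat ltnn subnn.
  by case: (eqVneq i (size T1)) => [/nR->|_]; clear; case: (eqVneq k (size R));
    case: (eqVneq k.+1 (size R)) => /=; do !case: ifP; lia.
have ine : i != size T1 by lia.
rewrite (negbTE ine) /=; case: (eqVneq k.+1 (size R)) => [ke|kne]; last first.
  have kR : k.+1 < size R.
    move: kj; rewrite e nth_cat size_map ltnn subnn /= size_rcons size_map; lia.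
  have -> : 0 < entry (T1 ++ R :: T2) j k.+1.
    by rewrite entry_pos // e nth_cat ltnn subnn.
  by do !case: ifP; lia.
have := all_nthP [::] a1 i; rewrite -e => /(_ ij).
have -> : nth [::] T1 i = nth [::] (T1 ++ R :: T2) i by rewrite nth_cat -e ij.
by move=> sne p1 p2 _ _; do !case: ifP; lia.
Qed.

Definition unshift (T : seq (seq nat)) := map (map predn) T.

Lemma map_predK R : all (ltn 0) R -> map S (map predn R) = R.
Proof. by elim: R => //= x R IH /andP[x0 /IH->]; rewrite prednK. Qed.

Lemma unshiftK T : pos_rows T -> shift (unshift T) = T.
Proof. by elim: T => //= R T IH /andP[R0 /IH]; rewrite shift_cons map_predK // => ->. Qed.

Lemma sorted_rcons_gt (s : seq nat) z : sorted (fun x y => y < x) (rcons s z) =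
  all (ltn z) s && sorted (fun x y => y < x) s.
Proof.
have tr : transitive (fun x y => y < x) by move=> y x z' /=; lia.
by rewrite !(sorted_pairwise tr) pairwise_rcons.
Qed.

(** Rows decrease, so 1 ends its row. If it is alone there, the row is the top one since the first
    column increases; otherwise the triple condition makes the row, without its 1, the first of its
    length, and [add_box] restores the box. *)
Lemma srct_shrink a T : is_comp a -> srct a T -> 0 < sumn a ->
  exists c a' T', [/\ 0 < c, is_comp a', srct a' T', add_box c a' = Some a &
    T = grow c T'].
Proof.
move=> ca sT a0; have pT := srct_pos sT; case: sT => sh pe ro co tr.
have : 1 \in flatten T by rewrite (perm_mem pe) mem_iota; move: a0; clear; lia.
case/flattenP=> Row RowT; case/splitPr: RowT sh pe ro co tr pT => T1 T2.
case: (lastP Row) => // R z sh pe ro co tr pT oneR.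
move: (ro) (pT); rewrite /pos_rows !all_cat /= sorted_rcons_gt all_rcons.
move=> /and3P[ro1 /andP[zR sR] ro2] /and3P[pT1 /andP[z0 pR] pT2].
have z1 : z = 1.
  move: oneR; rewrite mem_rcons inE => /orP[/eqP//|h].
  by have := allP zR _ h; move: z0 => /=; clear; lia.
subst z; rewrite -sh comp_rows in ca.
pose T1' := unshift T1; pose R' := map predn R; pose T2' := unshift T2.
have TE : T1 ++ rcons R 1 :: T2 = shift T1' ++ rcons (map S R') 1 :: shift T2'.
  by rewrite !unshiftK // map_predK.
have sRR : size R' = size R by rewrite size_map.
have sT' T0 : size (unshift T0) = size T0 by rewrite size_map.
have peS : perm_eq (flatten (T1' ++ R' :: T2')) (iota 1 (sumn a).-1).
  have := perm_flatten_grow T1' R' T2'; rewrite -TE perm_sym => h.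
  have := perm_trans h pe; rewrite -{1}(prednK a0) iota1S perm_cons.
  by move=> h'; apply: (perm_map_inj succn_inj h').
have pT' := pos_perm peS.
have eG i k := entry_grow i k pT'.
rewrite -TE in eG.
case: (eqVneq R [::]) => [R0|Rne].
  have T10 : T1 = [::].
    case: (T1) co ca pT1 => // R0' T1'' /=; rewrite R0 map_cat /=.
    rewrite (path_sortedE ltn_trans) all_cat /= => /andP[/and3P[_ h _] _].
    by case: R0' h => //= x R0' h _ /andP[/andP[x0 _] _]; clear -h x0; lia.
  have T10' : T1' = [::] by rewrite /T1' T10.
  have R0' : R' = [::] by rewrite /R' R0.
  have aE : a = 1 :: map size T2' by rewrite -sh T10 R0 /= /T2' /unshift -map_comp;
    congr (_ :: _); apply: eq_map => s /=; rewrite size_map.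
  exists 1, (map size T2'), T2'; split=> //.
  - by move: ca; rewrite T10 /= => /andP[_]; rewrite -!comp_rows /is_comp !all_map;
      apply: sub_all => s /=; rewrite size_map.
  - split=> //.
    + by move: peS; rewrite T10' R0' /= aE.
    + by rewrite -all_sorted_shift unshiftK.
    + move: co; rewrite T10 R0 /= => /path_sorted; rewrite -[T2]unshiftK //.
      rewrite head_map_succ ?sorted_map_succ //; move: ca; rewrite T10 /= => /andP[_].
      by rewrite all_map; apply: sub_all => -[].
    + move=> i j k ij kj; have := tr i.+1 j.+1 k.
      rewrite !eG T10' R0' /= -!/(entry T2' _ _) ltnS => /(_ ij).
      have e0 : 0 < entry T2' j k.+1.
        by rewrite entry_pos //; move: pT'; rewrite T10' R0'.
      have -> : k.+1 < size (nth [::] (T1 ++ rcons R 1 :: T2) j.+1).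
        by rewrite T10 /=; move: kj; rewrite !size_row; congr (_ < nth _ _ _);
          rewrite /T2' -map_comp; apply: eq_map => s /=; rewrite size_map.
      rewrite /entry /= -!/(entry T2' _ _) e0 => /(_ isT).
      by move: e0; clear; do !case: ifP; lia.
  - by rewrite /add_box aE.
  - by rewrite /grow /= T10 R0 unshiftK.
have R'ne : 0 < size R' by rewrite sRR; case: (R) Rne.
(* A higher row of that length would end in an entry above 1 and have nothing in the column of 1,
   against the triple condition. *)
have a1 : all (fun R0 => size R0 != (size R').+1.-1) T1'.
  apply/(all_nthP [::]) => i; rewrite sT' => i1; apply/eqP => /= se.
  have := tr i (size T1) (size R').-1 i1.
  rewrite nth_cat ltnn subnn /= size_rcons prednK // sRR ltnSn => /(_ isT).
  rewrite !eG !sT' sRR !eqxx (ltn_eqF i1) /=.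
  have sz : size (nth [::] (T1' ++ R' :: T2') i) = size R'.
    by rewrite nth_cat sT' i1.
  have p1 : 0 < entry (T1' ++ R' :: T2') i (size R').-1 by rewrite entry_pos // sz prednK.
  have p2 : 0 < entry (T1' ++ R' :: T2') i (size R') = false by rewrite entry_pos // sz ltnn.
  by rewrite -?sRR p1 p2 ltnS p1 ltn0 => /(_ isT).
have c1 : 1 < (size R').+1 by [].
have aS : add_box (size R').+1 (map size (T1' ++ R' :: T2')) = Some a.
  by rewrite add_box_grow // -TE sh.
have saE : sumn a = (sumn (map size (T1' ++ R' :: T2'))).+1 := add_box_sumn aS.
exists (size R').+1, (map size (T1' ++ R' :: T2')), (T1' ++ R' :: T2'); split=> //.
- rewrite comp_rows all_cat /=; move: ca; rewrite all_cat /= => /and3P[h1 _ h2].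
  rewrite -size_eq0 -lt0n R'ne /= !all_map; apply/andP; split.
    by apply: sub_all h1 => -[].
  by apply: sub_all h2 => -[].
- split=> //.
  + by move: peS; rewrite saE.
  + have us T0 : pos_rows T0 -> all (sorted (fun x y => y < x)) (unshift T0) =
        all (sorted (fun x y => y < x)) T0.
      by move=> p0; rewrite -all_sorted_shift unshiftK.
    rewrite all_cat /= !us // ro1 ro2 andbT /=.
    by rewrite -(@sorted_map_succ (fun x y => y < x)) // map_predK.
  + rewrite -(@sorted_map_succ ltn) // -head_map_succ; last first.
      rewrite all_cat /=; move: ca; rewrite all_cat /= => /and3P[h1 _ h2].
      rewrite -size_eq0 -lt0n R'ne /= !all_map; apply/andP; split.
        by apply: sub_all h1 => -[].
      by apply: sub_all h2 => -[].
    move: co; rewrite TE shift_cat shift_cons !map_cat /=.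
    by case: (R') R'ne.
  + move=> i j k ij kj; have e0 : 0 < entry (T1' ++ R' :: T2') j k.+1 by rewrite entry_pos.
    have := tr i j k ij; rewrite !eG e0.
    have -> : (j == size T1') && (k.+1 == size R') = false.
      apply/negP => /andP[/eqP je /eqP ke]; move: kj.
      by rewrite je nth_cat ltnn subnn /= ke ltnn.
    have -> : k.+1 < size (nth [::] (T1 ++ rcons R 1 :: T2) j).
      have := eG j k.+1; rewrite e0.
      have -> : (j == size T1') && (k.+1 == size R') = false.
        apply/negP => /andP[/eqP je /eqP ke]; move: kj.
        by rewrite je nth_cat ltnn subnn /= ke ltnn.
      by rewrite -(entry_pos _ _ pT) => ->.
    move=> /(_ isT); have ek := entry_pos i k pT'; move: e0 kj ek.
    have nR : i = size T1' -> size (nth [::] (T1' ++ R' :: T2') i) = size R'.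
      by move=> ->; rewrite nth_cat ltnn subnn.
    case: (eqVneq i (size T1')) => [/[dup] ii /nR sz|_] /=.
      by rewrite sz; clear; do ?case: eqP => ?; do ?case: ifP; lia.
    by clear; do !case: ifP; lia.
- by rewrite growE // -?TE //; move: R'ne; clear; lia.
Qed.

Lemma one_notin_shift R : (1 \in map S R) = (0 \in R).
Proof. by rewrite (mem_map succn_inj). Qed.

Lemma find_shift v T : find (fun R => v.+1 \in R) (shift T) = find (fun R => v \in R) T.
Proof.
by rewrite find_map; apply: eq_find => R /=; rewrite (mem_map succn_inj).
Qed.

Lemma has_shift v T : has (fun R => v.+1 \in R) (shift T) = has (fun R => v \in R) T.
Proof.
by rewrite has_map; apply: eq_has => R /=; rewrite (mem_map succn_inj).
Qed.

Lemma has_pos0 T : pos_rows T -> has (fun R => 0 \in R) T = false.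
Proof.
by move=> pT; apply/hasP => -[R RT]; apply/negP/negP => /(allP (allP pT _ RT)).
Qed.

Lemma col_of_cat T1 R T2 v : col_of (T1 ++ R :: T2) v =
  if has (fun R => v \in R) T1 then col_of T1 v
  else if v \in R then index v R else col_of T2 v.
Proof.
rewrite /col_of find_cat; case: ifP => h1; first by rewrite nth_cat -has_find h1.
rewrite /=; case: ifP => h2; first by rewrite addn0 nth_cat ltnn subnn.
by rewrite nth_cat ltnNge leq_addr /= addKn.
Qed.

Lemma col_of_shift T v : has (fun R => v \in R) T -> col_of (shift T) v.+1 = col_of T v.
Proof.
move=> h; rewrite /col_of find_shift (nth_map [::]) -?has_find //.
by rewrite index_map //; exact: succn_inj.
Qed.

Lemma col_of_grow1 T1 R T2 : pos_rows (T1 ++ R :: T2) ->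
  col_of (shift T1 ++ rcons (map S R) 1 :: shift T2) 1 = size R.
Proof.
rewrite /pos_rows all_cat /= => /and3P[p1 pR p2].
rewrite col_of_cat has_shift has_pos0 // mem_rcons mem_head -cats1 index_cat.
rewrite one_notin_shift ifN /= ?addn0 ?size_map //.
by apply/negP => /(allP pR).
Qed.

Lemma col_of_growS T1 R T2 v : 0 < v -> v \in flatten (T1 ++ R :: T2) ->
  col_of (shift T1 ++ rcons (map S R) 1 :: shift T2) v.+1 = col_of (T1 ++ R :: T2) v.
Proof.
move=> v0 vT; rewrite !col_of_cat has_shift; case: ifP => h1; first by rewrite col_of_shift.
rewrite mem_rcons inE eqSS (gtn_eqF v0) /= (mem_map succn_inj); case: ifP => h2.
  by rewrite -cats1 index_cat (mem_map succn_inj) h2 index_map //; exact: succn_inj.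
rewrite col_of_shift //; move: vT; rewrite flatten_cat mem_cat /= mem_cat h2.
case/orP=> /flattenP[R' RT vR]; last by apply/hasP; exists R'.
by move/hasP: h1; case; exists R'.
Qed.

Lemma colword_grow c a a' T : is_comp a -> srct a T -> 0 < c ->
  add_box c a = Some a' -> colword (grow c T) = c :: colword T.
Proof.
move=> ca sT c0 ab; have pT := srct_pos sT; case: sT => sh pe _ _ _.
have vT v : v \in iota 1 (size (flatten T)) -> v \in flatten T.
  by rewrite (perm_mem pe) (perm_size pe) size_iota.
case: (ltnP 1 c) => c1; last first.
  have -> : c = 1 by lia.
  have -> : grow 1 T = [:: 1] :: shift T by [].
  rewrite /colword; have -> : size (flatten ([:: 1] :: shift T)) = (size (flatten T)).+1.
    by rewrite [LHS]/= -map_flatten size_map.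
  rewrite iota1S map_cons -map_comp; congr (_ :: _).
  apply/eq_in_map => v vi /=; congr _.+1; rewrite -(@col_of_shift T v); last first.
    by case/flattenP: (vT _ vi) => R RT vR; apply/hasP; exists R.
  rewrite {1}/col_of /= inE.
  by have -> : (v.+1 == 1) = false by move: vi; rewrite mem_iota; lia.
rewrite -sh in ab; have [T1 [R [T2 [TE sR a1 aE]]]] := add_box_split c1 ab.
rewrite TE growE //; last by lia.
rewrite {1}/colword (perm_size (perm_flatten_grow T1 R T2)) [size _]/= size_map.
rewrite iota1S /= col_of_grow1 -?TE // sR prednK // -map_comp; congr (_ :: _).
apply/eq_in_map => v vi /=; congr _.+1; rewrite TE; apply: col_of_growS.
  by move: vi; rewrite mem_iota; lia.
by rewrite -TE; apply: vT.
Qed.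

Lemma act_cons_some c w g a : act (c :: w) g = Some a ->
  exists2 a', act w g = Some a' & add_box c a' = Some a.
Proof. by rewrite /=; case: (act w g) => //= a' h; exists a'. Qed.

Lemma build_srct w a : all (leq 1) w -> act w [::] = Some a ->
  srct a (build w) /\ colword (build w) = w.
Proof.
elim: w a => [|c w IH] a.
  by move=> _ [<-]; split=> //; split=> // i j k _; rewrite nth_nil.
case/andP=> c0 w1 /act_cons_some[a' wa' ab].
have [sT cT] := IH _ w1 wa'; have ca : is_comp a' by apply: act_comp wa'.
split; first exact: srct_grow sT c0 ab.
by rewrite /= (colword_grow ca sT c0 ab) cT.
Qed.

(** Deleting the least entry again and again reads off the word from left to right. *)
Lemma srct_build a T : is_comp a -> srct a T ->
  exists w, [/\ all (leq 1) w, act w [::] = Some a & T = build w].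
Proof.
move: {2}(sumn a) (erefl (sumn a)) => n; elim: n a T => [|n IH] a T na ca sT.
  have a0 : a = [::] by apply/size0nil; have := size_leq_sumn ca; lia.
  exists [::]; rewrite a0; split=> //; apply/size0nil.
  by rewrite -(size_map size) (srct_shape sT) a0.
have [|c [a' [T' [c0 ca' sT' ab ->]]]] := srct_shrink ca sT; first by lia.
have [|w [w1 wa ->]] := IH a' T' _ ca' sT'; first by have := add_box_sumn ab; lia.
by exists (c :: w); rewrite /= c0 w1 wa.
Qed.

Lemma mem_srcts a T : is_comp a -> T \in srcts a <-> srct a T.
Proof.
move=> ca; rewrite mem_filter -srctP; split=> [/andP[]//|h]; rewrite h /=.
have /srctP[sh pe _ _ _] := h; apply/mapP; exists (flatten T).
  by rewrite mem_permutations.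
by rewrite -sh -[map size T]/(shape T) flattenK.
Qed.

Lemma uniq_srcts a : uniq (srcts a).
Proof.
apply: filter_uniq; rewrite map_inj_in_uniq ?permutations_uniq // => p q.
rewrite !mem_permutations => /perm_size sp /perm_size sq.
move=> /(congr1 (@flatten nat)); rewrite !reshapeKr ?sp ?sq ?size_iota //.
Qed.

Lemma add_box_bound c x y : is_comp x -> 0 < c -> add_box c x = Some y -> c <= sumn y.
Proof.
move=> cx c0 ab; rewrite (add_box_sumn ab); case: (ltnP 1 c) => [c1|]; last by lia.
have [//|r [rs xr _] _] := add_box_inv _ ab.
by have := leq_mem_sumn (mem_nth 0 rs); rewrite xr; lia.
Qed.

Lemma act_bound w x y : is_comp x -> all (leq 1) w -> act w x = Some y ->
  all (fun c => 1 <= c < 1 + sumn y) w.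
Proof.
move=> cx; elim: w y => [|c w IH] y //= /andP[c0 w1].
case E: (act w x) (IH) => [z|//] /= /(_ _ w1 erefl) h ab.
rewrite c0 add1n ltnS (add_box_bound _ c0 ab) ?(act_comp cx E) //=.
by apply: sub_all h => d; rewrite (add_box_sumn ab); lia.
Qed.

(** The bound [L] is left free so that shapes of different sizes can share one alphabet; no column
    index exceeds the size of the shape. *)
Lemma perm_srcts a L : is_comp a -> sumn a <= L ->
  perm_eq (srcts a)
    (map build [seq w <- words 1 L (sumn a) | act w [::] == Some a]).
Proof.
move=> ca aL; apply: uniq_perm; first exact: uniq_srcts.
  rewrite map_inj_in_uniq ?filter_uniq ?words_uniq // => u v.
  rewrite !mem_filter !mem_words => /andP[/eqP ua /andP[_ u1]] /andP[/eqP va /andP[_ v1]] E.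
  have u1' : all (leq 1) u by apply: sub_all u1 => c /andP[].
  have v1' : all (leq 1) v by apply: sub_all v1 => c /andP[].
  by rewrite -(build_srct u1' ua).2 E (build_srct v1' va).2.
move=> T; apply/idP/mapP => [/(mem_srcts _ ca) sT|[w]].
  have [w [w1 wa ->]] := srct_build ca sT; exists w => //.
  rewrite mem_filter wa eqxx mem_words; have := act_sumn wa; rewrite add0n => ->.
  rewrite eqxx /=; apply: sub_all (act_bound _ w1 wa) => // c; lia.
rewrite mem_filter mem_words => /andP[/eqP wa /andP[_ w1]] ->.
have w1' : all (leq 1) w by apply: sub_all w1 => c /andP[].
by apply/(mem_srcts _ ca); case: (build_srct w1' wa).
Qed.

(* The descent composition of a tableau with column word [w]. *)
Fixpoint dc (w : seq nat) : seq nat :=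
  if w is c :: v then
    if v is d :: _ then if c <= d then 1 :: dc v else incr_nth (dc v) 0
    else [:: 1]
  else [::].

(** The offset [s] counts letters already removed, which allows induction on the word. *)
Lemma pairmap_descents (w : seq nat) s : w != [::] ->
  pairmap (fun x y => y - x) s
    (rcons [seq i <- iota s.+1 (size w).-1 |
             nth 0 w (i - s.+1) <= nth 0 w (i - s)] (s + size w)) = dc w.
Proof.
elim: w s => // c [|d w] IH s _; first by rewrite /= addn1 subSnn.
have IH' := IH s.+1 isT; rewrite [(size _).-1]/= [size (d :: w)]/= in IH'.
have E : [seq i <- iota s.+2 (size w) |
    nth 0 (c :: d :: w) (i - s.+1) <= nth 0 (c :: d :: w) (i - s)] =
  [seq i <- iota s.+2 (size w) |
    nth 0 (d :: w) (i - s.+2) <= nth 0 (d :: w) (i - s.+1)].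
  apply/eq_in_filter => i; rewrite mem_iota => /andP[si _].
  have -> : i - s = (i - s.+1).+1 by lia.
  by have -> : i - s.+1 = (i - s.+2).+1 by lia.
pose F0 := [seq i <- iota s.+2 (size w) |
    nth 0 (c :: d :: w) (i - s.+1) <= nth 0 (c :: d :: w) (i - s)].
transitivity (pairmap (fun x y => y - x) s
    (rcons (if c <= d then s.+1 :: F0 else F0) (s + (size w).+2))).
  congr (pairmap _ _ (rcons _ _)).
  have -> : (size [:: c, d & w]).-1 = (size w).+1 by [].
  have fc (p : pred nat) x l : filter p (x :: l) = if p x then x :: filter p l else filter p l by [].
  by rewrite -[iota _ _]/(s.+1 :: iota s.+2 (size w)) fc subnn subSnn.
have -> : dc [:: c, d & w] = if c <= d then 1 :: dc (d :: w) else incr_nth (dc (d :: w)) 0 by [].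
rewrite /F0 E.
rewrite addSnnS in IH'.
case: ifP => _; first by rewrite /= subSnn IH'.
rewrite -IH'; set F := filter _ _.
have : all (ltn s.+1) (rcons F (s + (size w).+2)).
  rewrite all_rcons; apply/andP; split; first by rewrite /=; lia.
  by apply/allP => i; rewrite mem_filter mem_iota /=; lia.
by rewrite headI /= => /andP[sh _]; congr (_ :: _); lia.
Qed.

Lemma descent_comp_colword T : descent_comp T = dc (colword T).
Proof.
rewrite /descent_comp; case E: (size (flatten T)) => [|n]; first by rewrite /colword E.
have sw : size (colword T) = n.+1 by rewrite size_map size_iota E.
rewrite -(@pairmap_descents _ 0); last by rewrite -size_eq0 sw.
rewrite sw add0n /descents E /=; congr (pairmap _ _ (rcons _ _)).
apply/eq_in_filter => i; rewrite mem_iota => /andP[i0 iN].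
have h k : k < n.+1 -> nth 0 (colword T) k = (col_of T k.+1).+1.
  by move=> kn; rewrite (nth_map 0) ?size_iota ?E // nth_iota.
by rewrite !h ?subn0; try lia; rewrite subn1 prednK.
Qed.

Theorem d_coef_words a b L : is_comp a -> sumn a <= L ->
  d_coef a b = count (fun w => (act w [::] == Some a) && (dc w == b))
                 (words 1 L (sumn a)).
Proof.
move=> ca aL; rewrite /d_coef (permP (perm_srcts ca aL)) count_map count_filter.
apply: eq_in_count => w; rewrite mem_words => /andP[_ w1] /=.
rewrite andbC; case: eqP => //= wa.
have w1' : all (leq 1) w by apply: sub_all w1 => c /andP[].
by rewrite descent_comp_colword (build_srct w1' wa).2.
Qed.

(** * Unitriangularity *)

Arguments dc : simpl never.

Lemma dc_cons2 c d w : dc [:: c, d & w] =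
  if c <= d then 1 :: dc (d :: w) else incr_nth (dc (d :: w)) 0.
Proof. by []. Qed.

Lemma dc_ne c w : exists l b, dc (c :: w) = l.+1 :: b.
Proof.
elim: w c => [|d w IH] c; first by exists 0, [::].
rewrite dc_cons2; case: ifP => _; first by exists 0, (dc (d :: w)).
by have [l [b ->]] := IH d; exists l.+1, b.
Qed.

(** The word [l, ..., 2, 1], which puts a row of length [l] on top. *)
Definition run l := rev (iota 1 l).

Lemma runS l : run l.+1 = l.+1 :: run l.
Proof. by rewrite /run -[in LHS](addn1 l) iotaD rev_cat /= add1n. Qed.

Lemma size_add_box c x y : 1 < c -> add_box c x = Some y -> size y = size x.
Proof. by move=> c1 /add_box_inv[//|r [rs _ _] ->]; rewrite size_incr_first. Qed.

(* When the word has as many descent runs as the shape has rows, every run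
   ends with the letter 1; the first run then builds the top row, which is
   either as long as the run or strictly shorter. *)
Lemma act_first_run c w a : all (leq 1) (c :: w) -> act (c :: w) [::] = Some a ->
  size a <= size (dc (c :: w)) /\
  (size a = size (dc (c :: w)) ->
   exists l b' h a', [/\ dc (c :: w) = l :: b', a = h :: a' &
    [/\ c = l, h = l & exists2 w2, c :: w = run l ++ w2 &
          act w2 [::] = Some a' /\ dc w2 = b'] \/ l < c /\ h < l]).
Proof.
elim: w c a => [|d w IH] c a.
  move=> _; rewrite /act /= /add_box in_nil; case: eqP => // -> [<-]; split=> // _.
  by exists 1, [::], 1, [::]; split=> //; left; split=> //; exists [::].
move=> /andP[c0 dw1] /act_cons_some[a1 wa1 ab].
have [le eqc] := IH _ _ dw1 wa1; rewrite dc_cons2; case: (leqP c d) => cd.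
  case: (ltnP 1 c) => c1.
    by have := size_add_box c1 ab => -> /=; split; lia.
  have c1' : c = 1 by lia.
  move: ab; rewrite c1' /add_box /= => -[<-]; split=> [|[e]]; first by rewrite /=; lia.
  exists 1, (dc (d :: w)), 1, a1; split=> //; left; split=> //.
  by exists (d :: w) => //; rewrite /run.
have d0 : 0 < d by case/andP: dw1.
have c1 : 1 < c by lia.
have [l [b' dE]] := dc_ne d w; rewrite dE in le eqc *.
rewrite (size_add_box c1 ab) /=; split=> // e.
have [l2 [b2 [h [a' [[<- <-] aE cs]]]]] := eqc e.
have [r [rs ar lt] aE2] := add_box_inv c1 ab.
rewrite aE in rs ar lt aE2.
exists l.+2, b'; case: cs => [[dl hl [w2 we wa2]]|[ld hl]].
  case: (eqVneq c l.+2) => [cl|cl].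
    have r0 : r = 0.
      by case: r lt {ar rs aE2} => // r /(_ 0 isT) /=; rewrite hl cl.
    exists l.+2, a'; split=> //; first by rewrite aE2 r0 /= hl.
    by left; split=> //; exists w2 => //; rewrite we cl [run l.+2]runS.
  have : r <> 0 by move=> r0; move: ar; rewrite r0 /= hl; lia.
  case: r {rs ar lt} aE2 => // r -> _; exists h, (incr_nth a' r); split=> //.
  by right; lia.
have : r <> 0 by move=> r0; move: ar; rewrite r0 /=; lia.
case: r {rs ar lt} aE2 => // r -> _; exists h, (incr_nth a' r); split=> //.
by right; lia.
Qed.

Fixpoint lexlt (a b : seq nat) : bool :=
  match a, b with
  | x :: a', y :: b' => (x < y) || (x == y) && lexlt a' b'
  | _, _ => false
  end.

Definition complt a b := (size a < size b) || (size a == size b) && lexlt a b.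

Lemma lexlt_asym a b : lexlt a b -> lexlt b a = false.
Proof.
elim: a b => [|x a IH] [|y b] //= /orP[xy|/andP[/eqP-> /IH->]].
  by rewrite ltnNge (ltnW xy) eq_sym (ltn_eqF xy).
by rewrite ltnn andbF.
Qed.

Lemma complt_asym a b : complt a b -> complt b a = false.
Proof.
rewrite /complt => /orP[h|/andP[/eqP-> /lexlt_asym->]]; last by rewrite ltnn andbF.
by rewrite ltnNge (ltnW h) eq_sym (ltn_eqF h).
Qed.

(** Either the shape is already smaller in its number of rows or in its top row, or the first
    descent run is exactly the word of the top row and can be removed. *)
Lemma act_run_complt w a : all (leq 1) w -> act w [::] = Some a ->
  complt a (dc w) \/ a = dc w /\ w = flatten [seq run l | l <- a].
Proof.
move: {2}(size w) (leqnn (size w)) => n; elim: n w a => [|n IH] [|c w] a //.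
- by move=> _ _ [<-]; right.
- by move=> _ _ [<-]; right.
move=> sw w1 wa; have [le eqc] := act_first_run w1 wa; rewrite /complt.
case: ltngtP le => // e _; first by left.
have [l [b' [h [a' [dE aE cs]]]]] := eqc e.
rewrite dE aE in e *; case: cs => [[cl hl [w2 we [wa2 d2]]]|[lc hl]]; last first.
  by left; rewrite /= hl.
have w21 : all (leq 1) w2 by move: w1; rewrite we all_cat => /andP[].
have [|h2|[a'E w2E]] := IH w2 a' _ w21 wa2.
- have := congr1 size we; rewrite size_cat size_rev size_iota /=.
  by have [l' [b2]] := dc_ne c w; rewrite dE => -[]; move: sw => /=; lia.
- left; move: h2; rewrite d2 /complt /=; move: e => /= -[->]; rewrite ltnn /=.
  by rewrite hl !eqxx /= => ->; rewrite orbT.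
by right; rewrite hl a'E d2 we {1}w2E a'E d2.
Qed.

Lemma dc_run_cat l w : all (leq 1) w -> dc (run l.+1 ++ w) = l.+1 :: dc w.
Proof.
move=> w1; elim: l => [|l IH]; last first.
  rewrite runS; move: IH; rewrite runS !cat_cons => IH.
  by rewrite dc_cons2 ltnn IH.
rewrite /run /=; case: w w1 => // d w /andP[d0 _].
by rewrite dc_cons2 d0.
Qed.

Lemma act_run l a : act (run l.+1) a = Some (l.+1 :: a).
Proof.
elim: l => // l IH; rewrite runS /act /= -/(act _ _) IH /=.
by rewrite (@add_box_first _ _ 0).
Qed.

Lemma run_ge1 l : all (leq 1) (run l).
Proof. by apply/allP => c; rewrite mem_rev mem_iota => /andP[]. Qed.

Lemma act_runs a : is_comp a -> let w := flatten [seq run l | l <- a] in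
  [/\ all (leq 1) w, act w [::] = Some a & dc w = a].
Proof.
elim: a => // -[|l] a IH //= /IH[w1 wa wd]; split.
- by rewrite all_cat run_ge1.
- by rewrite act_cat wa /= act_run.
- by rewrite dc_run_cat // wd.
Qed.

Lemma d_coef_diag a : is_comp a -> d_coef a a = 1.
Proof.
move=> ca; rewrite (d_coef_words _ ca (leqnn _)); have [w1 wa wd] := act_runs ca.
set w := flatten _ in w1 wa wd.
rewrite (_ : count _ _ = count_mem w (words 1 (sumn a) (sumn a))); last first.
  apply: eq_in_count => v; rewrite mem_words => /andP[_ v1].
  have v1' : all (leq 1) v by apply: sub_all v1 => c /andP[].
  apply/andP/eqP => [[/eqP va /eqP vd]|->]; last by rewrite wa wd.
  have [] := act_run_complt v1' va; last by case.
  by rewrite vd => h; have := complt_asym h; rewrite h.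
rewrite count_uniq_mem ?words_uniq // mem_words.
by rewrite -[size w]/(sumn [::] + size w) -(act_sumn wa) eqxx (act_bound _ w1 wa).
Qed.

Lemma d_coef_lt a b : is_comp a -> d_coef a b != 0 -> complt a b \/ a = b.
Proof.
move=> ca; rewrite (d_coef_words _ ca (leqnn _)) -lt0n -has_count => /hasP[w].
rewrite mem_words => /andP[_ w1] /andP[/eqP wa /eqP wd].
have w1' : all (leq 1) w by apply: sub_all w1 => c /andP[].
by have [] := act_run_complt w1' wa; rewrite wd; [left | case; right].
Qed.

Lemma pairwise_flatten_map (T1 T2 : Type) (r : rel T2) (f : T1 -> seq T2) (s : seq T1) :
  all (pairwise r \o f) s -> pairwise (fun x y => allrel r (f x) (f y)) s ->
  pairwise r (flatten [seq f x | x <- s]).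
Proof.
elim: s => //= x s IH /andP[px ps] /andP[ax as_].
rewrite pairwise_cat px IH // andbT /=.
by elim: s ax {IH ps as_} => [|y s IH] /=; rewrite ?allrel0r // allrel_catr => /andP[-> /IH->].
Qed.

Lemma pairwise_words j k n : pairwise lexlt (words j k n).
Proof.
elim: n => // n IH; apply: pairwise_flatten_map.
  apply/allP => x _ /=; rewrite pairwise_map; apply: sub_pairwise IH => u v /=.
  by rewrite ltnn eqxx.
have : pairwise ltn (iota j k) by rewrite -sorted_pairwise ?iota_ltn_sorted //; exact: ltn_trans.
apply: sub_pairwise => x y xy; apply/allrelP => u v /mapP[u' _ ->] /mapP[v' _ ->] /=.
by rewrite [x < y]xy.
Qed.

(** The enumeration is by length and then lexicographic, so [dmat] is triangular as it stands. *)
Lemma pairwise_compositions N : pairwise complt (compositions N).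
Proof.
apply: pairwise_flatten_map.
  apply/allP => k _ /=; rewrite words1.
  apply: (subseq_pairwise (filter_subseq _ _)).
  apply: (@sub_in_pairwise _ (mem (words 1 N k)) lexlt); last exact: pairwise_words.
    move=> u v; rewrite /= !mem_words => /andP[/eqP su _] /andP[/eqP sv _] h.
    by rewrite /complt su sv ltnn eqxx.
  exact/allP.
have : pairwise ltn (iota 0 N.+1) by rewrite -sorted_pairwise ?iota_ltn_sorted //; exact: ltn_trans.
apply: sub_pairwise => k l kl; apply/allrelP => u v.
rewrite !mem_filter !words1 !mem_words => /andP[_ /andP[/eqP su _]] /andP[_ /andP[/eqP sv _]].
by rewrite /complt su sv [k < l]kl.
Qed.

Local Open Scope ring_scope.

Lemma dmat_unit N : dmat N \in unitmx.
Proof.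
have ci (i : 'I_(size (compositions N))) : is_comp (nth [::] (compositions N) i).
  have := mem_nth [::] (ltn_ord i).
  by rewrite mem_compositions => /andP[].
rewrite unitmxE det_trig.
  rewrite big1 ?unitr1 // => i _; rewrite mxE d_coef_diag //.
apply/is_trig_mxP => i j ij; rewrite mxE.
case: eqVneq (@d_coef_lt (nth [::] (compositions N) j) (nth [::] (compositions N) i) (ci j)) => [->//|ne].
move=> /(_ isT); have := pairwise_compositions N.
move/(pairwiseP [::])/(_ i j); rewrite !inE !ltn_ord => /(_ isT isT ij) h.
case=> [h'|e]; first by have := complt_asym h'; rewrite h.
by move: h; rewrite e => h'; have := complt_asym h'; rewrite h'.
Qed.

Local Close Scope ring_scope.

(** * Products of ribbons *)

Lemma coarsens_nil w : coarsens w [::] = nilp w.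
Proof. by case: w. Qed.

Lemma coarsens_nill b : coarsens [::] b = nilp b.
Proof. by []. Qed.

Arguments coarsens : simpl never.

(** The first part [y] equals [x] or absorbs it. This form, unlike the definition, consumes the
    finer composition one part at a time. *)
Lemma coarsens_cons y w x b : is_comp (x :: b) -> coarsens (y :: w) (x :: b) =
  (y == x) && coarsens w b || (x < y) && coarsens (y - x :: w) b.
Proof.
case/andP=> x0 cb; rewrite [LHS]/coarsens -/coarsens.
have -> : iota 1 (size (x :: b)) = 1 :: map S (iota 1 (size b)) by rewrite [size _]/= iota1S.
rewrite [has _ (_ :: _)]/= take0 drop0 addn0 eq_sym; congr (_ || _).
rewrite has_map; case: (ltnP x y) => xy /=.
  apply: eq_has => k /=; congr (_ && _); lia.
apply/hasP => -[k]; rewrite mem_iota => kb /= /andP[/eqP e _].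
have : 0 < sumn (take k b).
  by case: k b cb kb {e} => [|k] [|z b] //= /andP[z0 _]; lia.
by lia.
Qed.

Lemma coarsens_spec b w : is_comp b -> coarsens w b ->
  [/\ is_comp w, sumn w = sumn b & size w <= size b].
Proof.
elim: b w => [|x b IH] [|y w] // cxb; rewrite coarsens_cons //.
have [x0 cb] := andP cxb => /orP[/andP[/eqP-> /(IH _ cb)[h1 h2 h3]]|/andP[xy /(IH _ cb)[]]].
  by rewrite /= x0 h2.
by rewrite /= => /andP[_ cw] e s; split; [rewrite cw andbT|..]; lia.
Qed.

Fixpoint near (a b : seq nat) : seq nat :=
  if a is x :: a' then
    if a' is [::] then (if b is y :: b' then (x + y) :: b' else [:: x])
    else x :: near a' b
  else b.

Lemma near_cons x a b : a != [::] -> near (x :: a) b = x :: near a b.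
Proof. by case: a. Qed.

Lemma near_incr x a b : near (x.+1 :: a) b = incr_nth (near (x :: a) b) 0.
Proof. by case: a => //=; case: b. Qed.

Lemma near_spec a b : is_comp a -> is_comp b -> a != [::] -> b != [::] ->
  [/\ is_comp (near a b), sumn (near a b) = sumn a + sumn b &
      size (near a b) = (size a + size b).-1].
Proof.
move=> ca cb a0 b0; elim: a a0 ca => // x a IH _ /andP[x0 ca].
case: (eqVneq a [::]) => [->|ane]; last first.
  have [h1 h2 h3] := IH ane ca; rewrite near_cons //= x0 h1 h2 h3; split=> //; try lia.
  by case: (b) b0 => //= *; lia.
case: b b0 cb {IH} => // y b _ /= /andP[y0 cb]; rewrite cb andbT; split; lia.
Qed.

(** Counts cut positions as in [nmul]; for compositions at most one position contributes, the sizes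
    of both halves being fixed. *)
Definition splits a b w :=
  \sum_(i < (size w).+1) (coarsens (take i w) a && coarsens (drop i w) b : nat).

Lemma splits_cons a b y w : a != [::] -> splits a b (y :: w) =
  \sum_(i < (size w).+1) (coarsens (y :: take i w) a && coarsens (drop i w) b : nat).
Proof.
move=> a0; rewrite /splits big_ord_recl take0 coarsens_nill.
by case: a a0.
Qed.

(** A coarsening of [a ++ b] either has a cut where [a] meets [b], or adds up the two parts meeting
    there. *)
Lemma coarsens_cat a b w : is_comp a -> is_comp b -> a != [::] -> b != [::] ->
  (coarsens w (a ++ b) : nat) = splits a b w + coarsens w (near a b).
Proof.
move=> ca cb a0 b0; elim: a a0 ca w => // x a IH _ cxa w.
have [x0 ca] := andP cxa.
have cab : is_comp (a ++ b) by rewrite /is_comp all_cat [all _ a]ca [all _ b]cb.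
have cxab : is_comp (x :: (a ++ b)) by rewrite /= x0 cab.
have [cn _ _] := @near_spec (x :: a) b cxa cb isT b0.
case: w => [|y w].
  rewrite /splits big_ord1 /= !coarsens_nill add0n; case: (a) => [|? ?] //.
  by case: (b).
rewrite splits_cons // cat_cons coarsens_cons //.
under eq_bigr do rewrite coarsens_cons //.
case: (eqVneq a [::]) => [a_nil|ane].
  subst a; case: b b0 cb IH cab cxab cn => // z b _ cb _ cab cxab cn.
  have [z0 cb'] := andP cb; rewrite [near _ _]/= coarsens_cons // cat0s.
  case: (ltngtP x y) => xy.
  - rewrite big1 /=; last by move=> i _; rewrite ?coarsens_nil.
    rewrite add0n coarsens_cons //; congr nat_of_bool; congr (_ || _).
      by congr (_ && _); lia.
    have -> : (z < y - x) = (x + z < y) by lia.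
    by have -> : y - x - z = y - (x + z) by lia.
  - rewrite big1 //=; have -> : (x + z < y) = false by lia.
    by have -> : (y == x + z) = false by lia.
  - rewrite big_ord_recl take0 drop0 /= big1.
      have -> : (x + z < y) = false by lia.
      have -> : (y == x + z) = false by lia.
      by rewrite !addn0 orbF.
    move=> i _; rewrite coarsens_nil orbF /nilp size_take /bump /=.
    case: ltnP => // _; have -> // : (size w == 0) = false.
    by have := ltn_ord i; lia.
have [cn' _ _] := near_spec ca cb ane b0.
rewrite near_cons // coarsens_cons ?[is_comp _]/= ?x0 //.
case: (ltngtP x y) => xy /=.
- by rewrite (IH ane ca) splits_cons.
- by rewrite big1.
- rewrite orbF (IH ane ca) orbF; congr (_ + _).
  by apply: eq_bigr => i _; rewrite orbF.
Qed.

Lemma incr_head_eq s t : s != [::] -> t != [::] ->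
  (incr_nth s 0 == incr_nth t 0) = (s == t).
Proof. by case: s t => [|x s] [|y t] //= _ _; rewrite !eqseq_cons eqSS. Qed.

(** The letters at the junction decide which composition can occur: a weak ascent allows only
    [a ++ b], a strict decrease only [near a b]. *)
Lemma dc_cat u v a b : u != [::] -> v != [::] -> is_comp a -> is_comp b ->
  b != [::] -> size u = sumn a ->
  (dc (u ++ v) == a ++ b) + (dc (u ++ v) == near a b) =
  ((dc u == a) && (dc v == b) : nat).
Proof.
move=> u0 v0 ca cb b0; elim: u u0 a ca => // c u IH _ a ca su.
case: a ca su => [|x a] //= /andP[x0 ca] su.
have nb0 : near a b != [::] by case: (a) (b) b0 => [|? [|? ?]] [].
case: u IH su => [|e u] IH su /=.
  have a_nil : a = [::] by case: (a) su ca => //= *; lia.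
  have x1 : x = 1 by rewrite a_nil /= in su; lia.
  subst a x; case: v v0 {IH} => // d v _; rewrite dc_cons2.
  have [l [t ->]] := dc_ne d v; case: b b0 cb nb0 => // y b _ /= /andP[y0 _] _.
  case: ifP => _; rewrite !eqseq_cons /=; first by rewrite [1 == _]ltn_eqF ?addn0 //; lia.
  by rewrite add1n eqSS.
have IHa := IH isT; rewrite dc_cons2 [dc (c :: _)]dc_cons2.
have [L [t XE]] := dc_ne e (u ++ v); have [M [s UE]] := dc_ne e u.
rewrite cat_cons in IHa; rewrite XE UE in IHa *.
case: (ltngtP x 1) x0 => [|x2|x1] // _.
  have [x' xE] : exists x', x = x'.+2 by exists x.-2; lia.
  subst x; case: ifP => _.
    rewrite !eqseq_cons /=; have -> : (1 :: L.+1 :: t == near (x'.+2 :: a) b) = false.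
      by rewrite near_incr near_incr; case: (near _ _) => [|? ?] //=; rewrite eqseq_cons.
    by [].
  rewrite -[if a is [::] then _ else _]/(near (x'.+2 :: a) b) near_incr.
  have su' : size (e :: u) = sumn (x'.+1 :: a) by move: su => /=; clear; lia.
  have := IHa (x'.+1 :: a) ca su'.
  rewrite cat_cons !eqseq_cons !eqSS => <-; congr (_ + _).
  by rewrite incr_head_eq //; case: (a) (b) b0 => [|? ?] [].
subst x; have ane : a != [::] by case: (a) su.
have := IHa a ca; rewrite -[if a is [::] then _ else _]/(near (1 :: a) b) near_cons //.
case: ifP => _; rewrite !eqseq_cons /= => h; last by [].
by apply: h; move: su => /=; clear; lia.
Qed.

Local Open Scope ring_scope.

(** The sum of the two lengths has the parity of their difference and avoids truncated
    subtraction. *)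
Lemma nrE b w : is_comp b ->
  nr b w = (coarsens w b)%:R * (-1) ^+ (size b + size w).
Proof.
move=> cb; rewrite /nr; case: (boolP (coarsens w b)) => cw; last first.
  rewrite mul0r big1_seq // => a /andP[ca _]; rewrite /nh.
  by case: eqP => [e|]; rewrite ?mulr0 //; rewrite e ca in cw.
have [h1 h2 h3] := coarsens_spec cb cw.
rewrite mul1r big_mkcond (bigD1_seq w) ?uniq_compositions //=; last first.
  by rewrite mem_compositions h1 h2 eqxx.
rewrite cw big1 ?addr0 => [|a /negbTE ne]; last first.
  by rewrite /nh eq_sym ne mulr0 if_same.
rewrite /nh eqxx mulr1 -signr_odd -[RHS]signr_odd; congr (_ ^+ _).
by rewrite oddB // oddD.
Qed.

(** For empty [b] both compositions are [a], which must be counted once only. *)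
Definition near_terms (a b : seq nat) := if b is [::] then [:: a] else [:: a ++ b; near a b].

Lemma mem_near_terms a b c : is_comp a -> is_comp b -> a != [::] ->
  c \in near_terms a b -> is_comp c && (sumn c == sumn a + sumn b)%N.
Proof.
move=> ca cb a0; case: b cb => [|y b] cb.
  by rewrite inE => /eqP->; rewrite ca /= addn0 eqxx.
rewrite !inE => /orP[] /eqP->.
  by rewrite /is_comp all_cat [all _ a]ca [all _ (y :: b)]cb sumn_cat eqxx.
by have [// | -> -> _] := near_spec ca cb a0 _; rewrite eqxx.
Qed.

(** [near a b] has one part less than [a ++ b], so its ribbon has opposite signs and cancels the
    coarsenings without a cut at the junction. *)
Lemma nmul_nr a b w : is_comp a -> is_comp b -> a != [::] ->
  nmul (nr a) (nr b) w = \sum_(c <- near_terms a b) nr c w.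
Proof.
move=> ca cb a0; rewrite /nmul; case: (eqVneq b [::]) => [->|bne].
  rewrite big_seq1 big_ord_recr /= take_size drop_size big1 ?add0r.
    by rewrite [nr [::] _]nrE // coarsens_nil mul1r mulr1.
  move=> i _; rewrite [nr [::] _]nrE // coarsens_nil /nilp size_drop subn_eq0.
  by rewrite leqNgt ltn_ord mul0r mulr0.
have -> : near_terms a b = [:: a ++ b; near a b] by case: (b) bne.
rewrite big_cons big_seq1; have [cn _ sn] := near_spec ca cb a0 bne.
have cab : is_comp (a ++ b) by rewrite /is_comp all_cat [all _ a]ca [all _ b]cb.
rewrite !nrE // sn size_cat.
have sE : ((size a + size b).-1 + size w)%N.+1 = (size a + size b + size w)%N.
  by case: (a) a0.
have -> : (-1) ^+ ((size a + size b).-1 + size w) = - (-1) ^+ (size a + size b + size w) :> rat.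
  by rewrite -sE exprS mulN1r opprK.
rewrite mulrN -mulrBl coarsens_cat // natrD addrK /splits natr_sum mulr_suml.
apply: eq_bigr => i _; rewrite !nrE // -mulnb natrM mulrACA; congr (_ * _).
rewrite -exprD; congr (_ ^+ _).
by rewrite addnACA -(size_cat (take i w)) cat_take_drop.
Qed.

Lemma dc_cat_terms u v a b : is_comp a -> is_comp b -> u != [::] ->
  size u = sumn a -> size v = sumn b ->
  \sum_(c <- near_terms a b) (dc (u ++ v) == c)%:R =
  (dc u == a)%:R * (dc v == b)%:R :> rat.
Proof.
move=> ca cb u0 su sv; case: (eqVneq b [::]) => [b0|bne].
  have v0 : v = [::] by apply/size0nil; rewrite sv b0.
  by rewrite b0 v0 big_seq1 cats0 mulr1.
have vne : v != [::].
  by rewrite -size_eq0 sv; case: (b) bne cb => //= y b' _ /andP[y0 _]; lia.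
have -> : near_terms a b = [:: a ++ b; near a b] by case: (b) bne.
by rewrite big_cons big_seq1 -natrD dc_cat // -natrM mulnb.
Qed.

Lemma dc_single w : w != [::] -> (dc w == [:: size w]) = sdec w.
Proof.
elim: w => // c [|d w] IH _ //; rewrite dc_cons2 /sdec [sorted _ _]/= -/(sdec (d :: w)).
have [l [b E]] := dc_ne d w; have := IH isT; rewrite E ltnNge.
by case: ifP => // _ /= <-; rewrite !eqseq_cons !eqSS.
Qed.

(** Descent composition [(1^k, n-k)] means weak increase for [k] steps and strict decrease
    afterwards. *)
Lemma hook_signE u n : size u = n ->
  \sum_(k < n) (-1) ^+ k * (dc u == nseq k 1%N ++ [:: (n - k)%N])%:R = hook_sign u.
Proof.
elim: u n => [|c [|d w] IH] n <-; first by rewrite big_ord0.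
  by rewrite big_ord1 /= mulr1.
have -> : hook_sign [:: c, d & w] =
  if (c <= d)%N then - hook_sign (d :: w) else (sdec (d :: w))%:R by [].
rewrite big_ord_recl dc_cons2.
have [l [b E]] := dc_ne d w; case: ifP => cd.
  rewrite E [X in (nat_of_bool X)%:R](_ : _ = false) ?mulr0 ?add0r; last by rewrite /= eqseq_cons.
  rewrite -(IH _ erefl) -sumrN; apply: eq_bigr => k _.
  by rewrite -E lift0 exprS mulN1r mulNr subSS eqseq_cons.
rewrite big1 ?addr0; last first.
  by move=> k _; rewrite E /= mulr0.
by rewrite mul1r -dc_single // E /= ?subn0 !eqseq_cons eqSS.
Qed.

Lemma big_words_cat (R : nmodType) j k n m (F : seq nat -> R) :
  \sum_(x <- words j k (n + m)) F x =
  \sum_(u <- words j k n) \sum_(v <- words j k m) F (u ++ v).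
Proof.
have S n' (G : seq nat -> R) : \sum_(x <- words j k n'.+1) G x =
    \sum_(c <- iota j k) \sum_(s <- words j k n') G (c :: s).
  by rewrite /words -/words big_flatten /= big_map; apply: eq_bigr => c _; rewrite big_map.
elim: n F => [|n IH] F; first by rewrite big_seq1.
rewrite addSn !S; apply: eq_bigr => c _; rewrite IH.
by [].
Qed.

(** * From ribbons to noncommutative Schur functions *)

Lemma ns_index N a w : sumn a = N -> ns a w =
  \sum_(i < size (compositions N) | nat_of_ord i == index a (compositions N))
    \sum_(j < size (compositions N))
      invmx (dmat N) i j * nr (nth [::] (compositions N) j) w.
Proof. by move=> <-. Qed.

Lemma ns_nth N (i : 'I_(size (compositions N))) w :
  ns (nth [::] (compositions N) i) w =
  \sum_j invmx (dmat N) i j * nr (nth [::] (compositions N) j) w.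
Proof.
have := mem_nth [::] (ltn_ord i); rewrite mem_compositions => /andP[_ /eqP /ns_index ->].
rewrite (big_pred1 i) // => j; rewrite index_uniq ?uniq_compositions //.
Qed.

Lemma big_compositions (F : seq nat -> rat) N :
  \sum_(a <- compositions N) F a =
  \sum_(i < size (compositions N)) F (nth [::] (compositions N) i).
Proof. by rewrite (big_nth [::]) big_mkord. Qed.

Lemma nr_ns b w : is_comp b ->
  nr b w = \sum_(a <- compositions (sumn b)) (d_coef a b)%:R * ns a w.
Proof.
move=> cb; set N := sumn b.
have bN : b \in compositions N by rewrite mem_compositions cb eqxx.
have ib : (index b (compositions N) < size (compositions N))%N by rewrite index_mem.
pose l := Ordinal ib; have lb : nth [::] (compositions N) l = b by rewrite nth_index.
rewrite big_compositions.
under eq_bigr => i _ do rewrite ns_nth big_distrr /=.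
rewrite exchange_big /= (bigD1 l) //= [X in _ + X]big1 ?addr0 => [|j jl].
  rewrite -[LHS]mul1r -{1}lb.
  under eq_bigr => i _ do rewrite mulrA.
  rewrite -mulr_suml nth_index //; congr (_ * _).
  have := mulmxV (dmat_unit N) => /matrixP/(_ l l); rewrite !mxE eqxx => e.
  by apply: (etrans (esym e)); apply: eq_bigr => i _; rewrite mxE lb.
under eq_bigr => i _ do rewrite mulrA.
rewrite -mulr_suml; have := mulmxV (dmat_unit N) => /matrixP/(_ l j).
rewrite !mxE eq_sym (negbTE jl) => e.
rewrite (_ : \sum_i _ = 0) ?mul0r //; apply: etrans e.
by apply: eq_bigr => i _; rewrite [in RHS]mxE lb.
Qed.

Lemma d_coef_sum a b L : is_comp a -> (sumn a <= L)%N ->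
  (d_coef a b)%:R = \sum_(w <- words 1 L (sumn a))
     (act w [::] == Some a)%:R * (dc w == b)%:R :> rat.
Proof.
move=> ca aL; rewrite (d_coef_words _ ca aL) -sum1_count natr_sum big_mkcond /=.
by apply: eq_bigr => w _; rewrite -natrM mulnb; case: ifP.
Qed.

Section PsiTimesRibbon.
Variables (b : seq nat) (n : nat) (w : seq nat).
Hypotheses (cb : is_comp b) (n0 : (0 < n)%N).
Let N := sumn b.
Let hook k := nseq k 1%N ++ [:: (n - k)%N].

Lemma hook_comp (k : 'I_n) : [/\ is_comp (hook k), sumn (hook k) = n & hook k != [::]].
Proof.
have kn := ltn_ord k; split.
- rewrite /is_comp all_cat all_nseq orbT /= subn_gt0 kn //.
- by rewrite sumn_cat sumn_nseq /=; lia.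
- by rewrite /hook; case: (nat_of_ord k).
Qed.

(** Expanding the ribbons gives words of length [N + n]. Cut after [n] letters, each consists of a
    hook word and a word [v] with descent composition [b]; [d] is the shape that [v] builds. *)
Lemma Psi_nr : nmul (Psi n) (nr b) w =
  \sum_(d <- compositions N) (d_coef d b)%:R *
    \sum_(g <- compositions (N + n)) act_sum 1 (N + n) n d g * ns g w.
Proof.
have -> : nmul (Psi n) (nr b) w = \sum_(k < n) (-1) ^+ k * nmul (nr (hook k)) (nr b) w.
  rewrite /nmul /Psi; under eq_bigr => i _ do rewrite mulr_suml.
  rewrite exchange_big; apply: eq_bigr => k _; rewrite mulr_sumr.
  by apply: eq_bigr => i _; rewrite mulrA.
transitivity (\sum_(k < n) (-1) ^+ k * \sum_(c <- near_terms (hook k) b)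
    \sum_(g <- compositions (N + n)) (d_coef g c)%:R * ns g w).
  apply: eq_bigr => k _; have [h1 h2 h3] := hook_comp k.
  rewrite nmul_nr //; congr (_ * _); apply: eq_big_seq => c cn.
  have /andP[cc /eqP sc] := mem_near_terms h1 cb h3 cn.
  by rewrite nr_ns // sc h2 addnC.
transitivity (\sum_(g <- compositions (N + n)) (\sum_(k < n) (-1) ^+ k *
    \sum_(c <- near_terms (hook k) b) (d_coef g c)%:R) * ns g w).
  under [RHS]eq_bigr => g _ do rewrite mulr_suml.
  rewrite [RHS]exchange_big; apply: eq_bigr => k _ /=.
  rewrite exchange_big /= mulr_sumr; apply: eq_bigr => g _.
  by rewrite -mulrA mulr_suml.
under [RHS]eq_bigr => d _ do rewrite mulr_sumr.
rewrite [RHS]exchange_big /=; apply: eq_big_seq => g gN.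
under [RHS]eq_bigr => d _ do rewrite mulrA.
rewrite -mulr_suml; congr (_ * _).
have := gN; rewrite mem_compositions => /andP[cg /eqP sg].
transitivity (\sum_(u <- words 1 (N + n) n) \sum_(v <- words 1 (N + n) N)
    (act (u ++ v) [::] == Some g)%:R * (hook_sign u * (dc v == b)%:R)).
  transitivity (\sum_(k < n) \sum_(u <- words 1 (N + n) n) \sum_(v <- words 1 (N + n) N)
      (-1 : rat) ^+ k * ((act (u ++ v) [::] == Some g)%:R * ((dc u == hook k)%:R * (dc v == b)%:R))).
    apply: eq_bigr => k _; have [h1 h2 h3] := hook_comp k.
    rewrite (eq_bigr (fun c => \sum_(u <- words 1 (N + n) n) \sum_(v <- words 1 (N + n) N)
        (act (u ++ v) [::] == Some g)%:R * (dc (u ++ v) == c)%:R : rat)).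
      rewrite exchange_big mulr_sumr; apply: eq_big_seq => u.
      rewrite mem_words => /andP[/eqP su _]; rewrite exchange_big mulr_sumr.
      apply: eq_big_seq => v; rewrite mem_words => /andP[/eqP sv _].
      rewrite -mulr_sumr dc_cat_terms ?h2 //.
      by rewrite -size_eq0 su -lt0n.
    by move=> c _; rewrite (@d_coef_sum g c (N + n)) ?sg // addnC big_words_cat addnC.
  rewrite exchange_big; apply: eq_big_seq => u; rewrite mem_words => /andP[/eqP su _].
  rewrite exchange_big; apply: eq_bigr => v _ /=.
  rewrite -(hook_signE su) mulr_suml mulr_sumr; apply: eq_bigr => k _.
  by rewrite mulrCA !mulrA.
rewrite exchange_big.
transitivity (\sum_(v <- words 1 (N + n) N) \sum_(d <- compositions N)
   ((act v [::] == Some d)%:R * (dc v == b)%:R) * act_sum 1 (N + n) n d g).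
  apply: eq_big_seq => v; rewrite mem_words => /andP[/eqP sv v1] /=.
  case E: (act v [::]) => [d|]; last first.
    rewrite !big1 // => [d _|u _]; first by rewrite !mul0r.
    by rewrite act_cat E mul0r.
  have dN : d \in compositions N.
    by rewrite mem_compositions (act_comp _ E) // (act_sumn E) sv /= eqxx.
  rewrite [RHS](bigD1_seq d) ?uniq_compositions //= eqxx mul1r.
  rewrite [X in _ = _ + X]big1 ?addr0 => [|e ne].
    rewrite mulr_sumr; apply: eq_bigr => u _; rewrite act_cat E /=.
    by rewrite mulrC mulrAC mulrC.
  by rewrite (inj_eq Some_inj) eq_sym (negbTE ne) !mul0r.
rewrite exchange_big; apply: eq_big_seq => d; rewrite mem_compositions => /andP[cd /eqP sd].
by rewrite (@d_coef_sum d b (N + n)) ?sd ?leq_addr // mulr_suml.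
Qed.

End PsiTimesRibbon.

(** By [Psi_nr], the wanted formula holds after the matrix of the [d_coef] has been applied to it;
    the inverse matrix isolates [ns alpha]. *)
Theorem mainTheorem1 (alpha : seq nat) (n : nat) :
  is_comp alpha -> (0 < n)%N ->
  forall w : seq nat,
    nmul (Psi n) (ns alpha) w =
    \sum_(beta <- P_set alpha n) (-1) ^+ (ht beta alpha) * ns beta w.
Proof.
move=> ca n0 w; set N := sumn alpha.
have aN : alpha \in compositions N by rewrite mem_compositions ca eqxx.
have ia : (index alpha (compositions N) < size (compositions N))%N by rewrite index_mem.
pose l := Ordinal ia; have la : nth [::] (compositions N) l = alpha by rewrite nth_index.
pose G d := \sum_(g <- compositions (N + n)) act_sum 1 (N + n) n d g * ns g w.
transitivity (\sum_j invmx (dmat N) l j * nmul (Psi n) (nr (nth [::] (compositions N) j)) w).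
  have nsl v : ns alpha v =
      \sum_j invmx (dmat N) l j * nr (nth [::] (compositions N) j) v.
    by rewrite -ns_nth la.
  rewrite /nmul; under eq_bigr => i _ do rewrite nsl mulr_sumr.
  rewrite exchange_big; apply: eq_bigr => j _; rewrite mulr_sumr.
  by apply: eq_bigr => i _; rewrite mulrCA.
transitivity (\sum_j invmx (dmat N) l j *
    \sum_(i < size (compositions N)) dmat N j i * G (nth [::] (compositions N) i)).
  apply: eq_bigr => j _; congr (_ * _).
  have := mem_nth [::] (ltn_ord j); rewrite mem_compositions => /andP[cj /eqP sj].
  rewrite Psi_nr // sj big_compositions; apply: eq_bigr => i _.
  by rewrite mxE.
under eq_bigr => j _ do rewrite mulr_sumr.
rewrite exchange_big /=.
transitivity (G alpha); last first.
  rewrite /P_set big_filter [RHS]big_mkcond /=; apply: eq_big_seq => g gN.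
  rewrite act_sum_P_set //; rewrite {1}/P_set mem_filter gN andbT.
  by case: ifP => _; rewrite ?mul1r ?mul0r.
have V := mulVmx (dmat_unit N).
transitivity (\sum_i (1%:M : 'M[rat]_(size (compositions N))) l i * G (nth [::] (compositions N) i)).
  apply: eq_bigr => i _; rewrite -V mxE mulr_suml; apply: eq_bigr => j _.
  by rewrite mulrA.
rewrite (bigD1 l) //= mxE eqxx mul1r la big1 ?addr0 // => i il.
by rewrite mxE eq_sym (negbTE il) mul0r.
Qed.
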